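(* Let $S$ be a polynomial ring over a field $k$ and let $I \subset S$ be a monomial ideal of height $c$. If $I$ is not a complete intersection, then $$\sum_i \beta_i(S/I) \geq 2^c + 2^{c-1}.$$ Furthermore, equality holds if and only if the generating function $\sum_i \beta_i(S/I)t^i$ is either $$(1 + 3t + 2t^2)(1+t)^{c-2} \quad \text{or} \quad (1 + 5t + 5t^2 + t^3)(1+t)^{c-3}.$$
   Context: $\beta_i(S/I)$ denotes the rank of the $i$-th free module in a minimal (graded) free resolution of $S/I$ over $S$. ''$I$ is a complete intersection'' means $I$ is generated by a regular sequence. *)

(* Defs.v *)
From HB Require Import structures.
From mathcomp Require Import all_boot all_order all_algebra.
From mathcomp Require Import mpoly.
Set Implicit Arguments. Unset Strict Implicit. Unset Printing Implicit Defensive.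
Import Order.TTheory GRing.Theory Num.Theory.
Local Open Scope ring_scope.

Section Defs.
Variables (k : fieldType) (n : nat).
Local Notation S := {mpoly k[n]}.

Definition pset := S -> Prop.

Definition ideal_gen (fs : seq S) : pset :=
  fun p => exists a : 'I_(size fs) -> S, p = \sum_(i < size fs) a i * fs`_i.

Definition monomial_ideal (G : seq 'X_{1..n}) : pset :=
  ideal_gen [seq 'X_[m] | m <- G].

Definition is_ideal (P : pset) : Prop :=
  [/\ P 0, (forall a b, P a -> P b -> P (a + b)) & (forall r a, P a -> P (r * a))].

Definition prime_ideal (P : pset) : Prop :=
  [/\ is_ideal P, ~ P 1 & (forall a b, P (a * b) -> P a \/ P b)].

Definition psubset (P Q : pset) : Prop := forall x, P x -> Q x.

Definition prime_chain_to (P : pset) (m : nat) : Prop :=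
  exists Q : nat -> pset,
    [/\ (forall i, (i <= m)%N -> prime_ideal (Q i)),
        (forall i, (i < m)%N -> psubset (Q i) (Q i.+1) /\ exists x, Q i.+1 x /\ ~ Q i x)
      & (forall x, Q m x <-> P x)].

(* Krull height: ht P = sup of chain lengths; ht I = min of ht P over primes P containing I.
   ideal_height I c  <->  ht I = c (in particular I is proper). *)
Definition ideal_height (I : pset) (c : nat) : Prop :=
  (forall Q, prime_ideal Q -> psubset I Q -> prime_chain_to Q c) /\
  (exists P, [/\ prime_ideal P, psubset I P & ~ prime_chain_to P c.+1]).

Definition regular_seq (fs : seq S) : Prop :=
  ~ ideal_gen fs 1 /\
  forall i, (i < size fs)%N -> forall g,
    ideal_gen (take i fs) (fs`_i * g) -> ideal_gen (take i fs) g.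

Definition complete_intersection (I : pset) : Prop :=
  exists fs : seq S, (forall p, I p <-> ideal_gen fs p) /\ regular_seq fs.

(* A finite minimal free resolution of S/I:
     0 -> F_len -> ... -> F_1 -> F_0 = S -> S/I -> 0,  F_i = S^(rank i),
   with differentials d_i : F_{i+1} -> F_i acting on row vectors (v |-> v *m d_i),
   image of d_0 equal to I, exactness at every F_{i+1}, and minimality:
   all entries of all differentials lie in the maximal ideal (x_1,...,x_n),
   i.e. have zero constant term. Then beta_i(S/I) = rank i. *)
Record min_free_resolution (I : pset) := MinFreeRes {
  res_len : nat;
  res_rank : nat -> nat;
  res_map : forall i, 'M[S]_(res_rank i.+1, res_rank i);
  res_rank0 : res_rank 0 = 1%N;
  res_rank_vanish : forall i, (res_len < i)%N -> res_rank i = 0%N;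
  res_image : forall p, I p <->
      exists u : 'rV[S]_(res_rank 1), forall j, (u *m res_map 0) 0 j = p;
  res_exact : forall i (v : 'rV[S]_(res_rank i.+1)),
      v *m res_map i = 0 <-> exists u : 'rV[S]_(res_rank i.+2), v = u *m res_map i.+1;
  res_minimal : forall i r s, (res_map i r s)@_0%MM = 0
}.

Definition betti_sum I (F : min_free_resolution I) : nat :=
  (\sum_(i < (res_len F).+1) res_rank F i)%N.

Definition betti_poly I (F : min_free_resolution I) : {poly int} :=
  \sum_(i < (res_len F).+1) ((res_rank F i)%:R *: 'X^i).

End Defs.

(* Main.v *)
Require Import Defs.
From HB Require Import structures.
From mathcomp Require Import all_boot all_order all_algebra.
From mathcomp Require Import mpoly.
From mathcomp Require Import ring zify.
Set Implicit Arguments. Unset Strict Implicit. Unset Printing Implicit Defensive.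
Import Order.TTheory GRing.Theory Num.Theory.
Local Open Scope ring_scope.

(** The Taylor complex of the generators resolves [S/I], so [rank F_i] is at least
    the [i]-th homology [h_i] of the Taylor complex modulo the maximal ideal. In
    that finite complex the differential keeps only the faces with the same lcm:
    it splits over the lcm's and depends only on the polarised, squarefree,
    generators, i.e. on a family of finite sets.

    For a variable [x] let [I_1] and [I_0] be obtained from a squarefree [I] by
    setting [x = 1] and [x = 0], and let [phi] be the map from Tor([S/I_0]) to
    Tor([S/I_1]). A short exact sequence of Taylor complexes gives
    [sum h(I) = sum h(I_1) + 2 dim ker phi]. So, by induction on the number of
    variables, we may assume that all the [I_1] are complete intersections with
    [c] generators, where [c] is the height, whence [sum h(I_1) = 2^c], and it
    remains to find [x] with [dim ker phi >= 2^(c-2)]. If [I_0] is a complete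
    intersection, then [phi] only sees the generators that [I_0] and [I_1] share.
    Otherwise [sum h(I_0) >= 3 * 2^(c-2)] by induction; any two generators share
    at most one variable, and a generator of degree at least 3 meeting another
    one halves the rank of [phi]. This leaves edge ideals of graphs in which every
    path of length 2 is dominating, where a vertex [x] of maximal degree works,
    with equality only for the pentagon.

    The height is bounded by the size of any set of variables meeting all the
    generators because chains of primes of [k[x_1,...,x_n]] have length at most
    [n]; this follows from the algebraic dependence of [n+1] polynomials. *)

(** * Ranks of submatrices *)

(** Only the inequality [rank F_i >= h_i] is established, and it suffices: the [h_i] already satisfy
    the bound, so if the ranks attain it the two sequences agree term by term and the generating
    function is that of the [h_i]. The target [2^(c-2)] is what [2^c + 2 dim ker phi >= 3 * 2^(c-1)]
    asks for. When [I_0] is not a complete intersection, induction in height [c - 1] gives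
    [dim ker phi >= 3 * 2^(c-2) - rank phi], so [phi] should hit at most half of the
    [2^c]-dimensional Tor of [S/I_1]. That Tor has one basis element for each set [B] of generators
    of [I_1], in pairwise distinct multidegrees; the rank of [phi] is thus bounded by counting the
    [B] that are not excluded by factoring [phi] through an intermediate ideal, and a single
    exclusion beyond half makes the bound strict. In the induction the height is replaced by a lower
    bound on the size of hitting sets, which passes unchanged to [I_1] and with a loss of one to
    [I_0]. *)

Section SubmatrixRank.
Variables (k : fieldType) (E : finType) (s : E -> E -> k).

Implicit Types X Y Z W : {set E}.

Definition coef_mx : 'M[k]_#|E| := \matrix_(a, b) s (enum_val a) (enum_val b).

Definition coord_proj (X : {set E}) : 'M[k]_#|E| :=
  diag_mx (\row_a (enum_val a \in X)%:R).

(** Blocks are padded with zeros to full size, so that images and kernels of different blocks are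
    subspaces of one space. *)
Definition restr_mx (X Y : {set E}) := coord_proj X *m coef_mx *m coord_proj Y.

Definition restr_rank X Y := \rank (restr_mx X Y).

Lemma coord_projE X a b :
  coord_proj X a b = ((a == b) && (enum_val a \in X))%:R.
Proof. by rewrite !mxE; case: eqP => [->|] /=; case: (_ \in X). Qed.

Lemma disjoint_setD X Y : [disjoint X & Y :\: X].
Proof. by rewrite -setI_eq0; apply/eqP/setP => a; rewrite !inE; case: (a \in X). Qed.

Lemma coord_proj0 : coord_proj set0 = 0.
Proof. by apply/matrixP => a b; rewrite coord_projE inE andbF mxE. Qed.

Lemma coord_projM X Y : coord_proj X *m coord_proj Y = coord_proj (X :&: Y).
Proof.
rewrite /coord_proj mulmx_diag; congr diag_mx; apply/rowP => a.
by rewrite !mxE inE; do 2!case: (_ \in _); rewrite ?mulr0 ?mulr1.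
Qed.

Lemma coord_projU X Y : [disjoint X & Y] ->
  coord_proj (X :|: Y) = coord_proj X + coord_proj Y.
Proof.
move=> dXY; rewrite /coord_proj -raddfD; congr diag_mx; apply/rowP => a.
rewrite !mxE inE; case aX: (_ \in X) => /=; last by rewrite add0r.
by rewrite (disjointFr dXY aX) addr0.
Qed.

Lemma coord_proj_sub X Y : X \subset Y -> (coord_proj X <= coord_proj Y)%MS.
Proof. by move/setIidPl => <-; rewrite -coord_projM submxMl. Qed.

Lemma coord_projK X Y : X \subset Y -> coord_proj X *m coord_proj Y = coord_proj X.
Proof. by rewrite coord_projM => /setIidPl ->. Qed.

Lemma coord_projKr X Y : X \subset Y -> coord_proj Y *m coord_proj X = coord_proj X.
Proof. by rewrite coord_projM setIC => /setIidPl ->. Qed.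

Lemma rank_coord_proj X : \rank (coord_proj X) = #|X|.
Proof.
pose sel : 'M[k]_(#|X|, #|E|) := \matrix_(i, b) (enum_val i == enum_val b)%:R.
have selT : sel *m sel^T = 1%:M.
  apply/matrixP => i j; rewrite !mxE.
  rewrite (bigD1 (enum_rank (enum_val i))) //= !mxE enum_rankK eqxx mul1r.
  rewrite big1 ?addr0 => [|b /negPf nb]; last first.
    rewrite !mxE; case: eqP => [eib|]; last by rewrite mul0r.
    by move: nb; rewrite eib enum_valK eqxx.
  by rewrite eq_sym (inj_eq enum_val_inj).
have def : coord_proj X = sel^T *m sel.
  apply/matrixP => a b; rewrite coord_projE mxE.
  have [aX|naX] := boolP (enum_val a \in X); last first.
    rewrite andbF big1 // => i _; rewrite !mxE; case: eqP => [eia|]; last by rewrite mul0r.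
    by move: naX; rewrite -eia enum_valP.
  rewrite (bigD1 (enum_rank_in aX (enum_val a))) //= !mxE enum_rankK_in // eqxx mul1r.
  rewrite big1 ?addr0 ?andbT ?(inj_eq enum_val_inj) // => i /negPf ni.
  rewrite !mxE; case: eqP => [eia|]; last by rewrite mul0r.
  by case/negP: (negbT ni); apply/eqP/enum_val_inj; rewrite enum_rankK_in.
apply/eqP; rewrite eqn_leq; apply/andP; split.
  by rewrite def (leq_trans (mxrankM_maxl _ _)) // rank_leq_col.
rewrite -(mxrank1 k #|X|) -(mulmx1 1%:M) -{1}selT -selT mulmxA -(mulmxA sel) -def.
exact: leq_trans (mxrankM_maxl _ _) (mxrankM_maxr _ _).
Qed.

Lemma restr_mx0 (X Y : {set E}) :
  (forall A B, A \in X -> B \in Y -> s A B = 0) -> restr_mx X Y = 0.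
Proof.
move=> s0; apply/matrixP => a b.
rewrite /restr_mx /coord_proj mul_diag_mx mul_mx_diag !mxE.
case aX: (_ \in X); case bY: (_ \in Y); rewrite ?mul0r ?mulr0 //.
by rewrite s0 // mulr0 mul0r.
Qed.

Lemma restr_mxM0 (X Y Z : {set E}) :
  (forall A C, A \in X -> C \in Z -> \sum_(B in Y) s A B * s B C = 0) ->
  coord_proj X *m coef_mx *m coord_proj Y *m coef_mx *m coord_proj Z = 0.
Proof.
move=> s0; apply/matrixP => a c.
rewrite /coord_proj mul_mx_diag -2!mulmxA mul_diag_mx !mxE.
case aX: (_ \in X); last by rewrite !mul0r.
case cZ: (_ \in Z); last by rewrite mulr0.
rewrite mul1r mulr1 -[RHS](s0 _ _ aX cZ).
rewrite [RHS](reindex (fun b : 'I_#|E| => enum_val b)) /=; last first.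
  by apply: onW_bij; apply: enum_val_bij.
rewrite [RHS]big_mkcond /=; apply: eq_bigr => b _.
rewrite mul_diag_mx !mxE; case: (_ \in Y); first by rewrite mul1r.
by rewrite mul0r mulr0.
Qed.

(** The dimension of the homology at [Y] of [X -> Y -> W]; the truncated subtractions are exact as
    soon as [complex_at X Y W] holds. *)
Definition hom_dim (X Y W : {set E}) := (#|Y| - restr_rank X Y - restr_rank Y W)%N.

Definition complex_at (X Y W : {set E}) :=
  forall A C, A \in X -> C \in W -> \sum_(B in Y) s A B * s B C = 0.

Definition no_arrow (X Y : {set E}) := forall A B, A \in X -> B \in Y -> s A B = 0.

Definition cycles (Y W : {set E}) := (coord_proj Y :&: kermx (restr_mx Y W))%MS.

Lemma rank_cycles Y W : (\rank (cycles Y W) + restr_rank Y W = #|Y|)%N.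
Proof.
rewrite -rank_coord_proj addnC.
rewrite -(mxrank_mul_ker (coord_proj Y) (restr_mx Y W)) /restr_rank /restr_mx.
by rewrite !mulmxA coord_projK.
Qed.

Lemma boundary_sub_cycles X Y W : complex_at X Y W ->
  (restr_mx X Y <= cycles Y W)%MS.
Proof.
move=> cx; rewrite sub_capmx submxMl /=; apply/sub_kermxP.
by rewrite /restr_mx !mulmxA -(mulmxA _ (coord_proj Y) (coord_proj Y)) coord_projK // restr_mxM0.
Qed.

Lemma complex_rank_le X Y W : complex_at X Y W ->
  (restr_rank X Y + restr_rank Y W <= #|Y|)%N.
Proof.
by move=> /boundary_sub_cycles/mxrankS; rewrite -(rank_cycles Y W) leq_add2r.
Qed.

Lemma hom_dimE X Y W : complex_at X Y W ->
  (hom_dim X Y W + restr_rank X Y + restr_rank Y W = #|Y|)%N.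
Proof. by move/complex_rank_le; rewrite /hom_dim; lia. Qed.

(** * Block triangular matrices *)

Section Split.
Variables X XQ XR Y YQ YR : {set E}.
Hypotheses (defX : X = XQ :|: XR) (dX : [disjoint XQ & XR]).
Hypotheses (defY : Y = YQ :|: YR) (dY : [disjoint YQ & YR]).
Hypothesis QR0 : no_arrow XQ YR.

Lemma restr_mx_projR : restr_mx X Y *m coord_proj YR = restr_mx XR YR.
Proof.
rewrite /restr_mx -!mulmxA coord_projKr ?defY ?subsetUr // !mulmxA.
by rewrite defX coord_projU // !mulmxDl [X in X + _ = _]restr_mx0 // add0r.
Qed.

Lemma rank_projR :
  (restr_rank XR YR + \rank (restr_mx X Y :&: kermx (coord_proj YR))%MS
   = restr_rank X Y)%N.
Proof. by rewrite /restr_rank -restr_mx_projR mxrank_mul_ker. Qed.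

Lemma rank_split_le :
  (restr_rank XQ YQ + restr_rank XR YR <= restr_rank X Y)%N.
Proof.
rewrite -rank_projR addnC leq_add2l; apply: mxrankS; rewrite sub_capmx.
apply/andP; split; last first.
  apply/sub_kermxP; rewrite /restr_mx -mulmxA coord_projM.
  move: dY; rewrite -setI_eq0 => /eqP ->; rewrite coord_proj0 mulmx0 //.
apply/submxP; exists (coord_proj XQ); rewrite /restr_mx !mulmxA.
rewrite coord_projK ?defX ?subsetUl // defY coord_projU // mulmxDr.
by rewrite [X in _ = _ + X]restr_mx0 // addr0.
Qed.

End Split.

(** A cycle of [Q] that bounds in [M] is a boundary of the whole complex that vanishes on [YR], so
    it counts in the rank beyond the [R] block. Cycles of [Q] and boundaries of [M] both lie among
    the cycles of [M], hence their intersection has at least the dimension of the cycles of [Q]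
    minus the homology of [M]. *)
Lemma rank_factor_le (X XQ XR XM Y YQ YR YM WQ WM : {set E}) :
    X = XQ :|: XR -> [disjoint XQ & XR] ->
    Y = YQ :|: YR -> [disjoint YQ & YR] -> no_arrow XQ YR ->
    XM \subset X -> YM \subset Y -> YQ \subset YM -> WQ \subset WM ->
    no_arrow XM (Y :\: YM) -> no_arrow YQ (WM :\: WQ) ->
    complex_at XM YM WM ->
  (#|YQ| + restr_rank XR YR
     <= restr_rank X Y + restr_rank YQ WQ + hom_dim XM YM WM)%N.
Proof.
move=> defX dX defY dY QR0 sXM sYM sYQ sWQ M0 Q0 cx.
rewrite -(rank_cycles YQ WQ) -(rank_projR defX dX defY QR0).
set U := restr_mx X Y; set K := kermx _.
have ZQM : (cycles YQ WQ <= cycles YM WM)%MS.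
  rewrite sub_capmx; apply/andP; split.
    by apply: submx_trans (capmxSl _ _) _; apply: coord_proj_sub.
  apply/sub_kermxP; have /submxP[C defC] := capmxSl (coord_proj YQ) (kermx (restr_mx YQ WQ)).
  have /sub_kermxP : (cycles YQ WQ <= kermx (restr_mx YQ WQ))%MS by apply: capmxSr.
  rewrite /cycles defC => CQ0; rewrite -(setID WM WQ) (setIidPr sWQ) /restr_mx.
  rewrite coord_projU; last exact: disjoint_setD.
  rewrite !mulmxDr !mulmxA -(mulmxA C) coord_projK //.
  rewrite -!mulmxA in CQ0 *; move: CQ0; rewrite !mulmxA -(mulmxA C) coord_projK // => ->.
  by rewrite add0r -2!mulmxA [X in C *m X](_ : _ = 0) ?mulmx0 // -[RHS](restr_mx0 Q0) /restr_mx mulmxA.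
have BM := boundary_sub_cycles cx.
have BU : (restr_mx XM YM <= U)%MS.
  apply/submxP; exists (coord_proj XM); rewrite /U /restr_mx !mulmxA coord_projK //.
  rewrite -(setID Y YM) (setIidPr sYM) coord_projU; last first.
    exact: disjoint_setD.
  by rewrite mulmxDr [X in _ + X](_ : _ = 0) ?addr0 // -[RHS](restr_mx0 M0) /restr_mx.
have ZK : (cycles YQ WQ <= K)%MS.
  apply: submx_trans (capmxSl _ _) _; apply/sub_kermxP; rewrite coord_projM.
  by move: dY; rewrite -setI_eq0 => /eqP ->; rewrite coord_proj0.
have: (cycles YQ WQ :&: restr_mx XM YM <= U :&: K)%MS.
  rewrite sub_capmx (submx_trans (capmxSr _ _) BU).
  by rewrite (submx_trans (capmxSl _ _) ZK).
move/mxrankS => le1.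
have le2 : (cycles YQ WQ + restr_mx XM YM <= cycles YM WM)%MS by rewrite addsmx_sub ZQM.
move/mxrankS: le2 => le2.
have := mxrank_sum_cap (cycles YQ WQ) (restr_mx XM YM).
have := rank_cycles YM WM; rewrite /hom_dim /restr_rank in le1 le2 *.
by set u := \rank (U :&: K)%MS in le1 *; lia.
Qed.

(** The [XR] part of a boundary from [VR] differs from the full boundary by a chain on [XQ]; as the
    differential squares to zero, its image lies in the image of [XQ]. Only a complement [C] of
    these boundaries in the space on [XR] can add to the rank. *)
Lemma rank_quotient_le (X XQ XR Y YQ YR VR : {set E}) :
    X = XQ :|: XR -> [disjoint XQ & XR] ->
    Y = YQ :|: YR -> [disjoint YQ & YR] -> no_arrow XQ YR ->
    complex_at VR X Y ->
  (restr_rank X Y + restr_rank VR XR <= #|XR| + restr_rank XQ YQ)%N.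
Proof.
move=> defX dX defY dY QR0 cx.
have XQY : restr_mx XQ Y = restr_mx XQ YQ.
  by rewrite /restr_mx defY coord_projU // mulmxDr [X in _ + X = _](restr_mx0 QR0) addr0.
set B := restr_mx VR XR; set C := (coord_proj XR :\: B)%MS.
have BX : (B <= coord_proj XR)%MS by rewrite submxMl.
have rC : (\rank C + \rank B = #|XR|)%N.
  by rewrite -rank_coord_proj -(mxrank_cap_compl (coord_proj XR) B) addnC (capmx_idPr BX).
have XRsub : (coord_proj XR <= C + B)%MS.
  by rewrite /C -{1}(addsmx_diff_cap_eq (coord_proj XR) B) addsmxS // capmxSr.
have BD : (B *m (coef_mx *m coord_proj Y) <= restr_mx XQ YQ)%MS.
  have -> : B *m (coef_mx *m coord_proj Y)
          = - (coord_proj VR *m coef_mx) *m restr_mx XQ YQ.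
    rewrite -XQY; apply/eqP; rewrite -subr_eq0 mulNmx opprK.
    rewrite /B /restr_mx !mulmxA addrC -!mulmxDl -mulmxDr -coord_projU // -defX.
    by apply/eqP; rewrite restr_mxM0.
  exact: submxMl.
have: (restr_mx X Y <= restr_mx XQ YQ + C *m (coef_mx *m coord_proj Y))%MS.
  rewrite /restr_mx defX coord_projU // !mulmxDl addmx_sub //.
    by rewrite [X in (X <= _)%MS]XQY addsmxSl.
  rewrite -mulmxA; apply: submx_trans (submxMr _ XRsub) _.
  by rewrite addsmxMr addsmx_sub addsmxSr /= (submx_trans BD) ?addsmxSl.
move/mxrankS/leq_trans/(_ (mxrank_adds_leqif _ _)) => le1.
have := mxrankM_maxl C (coef_mx *m coord_proj Y).
by rewrite /restr_rank in le1 *; rewrite -/B -rC; lia.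
Qed.

Lemma restr_rank_le_diag X Y (Y0 : {set E}) (g : E -> E) :
    Y0 \subset Y -> {in Y0, forall A, g A \in X} ->
    {in Y0 &, forall A B, (s (g A) B == 0) = (A != B)} ->
  (#|Y0| <= restr_rank X Y)%N.
Proof.
move=> sY gX sg; rewrite -rank_coord_proj.
apply: leq_trans (mxrankM_maxl _ (coord_proj Y0)); apply: mxrankS.
apply/row_subP => a; set A := enum_val a.
have [aY0|naY0] := boolP (A \in Y0); last first.
  rewrite [row a _](_ : _ = 0) ?sub0mx //; apply/rowP => b.
  by rewrite mxE coord_projE (negPf naY0) andbF mxE.
pose u : 'rV[k]_#|E| := (s (g A) A)^-1 *: delta_mx 0 (enum_rank (g A)).
apply/submxP; exists u; apply/rowP => b.
rewrite /restr_mx -!mulmxA coord_projKr // [LHS]mxE coord_projE.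
rewrite /coord_proj mul_mx_diag mul_diag_mx /u -scalemxAl -rowE !mxE enum_rankK gX // mul1r -/A.
have [bY0|nbY0] := boolP (enum_val b \in Y0); last first.
  rewrite !mulr0; case: eqP => [eab|] //=.
  by move: nbY0; rewrite -eab aY0.
have := sg _ _ aY0 bY0; have := sg _ _ aY0 aY0.
rewrite eqxx /= => /negbT nz sab; rewrite aY0 andbT mulr1.
have [eab|neab] := eqVneq a b; first by rewrite -eab mulVf.
by move: sab; rewrite (inj_eq enum_val_inj) neab => /eqP ->; rewrite mulr0.
Qed.

End SubmatrixRank.

(** * Homology of families of faces of a simplex *)

Section SimplexBoundary.
Variables (R : pzRingType) (m : nat).
Implicit Types (A B C : {set 'I_m}) (i j : 'I_m).

Definition face_sign A i : R := (-1) ^+ #|[set j in A | (j < i)%N]|.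

Definition bd A B : R := \sum_(i in A | B == A :\ i) face_sign A i.

Lemma bd_face A i : i \in A -> bd A (A :\ i) = face_sign A i.
Proof.
move=> iA; rewrite /bd (big_pred1 i) // => j /=.
apply/andP/eqP => [[jA /eqP/setP/(_ j)]|->]; last by rewrite eqxx iA.
by rewrite !inE eqxx /= jA andbT => /negbFE/eqP.
Qed.

Lemma bd_eq0 A B : (forall i, i \in A -> B != A :\ i) -> bd A B = 0.
Proof. by move=> nB; rewrite /bd big_pred0 // => i; case iA: (i \in A) => //=; apply/negbTE/nB. Qed.

Lemma bd_nz A B : bd A B != 0 -> exists2 i, i \in A & B = A :\ i.
Proof.
move=> nz; have [i /andP[iA /eqP ->]|ni] := pickP [pred i in A | B == A :\ i].
  by exists i.
by case/negP: nz; rewrite /bd big_pred0 // => i; apply: ni.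
Qed.

Lemma face_signD A i j : i \in A -> (i < j)%N ->
  face_sign (A :\ i) j = - face_sign A j.
Proof.
move=> iA ij; rewrite /face_sign.
rewrite [in RHS](_ : [set _ in A | _] = i |: [set l in A :\ i | (l < j)%N]).
  by rewrite cardsU1 !inE eqxx /= exprS mulN1r opprK.
by apply/setP => l; rewrite !inE; case: eqP => [->|] //=; rewrite iA ij.
Qed.

Lemma face_signK A i j : (i < j)%N -> face_sign (A :\ j) i = face_sign A i.
Proof.
move=> ij; rewrite /face_sign; congr (_ ^+ _); apply: eq_card => l.
rewrite !inE; case: eqP => [->|] //=; rewrite ltnNge (ltnW ij) andbF //.
Qed.

Lemma bd_bd A C : \sum_B bd A B * bd B C = 0.
Proof.
pose F i j := if [&& i \in A, j \in A, i != j & C == A :\ i :\ j]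
              then face_sign A i * face_sign (A :\ i) j else 0.
transitivity (\sum_i \sum_j F i j).
  transitivity (\sum_B \sum_(i in A | B == A :\ i) face_sign A i * bd (A :\ i) C).
    apply: eq_bigr => B _; rewrite /bd mulr_suml.
    by apply: eq_bigr => i /andP[_ /eqP ->].
  rewrite (exchange_big_dep (mem A)) /=; last by move=> B i _ /andP[].
  rewrite [LHS]big_mkcond; apply: eq_bigr => i _.
  case iA: (i \in A); last by rewrite big1 // => j _; rewrite /F iA.
  rewrite (big_pred1 (A :\ i)) //.
  rewrite /bd mulr_sumr [LHS]big_mkcond; apply: eq_bigr => j _.
  rewrite /F iA !inE /= (eq_sym j i); case: (j \in A); case: (i != j) => //=.
have Fanti i j : (i < j)%N -> F i j = - F j i.
  move=> ij; rewrite /F [j == i]eq_sym.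
  have -> : A :\ j :\ i = A :\ i :\ j by rewrite !setDDl setUC.
  case iA: (i \in A); case jA: (j \in A) => //=; rewrite ?oppr0 //.
  case: ifP => _; last by rewrite oppr0.
  by rewrite face_signD // face_signK // /face_sign -!exprD mulrN -exprD addnC.
have Fii i : F i i = 0 by rewrite /F eqxx /= !andbF.
rewrite pair_big /=.
rewrite (bigID (fun p : 'I_m * 'I_m => (p.1 < p.2)%N)) /=.
rewrite [X in _ + X](bigID (fun p : 'I_m * 'I_m => (p.2 < p.1)%N)) /=.
rewrite [X in _ + (_ + X)]big1 ?addr0; last first.
  move=> [i j] /= /andP[]; rewrite -!leqNgt => le1 le2.
  by have -> : i = j by apply: val_inj; apply/eqP; rewrite eqn_leq le1 le2.
rewrite [X in _ + X](reindex (fun p : 'I_m * 'I_m => (p.2, p.1))) /=; last first.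
  by exists (fun p => (p.2, p.1)) => -[].
rewrite [X in _ + X](eq_bigl (fun p : 'I_m * 'I_m => (p.1 < p.2)%N)); last first.
  by move=> [i j] /=; case: ltngtP.
rewrite -big_split big1 //= => -[i j] /= ij.
by rewrite Fanti // addNr.
Qed.

End SimplexBoundary.

(** * Subcomplexes, quotients and the long exact sequence *)

Section FamilyHomology.
Variables (k : fieldType) (m : nat).
Local Notation E := {set 'I_m}.
Local Notation s := (@bd k m).
Implicit Types (P Q M : {set E}) (A B C : E) (i n : nat).

(** The condition under which the restricted incidence coefficients still square to zero: both
    intermediate faces of a composite are present. *)
Definition convex P := forall A B C,
  A \in P -> C \in P -> A \subset B -> B \subset C -> B \in P.

(** [Q] spans a subcomplex of [P], and [P :\: Q] the quotient complex. *)
Definition down_in Q P := forall A B, A \in Q -> B \in P -> B \subset A -> B \in Q.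

(* Level [n] consists of the sets of cardinality [n - 1], so that level 0 is empty. *)
Definition level P n := [set A in P | #|A|.+1 == n].

Definition level_rank P n := restr_rank s (level P n.+1) (level P n).

(** The index is the cardinality of the faces, that is, the homological degree in the Taylor
    complex. *)
Definition hdim P i := hom_dim s (level P i.+2) (level P i.+1) (level P i).

(** The rank of the connecting map from the homology of the quotient [P :\: Q] in degree [n] to that
    of [Q] in degree [n - 1]. *)
Definition excess P Q n := (level_rank P n - level_rank Q n - level_rank (P :\: Q) n)%N.

Lemma level0 P : level P 0 = set0.
Proof. by apply/setP => A; rewrite !inE andbF. Qed.

Lemma levelP P n A : reflect (A \in P /\ #|A|.+1 = n) (A \in level P n).
Proof. by rewrite inE; apply: (iffP andP) => -[-> /eqP]. Qed.

Lemma level_complex P n : convex P ->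
  complex_at s (level P n.+2) (level P n.+1) (level P n).
Proof.
move=> cP A C /levelP[AP /eqP cA] /levelP[CP cC].
rewrite -[RHS](bd_bd k A C) big_mkcond; apply: eq_bigr => B _.
case: ifP => // /negP nB; apply/esym/eqP; rewrite mulf_eq0; apply/norP => -[].
move=> /bd_nz[i iA defB] /bd_nz[j jB defC]; apply: nB; apply/levelP; split.
  by apply: cP CP AP _ _; rewrite ?defC defB subsetDl.
by apply/eqP; move: cA; rewrite (cardsD1 i) iA defB.
Qed.

Lemma down_no_arrow Q P n : down_in Q P ->
  no_arrow s (level Q n.+1) (level (P :\: Q) n).
Proof.
move=> dQ A B /levelP[AQ _] /levelP[/setDP[BP nBQ] _].
apply: bd_eq0 => i iA; apply: contra nBQ => /eqP defB.
by apply: dQ AQ BP _; rewrite defB subsetDl.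
Qed.

Lemma convex_down Q P : convex P -> Q \subset P -> down_in Q P -> convex Q.
Proof.
move=> cP /subsetP sQ dQ A B C AQ CQ sAB sBC.
exact: (dQ C B CQ (cP A B C (sQ _ AQ) (sQ _ CQ) sAB sBC) sBC).
Qed.

Lemma convex_diff Q P : convex P -> down_in Q P -> convex (P :\: Q).
Proof.
move=> cP dQ A B C /setDP[AP nAQ] /setDP[CP _] sAB sBC.
have BP : B \in P := cP A B C AP CP sAB sBC.
by rewrite inE BP andbT; apply: contra nAQ => BQ; apply: dQ BQ AP sAB.
Qed.

Lemma level_split Q P n : Q \subset P ->
  level P n = level Q n :|: level (P :\: Q) n.
Proof.
move/subsetP => sQ; apply/setP => A; rewrite !inE -andb_orl; congr (_ && _).
by case AQ: (A \in Q) => //=; rewrite sQ.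
Qed.

Lemma level_disjoint Q P n : [disjoint level Q n & level (P :\: Q) n].
Proof.
by rewrite -setI_eq0; apply/eqP/setP => A; rewrite !inE; case: (A \in Q); rewrite ?andbF.
Qed.

Lemma hdimE P i : convex P ->
  (hdim P i + level_rank P i.+1 + level_rank P i = #|level P i.+1|)%N.
Proof. by move=> cP; apply: hom_dimE; apply: level_complex. Qed.

Lemma level_rank0 P : level_rank P 0 = 0%N.
Proof.
by rewrite /level_rank level0 /restr_rank /restr_mx coord_proj0 mulmx0 mxrank0.
Qed.

Lemma excess0 P Q : excess P Q 0 = 0%N.
Proof. by rewrite /excess level_rank0. Qed.

Lemma excessE P Q n : Q \subset P -> down_in Q P ->
  (excess P Q n + level_rank Q n + level_rank (P :\: Q) n = level_rank P n)%N.
Proof.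
move=> sQ dQ.
suff : (level_rank Q n + level_rank (P :\: Q) n <= level_rank P n)%N.
  by rewrite /excess; lia.
apply: rank_split_le; rewrite ?(level_split _ sQ) ?level_disjoint //.
exact: down_no_arrow.
Qed.

Lemma card_level_split Q P n : Q \subset P ->
  #|level P n| = (#|level Q n| + #|level (P :\: Q) n|)%N.
Proof.
move=> sQ; rewrite (level_split _ sQ) cardsU.
by rewrite (eqP (_ : _ :&: _ == set0)) ?cards0 ?subn0 // setI_eq0 level_disjoint.
Qed.

(** Dimension count in the long exact sequence of the pair. *)
Lemma hdim_split P Q i : convex P -> Q \subset P -> down_in Q P ->
  (hdim P i + excess P Q i.+1 + excess P Q i = hdim Q i + hdim (P :\: Q) i)%N.
Proof.
move=> cP sQ dQ; have := card_level_split i.+1 sQ.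
rewrite -!hdimE //; [|exact: convex_diff|exact: convex_down sQ dQ].
by have := excessE i sQ dQ; have := excessE i.+1 sQ dQ; lia.
Qed.

(** The image of the connecting map is the kernel of the map from the homology of [Q] to that of
    [P]; that map factors through the homology of [M], which bounds its rank. *)
Lemma excess_ge P M Q i : convex P -> Q \subset M -> M \subset P ->
  down_in Q P -> down_in M P -> (hdim Q i <= excess P Q i.+1 + hdim M i)%N.
Proof.
move=> cP sQM sMP dQ dM; have sQ := subset_trans sQM sMP.
have cQ := convex_down cP sQ dQ; have cM := convex_down cP sMP dM.
have dQM : down_in Q M by move=> A B AQ BM; apply: dQ AQ (subsetP sMP _ BM).
have sub_level (X Y : {set E}) n : X \subset Y -> level X n \subset level Y n.
  by move/subsetP => sXY; apply/subsetP => A /levelP[/sXY AY cA]; apply/levelP.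
have levD (X Y : {set E}) n : level Y n :\: level X n = level (Y :\: X) n.
  by apply/setP => A; rewrite !inE; case: (_ == n); rewrite ?andbF ?andbT.
have := @rank_factor_le k E s (level P i.+2) (level Q i.+2) (level (P :\: Q) i.+2)
  (level M i.+2) (level P i.+1) (level Q i.+1) (level (P :\: Q) i.+1) (level M i.+1)
  (level Q i) (level M i) (level_split _ sQ) (level_disjoint _ _ _)
  (level_split _ sQ) (level_disjoint _ _ _) (down_no_arrow dQ)
  (sub_level _ _ _ sMP) (sub_level _ _ _ sMP) (sub_level _ _ _ sQM) (sub_level _ _ _ sQM).
rewrite !levD => /(_ (down_no_arrow dM) (down_no_arrow dQM) (level_complex cM)).
rewrite -/(hdim M i) -!/(level_rank _ _) -(hdimE i cQ).
by have := excessE i.+1 sQ dQ; lia.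
Qed.

Lemma hdim_acyclic_quotient P Q i : convex P -> Q \subset P -> down_in Q P ->
  (forall n, hdim (P :\: Q) n = 0%N) -> hdim P i = hdim Q i.
Proof.
move=> cP sQ dQ acyc.
have ex0 n : excess P Q n = 0%N.
  have := @rank_quotient_le k E s (level P n.+1) (level Q n.+1) (level (P :\: Q) n.+1)
    (level P n) (level Q n) (level (P :\: Q) n) (level (P :\: Q) n.+2)
    (level_split _ sQ) (level_disjoint _ _ _) (level_split _ sQ) (level_disjoint _ _ _)
    (down_no_arrow dQ).
  rewrite -!/(level_rank _ _) => le1.
  have {}le1 := le1 (fun A C hA hC => level_complex cP (subsetP (_ : _ \subset level P n.+2) A hA) hC).
  have {}le1 : (level_rank P n + level_rank (P :\: Q) n.+1 <= 
           #|level (P :\: Q) n.+1| + level_rank Q n)%N.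
    by apply: le1; apply/subsetP => A /levelP[/setDP[? _] ?]; apply/levelP.
  have := hdimE n (convex_diff cP dQ); rewrite acyc.
  by have := excessE n sQ dQ; lia.
by have := hdim_split i cP sQ dQ; rewrite !ex0 acyc !addn0.
Qed.

(** Faces come in pairs [A], [j |: A]. These pairs give a diagonal block of signs, so each rank is
    at least the number of faces without [j], and the ranks on both sides of a level exhaust it. *)
Lemma hdim_cone P (j : 'I_m) i : convex P ->
  {in P, forall A, j |: A \in P /\ A :\ j \in P} -> hdim P i = 0%N.
Proof.
move=> cP tog; have := hdimE i cP.
have key n : (#|[set A in level P n | j \notin A]| <= level_rank P n)%N.
  apply: (@restr_rank_le_diag _ _ _ _ _ _ (fun A => j |: A)).
  - by apply/subsetP => A; rewrite inE => /andP[].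
  - move=> A; rewrite inE => /andP[/levelP[AP <-] jA]; apply/levelP.
    by split; [case: (tog A AP)|rewrite cardsU1 jA].
  move=> A B; rewrite !inE => /andP[_ jA] /andP[_ jB].
  have jAK : (j |: A) :\ j = A by apply: setU1K.
  have [<-|neAB] := eqVneq A B.
    rewrite -{2}jAK bd_face ?setU11 // /face_sign.
    by apply/negbTE; rewrite signr_eq0.
  apply/eqP/bd_eq0 => l lA; apply/eqP => defB.
  have [elj|nelj] := eqVneq l j; first by case/eqP: neAB; rewrite defB elj jAK.
  by case/negP: jB; rewrite defB !inE eqxx eq_sym nelj.
have := key i; have := key i.+1.
have : (#|[set A in level P i.+1 | j \in A]| <= #|[set A in level P i | j \notin A]|)%N.
  rewrite -(card_in_imset (f := fun A => A :\ j)).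
    apply: subset_leq_card; apply/subsetP => _ /imsetP[A + ->].
    rewrite inE => /andP[/levelP[AP [cA]] jA]; rewrite !inE eqxx andbT /=.
    by case: (tog A AP) => _ -> /=; rewrite -cA (cardsD1 j A) jA.
  move=> A B; rewrite !inE => /andP[_ jA] /andP[_ jB] eAB.
  by rewrite -(setD1K jA) -(setD1K jB) eAB.
have : (#|[set A in level P i.+1 | j \in A]| + #|[set A in level P i.+1 | j \notin A]|
        = #|level P i.+1|)%N.
  rewrite -[RHS](cardsID [set A : E | j \in A]); congr addn; apply: eq_card => A.
    by rewrite !inE.
  by rewrite !inE andbC.
by lia.
Qed.

End FamilyHomology.

(** * Families of sets *)

Local Open Scope nat_scope.

Section SetFamilies.
Variables (k : fieldType) (m : nat) (V : finType).
Implicit Types (f : 'I_m -> {set V}) (J K A B : {set 'I_m}) (b T : {set V}) (x y : V).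

(** Sets of variables are squarefree monomials and unions are lcm's. An ideal is a family [f] with a
    set [J] of active indices: setting a variable to 0 shrinks [J], setting it to 1 changes [f], and
    subideals share one index type. *)
Definition cover_of f A := \bigcup_(i in A) f i.

Definition weight_fam f J b := [set A : {set 'I_m} | (A \subset J) && (cover_of f A == b)].

Definition whdim f J b i := hdim k (weight_fam f J b) i.

Definition fbetti f J i := \sum_(b : {set V}) whdim f J b i.

Definition dominates f K J := forall j, j \in J -> exists2 l, l \in K & f l \subset f j.

Definition antichain f J := {in J &, forall i j, f i \subset f j -> i = j}.

Definition pairwise_disjoint f J := {in J &, forall i j, i != j -> [disjoint f i & f j]}.

Definition nonempty_on f J := {in J, forall j, f j != set0}.

(** Hitting sets are the sets of variables generating a prime that contains the ideal. *)
Definition hitting f J T := forall j, j \in J -> f j :&: T != set0.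

Definition del f x := fun j => f j :\ x.

Definition avoiding f J x := [set j in J | x \notin f j].

Lemma cover_ofS f A B : A \subset B -> cover_of f A \subset cover_of f B.
Proof.
move/subsetP => sAB; apply/bigcupsP => i /sAB iB; exact: bigcup_sup.
Qed.

Lemma cover_sub f A j : j \in A -> f j \subset cover_of f A.
Proof. by move=> jA; apply: bigcup_sup. Qed.

Lemma cover_ofP f A x : reflect (exists2 j, j \in A & x \in f j) (x \in cover_of f A).
Proof. exact: bigcupP. Qed.

Lemma cover_setU1 f A j : cover_of f (j |: A) = f j :|: cover_of f A.
Proof.
apply/setP => x; apply/cover_ofP/setUP => [[l]|].
  by case/setU1P => [->|lA] xl; [left|right; apply/cover_ofP; exists l].
case=> [xj|/cover_ofP[l lA xl]]; first by exists j; rewrite ?setU11.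
by exists l; rewrite ?inE ?lA ?orbT.
Qed.

Lemma weight_famP f J b A :
  reflect (A \subset J /\ cover_of f A = b) (A \in weight_fam f J b).
Proof. by rewrite inE; apply: (iffP andP) => -[? /eqP]. Qed.

Lemma weight_fam_convex f J b : convex (weight_fam f J b).
Proof.
move=> A B C /weight_famP[sA cA] /weight_famP[sC cC] sAB sBC; apply/weight_famP.
split; first exact: subset_trans sBC sC.
by apply/eqP; rewrite eqEsubset -{1}cC -cA !cover_ofS.
Qed.

Lemma weight_fam_sub f J K b : K \subset J -> weight_fam f K b \subset weight_fam f J b.
Proof.
move=> sKJ; apply/subsetP => A /weight_famP[sA cA]; apply/weight_famP.
by split=> //; apply: subset_trans sKJ.
Qed.

Lemma weight_fam_down f J K b : down_in (weight_fam f K b) (weight_fam f J b).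
Proof.
move=> A B /weight_famP[sA _] /weight_famP[_ cB] sBA; apply/weight_famP.
by split=> //; apply: subset_trans sA.
Qed.

(** The faces containing the redundant [j] form a cone with apex [l], since [l] does not change an
    lcm to which [j] contributes. *)
Lemma whdim_remove f J b i l j : l \in J -> j \in J -> l != j -> f l \subset f j ->
  whdim f J b i = whdim f (J :\ j) b i.
Proof.
move=> lJ jJ nlj slj; apply: hdim_acyclic_quotient.
- exact: weight_fam_convex.
- by apply: weight_fam_sub; apply: subsetDl.
- exact: weight_fam_down.
move=> n; apply: (@hdim_cone _ _ _ l).
  by apply: convex_diff; [apply: weight_fam_convex|apply: weight_fam_down].
move=> A /setDP[/weight_famP[sA cA] nA].
have jA : j \in A.
  apply: contraR nA => njA; apply/weight_famP; split=> //.
  by rewrite subsetD1 sA.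
have key B : B \subset J -> j \in B -> cover_of f B = b ->
    B \in weight_fam f J b :\: weight_fam f (J :\ j) b.
  move=> sB jB cB; apply/setDP; split; first exact/weight_famP.
  by apply/negP => /weight_famP[]; rewrite subsetD1 jB andbF.
have cU : cover_of f (l |: A) = b.
  rewrite cover_setU1 cA; apply/setUidPr; rewrite -cA.
  exact: subset_trans slj (cover_sub f jA).
split; apply: key => //; rewrite ?inE ?jA ?orbT ?(eq_sym j) ?nlj //.
- by rewrite subUset sub1set lJ.
- exact: subset_trans (subsetDl _ _) sA.
rewrite -cU; have <- : l |: (A :\ l) = l |: A by apply/setP => y; rewrite !inE; case: eqP.
rewrite cover_setU1; apply/esym/setUidPr; apply: subset_trans slj _.
by apply: cover_sub; rewrite !inE jA eq_sym nlj.
Qed.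

Lemma whdim_dominates f K J b i : K \subset J -> dominates f K J ->
  whdim f J b i = whdim f K b i.
Proof.
elim: {J}#|J| {-2}J (leqnn #|J|) => [|n IH] J.
  by rewrite leqn0 cards_eq0 => /eqP ->; rewrite subset0 => /eqP ->.
move=> cJ sKJ dom; have [->//|neKJ] := eqVneq J K.
have /properP[_ [j jJ jK]] : K \proper J by rewrite properEneq eq_sym neKJ.
have [l lK slj] := dom j jJ; have lj : l != j by apply: contraNneq jK => <-.
rewrite (whdim_remove b i (subsetP sKJ _ lK) jJ lj slj); apply: IH.
- by move: cJ; rewrite (cardsD1 j) jJ.
- by rewrite subsetD1 sKJ.
by move=> j' /setD1P[_ /dom].
Qed.

Lemma fbetti_dominates f K J i : K \subset J -> dominates f K J ->
  fbetti f J i = fbetti f K i.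
Proof. by move=> sKJ dom; apply: eq_bigr => b _; apply: whdim_dominates. Qed.

Lemma whdim_unit f J b i j : j \in J -> f j = set0 -> whdim f J b i = 0.
Proof.
move=> jJ fj0; apply: (@hdim_cone _ _ _ j); first exact: weight_fam_convex.
move=> A /weight_famP[sA cA]; split; apply/weight_famP; split.
- by rewrite subUset sub1set jJ.
- by rewrite cover_setU1 fj0 set0U.
- exact: subset_trans (subsetDl _ _) sA.
rewrite -cA; apply/setP => x; apply/cover_ofP/cover_ofP => -[l].
  by move=> /setD1P[_ lA] xl; exists l.
move=> lA xl; exists l; rewrite ?inE ?lA ?andbT //.
by apply: contraTneq xl => ->; rewrite fj0 inE.
Qed.

Lemma disjoint_cover_proper f J A j : pairwise_disjoint f J -> nonempty_on f J ->
  A \subset J -> j \in A -> cover_of f (A :\ j) != cover_of f A.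
Proof.
move=> dJ nJ /subsetP sA jA; have /set0Pn[x xj] := nJ j (sA _ jA).
apply/eqP => /setP/(_ x); rewrite [RHS](introT (cover_ofP _ _ _)); last by exists j.
move/cover_ofP=> [l /setD1P[lj lA] xl].
by have := disjointFr (dJ l j (sA _ lA) (sA _ jA) lj) xl; rewrite xj.
Qed.

(** Dropping a factor always shrinks the lcm, so the differential within one lcm is zero. *)
Lemma whdim_disjoint f J b i : pairwise_disjoint f J -> nonempty_on f J ->
  whdim f J b i = #|[set B in weight_fam f J b | #|B| == i]|.
Proof.
move=> dJ nJ.
have rk0 n : level_rank k (weight_fam f J b) n = 0.
  rewrite /level_rank /restr_rank restr_mx0 ?mxrank0 // => A B.
  move=> /levelP[/weight_famP[sA cA] _] /levelP[/weight_famP[sB cB] _].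
  apply: bd_eq0 => j jA; apply/eqP => defB.
  by have /eqP[] := disjoint_cover_proper dJ nJ sA jA; rewrite -defB cA.
have := hdimE k i (weight_fam_convex (f := f) (J := J) (b := b)); rewrite !rk0 !addn0 /whdim => ->.
by apply: eq_card => A; rewrite !inE eqSS.
Qed.

Lemma fbetti_disjoint f J i : pairwise_disjoint f J -> nonempty_on f J ->
  fbetti f J i = 'C(#|J|, i).
Proof.
move=> dJ nJ; rewrite -cards_draws -sum1_card (partition_big (cover_of f) predT) //=.
apply: eq_bigr => b _; rewrite whdim_disjoint // -sum1_card; apply: eq_bigl => A.
by rewrite !inE -!andbA; congr (_ && _); rewrite andbC.
Qed.

Lemma whdim_empty f J b i : weight_fam f J b = set0 -> whdim f J b i = 0.
Proof.
move=> e0; have := hdimE k i (weight_fam_convex (f := f) (J := J) (b := b)).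
rewrite -/(whdim f J b i) e0.
have -> : level set0 i.+1 = set0 :> {set {set 'I_m}} by apply/setP => A; rewrite !inE.
by rewrite cards0; lia.
Qed.

(** * Setting a variable to 1 and to 0 *)

Section SplitAt.
Variables (f : 'I_m -> {set V}) (J : {set 'I_m}) (x : V).
Local Notation fx := (del f x).
Local Notation J0 := (avoiding f J x).

Lemma cover_del A : cover_of fx A = cover_of f A :\ x.
Proof.
apply/setP => y; apply/cover_ofP/setD1P => [[j jA /setD1P[yx yj]]|[yx /cover_ofP[j jA yj]]].
  by split=> //; apply/cover_ofP; exists j.
by exists j => //; apply/setD1P.
Qed.

Lemma avoiding_sub : J0 \subset J.
Proof. by apply/subsetP => j; rewrite inE => /andP[]. Qed.

Lemma sub_avoiding A : (A \subset J0) = (A \subset J) && (x \notin cover_of f A).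
Proof.
apply/subsetP/andP => [sA|[/subsetP sA nx] j jA].
  split; first by apply/subsetP => j /sA; rewrite inE => /andP[].
  by apply/cover_ofP => -[j /sA]; rewrite inE => /andP[_ /negP].
rewrite inE sA //=; apply: contra nx => xj; apply/cover_ofP; by exists j.
Qed.

Lemma weight_fam_avoid b : x \notin b -> weight_fam fx J0 b = weight_fam f J0 b.
Proof.
move=> xb; apply/setP => A; rewrite !inE sub_avoiding cover_del.
case: (boolP (x \in _)) => [|nx]; rewrite ?andbF // !andbT.
by congr (_ && (_ == _)); apply/setDidPl; rewrite disjoint_sym disjoints1.
Qed.

Lemma weight_fam_out b : x \notin b -> weight_fam f J b = weight_fam f J0 b.
Proof.
move=> xb; apply/setP => A; rewrite !inE sub_avoiding -andbA; congr (_ && _).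
by case: eqP => [->|]; rewrite ?andbF // xb.
Qed.

(** The short exact sequence: in degree [x |: b] the faces are those of [I_1] in degree [b] modulo
    those of [I_0]. *)
Lemma weight_fam_in b : x \notin b ->
  weight_fam f J (x |: b) = weight_fam fx J b :\: weight_fam f J0 b.
Proof.
move=> xb; rewrite -weight_fam_avoid //; apply/setP => A.
rewrite !inE sub_avoiding cover_del; case: (A \subset J); rewrite ?andbF //=.
have [xA|nxA] := boolP (x \in _).
  rewrite ?andbF /=; apply/eqP/eqP => [->|<-]; first by rewrite setU1K.
  by rewrite setD1K.
rewrite andNb; apply/negbTE; apply: contra nxA => /eqP ->; exact: setU11.
Qed.

Lemma weight_fam_del_in b : x \in b -> weight_fam fx J b = set0.
Proof.
move=> xb; apply/setP => A; rewrite !inE cover_del; apply/negbTE.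
by rewrite negb_and; apply/orP; right; apply: contraTneq xb => <-; rewrite !inE eqxx.
Qed.

(** By exactness [split_excess i.+1] is the dimension of the kernel of [phi] in homological degree
    [i]. *)
Definition split_excess n :=
  \sum_(b : {set V} | x \notin b) excess k (weight_fam fx J b) (weight_fam f J0 b) n.

Lemma split_excess0 : split_excess 0 = 0.
Proof. by rewrite /split_excess big1 // => b _; apply: excess0. Qed.

Lemma sub_weight_del b : x \notin b -> weight_fam f J0 b \subset weight_fam fx J b.
Proof. by move=> xb; rewrite -weight_fam_avoid // weight_fam_sub // avoiding_sub. Qed.

Lemma down_weight_del b : x \notin b -> down_in (weight_fam f J0 b) (weight_fam fx J b).
Proof. by move=> xb; rewrite -weight_fam_avoid //; apply: weight_fam_down. Qed.

Lemma fbetti_split i :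
  fbetti fx J i + split_excess i.+1 + split_excess i = fbetti f J i.
Proof.
rewrite /fbetti (bigID (fun b : {set V} => x \notin b)) /=.
rewrite [X in _ + X + _ + _]big1 ?addn0; last first.
  by move=> b; rewrite negbK => xb; apply/whdim_empty/weight_fam_del_in.
rewrite -!big_split /= [RHS](bigID (fun b : {set V} => x \notin b)) /=.
rewrite [X in _ = _ + X](reindex_onto (fun b => x |: b) (fun b => b :\ x)) /=; last first.
  by move=> b; rewrite negbK => xb; rewrite setD1K.
rewrite [X in _ = _ + X](eq_bigl (fun b : {set V} => x \notin b)); last first.
  move=> b; rewrite negbK setU11 /=; apply/eqP/idP => [<-|xb]; last by rewrite setU1K.
  by rewrite !inE eqxx.
rewrite -big_split /=; apply: eq_bigr => b xb.
rewrite /whdim weight_fam_out // weight_fam_in //.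
by apply: hdim_split (sub_weight_del xb) (down_weight_del xb); apply: weight_fam_convex.
Qed.

Lemma split_excess_ge i : fbetti f J0 i <= split_excess i.+1 + fbetti fx J i.
Proof.
rewrite /fbetti (bigID (fun b : {set V} => x \notin b)) /=.
rewrite [X in _ + X]big1 ?addn0; last first.
  move=> b; rewrite negbK => xb; apply: whdim_empty; apply/setP => A; rewrite !inE sub_avoiding.
  by case: eqP => [->|]; rewrite ?andbF // xb andbF.
rewrite [X in _ <= _ + X](bigID (fun b : {set V} => x \notin b)) /= addnA.
apply: leq_trans (leq_addr _ _); rewrite -big_split /=; apply: leq_sum => b xb.
apply: excess_ge (sub_weight_del xb) _ (down_weight_del xb) _ => //.
exact: weight_fam_convex.
Qed.

(* [B] is a product of generators of [I_{x=1}]: the map of Tor's induced by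
   [I_{x=0} <= I_{x=1}] vanishes in degree [B] as soon as it factors through a
   monomial ideal without homology in that degree. *)
Definition killed B := exists K,
  [/\ [set g in J0 | f g \subset cover_of fx B] \subset K, K \subset J
    & whdim fx K (cover_of fx B) #|B| = 0].

(** In multidegree [b] and homological degree [i], the products [B] of [i] generators with lcm [b]
    span the homology of the complete intersection. If one of them is killed then [phi] vanishes
    there; otherwise all are good and their number bounds the rank. *)
Lemma split_excess_good K (good : {set {set 'I_m}}) i :
    K \subset J -> dominates fx K J -> pairwise_disjoint fx K -> nonempty_on fx K ->
    (forall B, B \subset K -> B \notin good -> killed B) ->
  fbetti f J0 i <= split_excess i.+1 + #|[set B in good | #|B| == i]|.
Proof.
move=> sKJ domK dK nK bad.
rewrite /fbetti (bigID (fun b : {set V} => x \notin b)) /=.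
rewrite [X in _ + X]big1 ?addn0; last first.
  move=> b; rewrite negbK => xb; apply: whdim_empty; apply/setP => A; rewrite !inE sub_avoiding.
  by case: eqP => [->|]; rewrite ?andbF // xb andbF.
rewrite -sum1_card (partition_big (cover_of fx) (fun b : {set V} => x \notin b)) /=; last first.
  by move=> B _; rewrite cover_del !inE eqxx.
rewrite -big_split /=; apply: leq_sum => b xb; rewrite sum1dep_card.
have [/subsetP allg|/subsetPn[B + nB]] :=
    boolP ([set B in weight_fam fx K b | #|B| == i] \subset good).
  apply: (@leq_trans (excess k (weight_fam fx J b) (weight_fam f J0 b) i.+1
            + whdim fx J b i)).
    apply: excess_ge (sub_weight_del xb) _ (down_weight_del xb) _ => //.
    exact: weight_fam_convex.
  rewrite leq_add2l (whdim_dominates b i sKJ domK) whdim_disjoint //.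
  apply: subset_leq_card; apply/subsetP => B hB; have := allg B hB.
  by move: hB; rewrite !inE => /andP[/andP[_ ->] ->] ->.
rewrite inE => /andP[/weight_famP[sB cB] /eqP ci].
have [K' [sK' sK'J h0]] := bad B sB nB; rewrite cB ci in sK' h0.
apply: leq_trans (leq_addr _ _).
apply: (@leq_trans (excess k (weight_fam fx J b) (weight_fam f J0 b) i.+1
          + whdim fx K' b i)); last by rewrite h0 addn0.
apply: excess_ge.
- exact: weight_fam_convex.
- apply/subsetP => A; rewrite -weight_fam_avoid // => /weight_famP[sA cA].
  apply/weight_famP; split=> //; apply: subset_trans sK'; apply/subsetP => g gA.
  have := subsetP sA g gA; rewrite !inE => /andP[-> ng] /=; rewrite ng /=.
  have := cover_sub fx gA; rewrite cA /del; suff /setDidPl -> : [disjoint f g & [set x]] by [].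
  by rewrite disjoint_sym disjoints1.
- exact: weight_fam_sub.
- exact: down_weight_del.
exact: weight_fam_down.
Qed.

(** The factors of [B] other than [l] generate an ideal containing every generator of [I_0] that
    divides the lcm of [B], and their own lcm is too small for homology in that degree. *)
Lemma killed_by_missing_factor K B l :
    K \subset J -> pairwise_disjoint fx K -> nonempty_on fx K ->
    B \subset K -> l \in B ->
    (forall g, g \in J0 -> f g \subset cover_of fx B ->
       exists l', [/\ l' \in B, l' != l & fx l' \subset f g]) ->
  killed B.
Proof.
move=> sKJ dK nK sB lB miss; have sBJ := subset_trans sB sKJ.
pose G := [set g in J0 | f g \subset cover_of fx B]; exists (G :|: (B :\ l)); split; first exact: subsetUl.
  rewrite subUset; apply/andP; split; last exact: subset_trans (subsetDl _ _) sBJ.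
  by apply/subsetP => g; rewrite !inE => /andP[/andP[]].
rewrite (@whdim_dominates _ (B :\ l)) ?subsetUr //.
  apply: whdim_empty; apply/setP => A; rewrite inE [RHS]inE; apply/negP => /andP[sA /eqP cA].
  have := disjoint_cover_proper dK nK sB lB; rewrite eqEsubset cover_ofS ?subsetDl //=.
  by rewrite -cA cover_ofS.
move=> j /setUP[|jB]; last by exists j.
rewrite inE => /andP[jJ0 sj]; have [l' [l'B l'l sl']] := miss j jJ0 sj.
exists l'; first by rewrite !inE l'l.
rewrite /del; have : x \notin f j by move: jJ0; rewrite inE => /andP[].
by rewrite -disjoints1 disjoint_sym => /setDidPl ->.
Qed.

End SplitAt.
End SetFamilies.

(** * The numerical bound *)

Section BettiBound.
Variable m : nat.
Implicit Types (H e q : nat -> nat) (c : nat).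

Definition seq_sum H := \sum_(i < m.+1) H i.

Definition seq_poly H : {poly int} := (\poly_(i < m.+1) (H i)%:R)%R.

(** Doubling gives the bound a meaning at [c = 0]. As [1 + 3t + 2t^2 = (1 + t)(1 + 2t)], the first
    alternative is the first polynomial of the theorem times [1 + t], which avoids the exponent
    [c - 1]. *)
Definition betti_bound c H :=
  3 * 2 ^ c <= 2 * seq_sum H /\
  (2 * seq_sum H = 3 * 2 ^ c ->
     (seq_poly H * (1 + 'X) = (1 + 2%:R *: 'X) * (1 + 'X) ^+ c)%R \/
     exists2 d, c = d.+3 &
       (seq_poly H = (1 + 5%:R *: 'X + 5%:R *: 'X^2 + 'X^3) * (1 + 'X) ^+ d)%R).

Lemma bound_strict c H : 3 * 2 ^ c < 2 * seq_sum H -> betti_bound c H.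
Proof. by move=> lt; split; [exact: ltnW|move=> eq; rewrite eq ltnn in lt]. Qed.

Lemma seq_sum_eq H H' : (forall i, i <= m -> H' i <= H i) -> seq_sum H <= seq_sum H' ->
  forall i, i <= m -> H' i = H i.
Proof.
move=> le leS i im; apply/eqP; rewrite eqn_leq le //= leqNgt; apply/negP => lt.
move: leS; rewrite leqNgt => /negP; apply; rewrite /seq_sum.
rewrite (bigD1 (Ordinal (im : i < m.+1))) //= [ltnRHS](bigD1 (Ordinal (im : i < m.+1))) //=.
rewrite -addSn leq_add //; apply: leq_sum => j _; apply: le; exact: ltn_ord j.
Qed.

Lemma eq_seq_poly H H' : (forall i, i <= m -> H' i = H i) -> seq_poly H' = seq_poly H.
Proof. by move=> eqH; apply/polyP => i; rewrite !coef_poly ltnS; case: leqP => // /eqH ->. Qed.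

Lemma leq_seq_sum H H' : (forall i, i <= m -> H' i <= H i) -> seq_sum H' <= seq_sum H.
Proof. by move=> le; apply: leq_sum => i _; apply: le; exact: ltn_ord i. Qed.

(** If the larger sequence attains the bound, so does the smaller one; the sums then agree, hence
    the terms, and the equality case is inherited. *)
Lemma bound_mono c H H' : (forall i, i <= m -> H' i <= H i) ->
  betti_bound c H' -> betti_bound c H.
Proof.
move=> le [leS eqS]; have leH := leq_seq_sum le.
split; first by apply: leq_trans leS _; rewrite leq_mul2l leH.
move=> eqH; have eq' : 2 * seq_sum H' = 3 * 2 ^ c.
  by apply/eqP; rewrite eqn_leq leS -eqH leq_mul2l leH.
have eqi : forall i, i <= m -> H' i = H i.
  by apply: seq_sum_eq => //; move: eq' eqH; lia.
by rewrite -(eq_seq_poly eqi); apply: eqS.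
Qed.

Lemma sum_double e : e 0 = 0 -> e m.+1 = 0 ->
  seq_sum (fun i => e i.+1 + e i) = 2 * seq_sum (fun i => e i.+1).
Proof.
move=> e0 em; rewrite /seq_sum big_split /= mul2n -addnn; congr addn.
rewrite [LHS]big_ord_recl [RHS]big_ord_recr /= e0 em add0n addn0.
by apply: eq_bigr.
Qed.

Lemma poly_double e : e 0 = 0 -> e m.+1 = 0 ->
  (seq_poly (fun i => (e i.+1 + e i)%N) = (1 + 'X) * seq_poly (fun i => e i.+1))%R.
Proof.
move=> e0 em; apply/polyP => i; rewrite mulrDl mul1r coefD coefXM !coef_poly.
case: i => [|i] /=; first by rewrite e0 addn0 addr0.
rewrite !ltnS; have [im|] := ltnP i m; first by rewrite (ltnW im) natrD.
rewrite add0r => mi; case: ltnP => // im.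
by have -> : i = m by [lia]; rewrite em.
Qed.

Lemma seq_polyD H H' : (seq_poly (fun i => (H i + H' i)%N) = seq_poly H + seq_poly H')%R.
Proof.
by apply/polyP => i; rewrite coefD !coef_poly; case: ifP; rewrite ?addr0 // natrD.
Qed.

Lemma seq_sumD H H' : seq_sum (fun i => H i + H' i) = seq_sum H + seq_sum H'.
Proof. exact: big_split. Qed.

Lemma seq_sum_bin a : a <= m -> seq_sum (fun i => 'C(a, i)) = 2 ^ a.
Proof.
move=> am; rewrite /seq_sum -[in RHS](addn1 1) expnDn.
rewrite [RHS](big_ord_widen m.+1 (fun i => 'C(a, i) * (1 ^ (a - i) * 1 ^ i))) ?ltnS //.
rewrite [LHS](bigID (fun i : 'I_m.+1 => i < a.+1)) /= [X in _ + X]big1 ?addn0.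
  by apply: eq_bigr => i _; rewrite !exp1n !muln1.
by move=> i; rewrite -leqNgt => /bin_small.
Qed.

Lemma seq_poly_bin a : a <= m -> (seq_poly (fun i => 'C(a, i)) = (1 + 'X) ^+ a)%R.
Proof.
move=> am; apply/polyP => i; rewrite coef_poly exprDn coef_sum.
under eq_bigr => j _ do rewrite expr1n mul1r coefMn coefXn.
have [ia|ai] := ltnP i a.+1.
  rewrite (bigD1 (Ordinal ia)) //= eqxx big1 ?addr0 => [|j]; last first.
    rewrite -val_eqE /= eq_sym => /negPf ->; exact: mul0rn.
  by rewrite ifT //; apply: leq_trans ia _.
rewrite big1 => [|j _]; last first.
  by rewrite (_ : (i == j) = false) ?mul0rn //; apply/eqP => eij; have := ltn_ord j; lia.
by case: ifP => // _; rewrite bin_small.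
Qed.

(** The case of a variable among the generators: the generating function acquires a factor
    [1 + t]. *)
Lemma bound_double c e q : e 0 = 0 -> e m.+1 = 0 ->
  (forall i, i <= m -> q i <= e i.+1) -> betti_bound c q ->
  betti_bound c.+1 (fun i => e i.+1 + e i).
Proof.
move=> e0 em le; move/(bound_mono (H := fun i => e i.+1)) => /(_ le) [leS eqS].
split; rewrite sum_double // expnS; first by lia.
move=> eq2; have {}eq2 : 2 * seq_sum (fun i => e i.+1) = 3 * 2 ^ c by lia.
rewrite poly_double //; case: (eqS eq2) => [eqp|[d dc eqp]].
  by left; rewrite -mulrA eqp exprS mulrCA.
by right; exists d.+1; rewrite ?dc // eqp (exprS _ d) mulrCA.
Qed.

Lemma coef01_1X c : (((1 + 'X : {poly int}) ^+ c)`_0 = 1)%R /\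
  (((1 + 'X : {poly int}) ^+ c)`_1 = c%:R)%R.
Proof.
elim: c => [|c [IH0 IH1]]; first by rewrite expr0 !coef1.
rewrite exprS mulrDl mul1r !coefD !coefXM /= IH0 IH1; split; first by rewrite addr0.
by rewrite -natr1.
Qed.

(** The coefficient of [t] limits the number of generators of an ideal that attains the bound. *)
Lemma bound_eq_coef1 c H : 0 < m -> betti_bound c H -> 2 * seq_sum H = 3 * 2 ^ c ->
  H 1 = c.+1 \/ (2 < c /\ H 1 = c.+2).
Proof.
move=> m0 [_ eqc] /eqc[] => [eqp|[d -> eqp]].
  left; have [e0 e1] := coef01_1X c.
  have := congr1 (fun p : {poly int} => (p`_1)%R) eqp; have := congr1 (fun p : {poly int} => (p`_0)%R) eqp.
  rewrite !mulrDl !mulrDr !mul1r !mulr1 -!scalerAl !coefD !coefZ !coefXM !coefMX /= e0 e1.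
  by rewrite !coef_poly !ltnS ?leq0n ?m0 /=; lia.
right; split=> //; have [e0 e1] := coef01_1X d.
have := congr1 (fun p : {poly int} => (p`_1)%R) eqp.
rewrite !mulrDl !mul1r -!scalerAl !coefD !coefZ coefXM !coefXnM /= e0 e1.
by rewrite !coef_poly !ltnS ?leq0n ?m0 /=; lia.
Qed.

(* [H] is controlled by a complete intersection with [c.+1] generators and by the
   part of [q] which does not survive in its Koszul homology. *)
Section Mixed.
Variables (c : nat) (H e q g : nat -> nat).
Hypotheses (cm : c.+1 <= m) (e0 : e 0 = 0) (em : e m.+1 = 0).
Hypothesis defH : forall i, i <= m -> H i = 'C(c.+1, i) + e i.+1 + e i.
Hypothesis qg : forall i, i <= m -> q i <= e i.+1 + g i.

Lemma mixed_sum : seq_sum H = 2 ^ c.+1 + 2 * seq_sum (fun i => e i.+1).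
Proof.
rewrite -sum_double // -seq_sum_bin // -seq_sumD; apply: eq_bigr => i _.
by rewrite defH ?addnA //; exact: ltn_ord i.
Qed.

Lemma mixed_le : seq_sum q <= seq_sum (fun i => e i.+1) + seq_sum g.
Proof. by rewrite -seq_sumD; apply: leq_seq_sum. Qed.

Lemma mixed_poly : seq_sum (fun i => e i.+1) + seq_sum g <= seq_sum q ->
  (seq_poly H = (1 + 'X) ^+ c.+1 + (1 + 'X) * (seq_poly q - seq_poly g))%R.
Proof.
move=> le; have eqq : forall i, i <= m -> q i = e i.+1 + g i.
  by apply: seq_sum_eq => //; rewrite seq_sumD.
have -> : seq_poly q = seq_poly (fun i => e i.+1 + g i) by apply: eq_seq_poly.
rewrite seq_polyD addrK -poly_double // -seq_poly_bin // -seq_polyD.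
by apply: eq_seq_poly => i im; rewrite defH ?addnA.
Qed.

Lemma bound_mixed_strict : betti_bound c q -> seq_sum g < 2 ^ c -> betti_bound c.+1 H.
Proof.
move=> [leq_ _] lt; apply: bound_strict; rewrite mixed_sum expnS.
by have := mixed_le; lia.
Qed.

(** Here [r] counts the generators of [I_0] and [a] those shared with [I_1]. The kernel of [phi] has
    dimension at least [2^r - 2^a]: at least [2^c] if [r > c], and at least [2^(c-1)] if [r = c].
    Equality leaves only [r = c], [a = c - 1], with the first polynomial. *)
Lemma bound_mixed_disjoint r a : r <= m -> c <= r -> a <= r -> a <= c -> (r = c -> a < c) ->
  (forall i, i <= m -> q i = 'C(r, i)) -> (forall i, i <= m -> g i = 'C(a, i)) ->
  betti_bound c.+1 H.
Proof.
move=> rm cr ar ac rca eqq eqg.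
have sq : seq_sum q = 2 ^ r.
  by rewrite -(seq_sum_bin rm); apply: eq_bigr => i _; apply: eqq; exact: ltn_ord i.
have sg : seq_sum g = 2 ^ a.
  by rewrite -(@seq_sum_bin a) ?(leq_trans ar) //; apply: eq_bigr => i _; apply: eqg; exact: ltn_ord i.
have := mixed_le; rewrite sq sg => le1.
have [eqr|ltr] := eqVneq r c; last first.
  have p1 : 2 ^ c.+1 <= 2 ^ r by rewrite leq_exp2l //; lia.
  have p2 : 2 ^ a <= 2 ^ c by rewrite leq_exp2l.
  apply: bound_strict; rewrite mixed_sum; move: p1 p2 le1; rewrite !expnS.
  have pc : 0 < 2 ^ c by rewrite expn_gt0.
  by lia.
have {}rca := rca eqr; subst r.
have [d dc] : exists d, c = d.+1 by case: (c) rca => // d _; exists d.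
rewrite dc ltnS in rca.
have p1 : 2 ^ a <= 2 ^ d by rewrite leq_exp2l.
rewrite dc expnS in le1 sq.
split; first by rewrite mixed_sum dc !expnS; lia.
rewrite mixed_sum dc !expnS => eqS.
have eqa : a = d by apply/eqP; rewrite -(@eqn_exp2l 2) //; apply/eqP; lia.
left; rewrite mixed_poly ?sq ?sg ?eqa; last by lia.
have -> : seq_poly q = ((1 + 'X) ^+ d.+1)%R.
  by rewrite -dc -(seq_poly_bin rm); apply: eq_seq_poly.
have -> : seq_poly g = ((1 + 'X) ^+ d)%R.
  by rewrite -eqa -(@seq_poly_bin a) ?(leq_trans ar) //; apply: eq_seq_poly.
by rewrite dc scaler_nat -mulr_natl !exprS; ring.
Qed.

End Mixed.
End BettiBound.

(** * The bound for families of sets *)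

(** [a] and [b] are the Betti sums of [I_0] and [I], and [g] counts the good sets. Parity decides:
    [a] is even, so if it is not minimal it exceeds [3 * 2^(c+1)] by at least 2, which pays for the
    extra 1 allowed in [g]. *)
Lemma loose_arith c a b g r p : 3 * 2 ^ c.+2 <= 2 * a ->
  2 ^ c.+3 + 2 * a <= b + 2 * g -> 2 * a != 3 * 2 ^ c.+2 -> g <= (2 ^ c.+2).+1 ->
  a + 2 * r = 2 * p -> 3 * 2 ^ c.+3 < 2 * b.
Proof. by rewrite !expnS; lia. Qed.

Lemma pentagon_arith a b : 2 ^ 3 + 2 * a <= b + 2 * 4 -> 2 * a = 3 * 2 ^ 2 ->
  3 * 2 ^ 3 <= 2 * b.
Proof. by rewrite !expnS expn0; lia. Qed.

Lemma pentagon_arith_eq a b : 2 * a = 3 * 2 ^ 2 -> 2 * b = 3 * 2 ^ 3 ->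
  b + 2 * 4 <= 2 ^ 3 + 2 * a.
Proof. by rewrite !expnS expn0; lia. Qed.

Section FamilyBound.
Variables (k : fieldType) (m : nat) (V : finType).
Implicit Types (f : 'I_m -> {set V}) (J K A B : {set 'I_m}) (b T : {set V}) (x y : V).

Definition intersecting f J :=
  exists i j, [/\ i \in J, j \in J, i != j & ~~ [disjoint f i & f j]].

Definition hits_ge f J c := forall T, hitting f J T -> c <= #|T|.

Lemma disjoint_or_intersecting f J : pairwise_disjoint f J \/ intersecting f J.
Proof.
have [/'exists_existsP[i [j /and4P[iJ jJ ij nd]]]|h] :=
  boolP [exists i, exists j, [&& i \in J, j \in J, i != j & ~~ [disjoint f i & f j]]].
  by right; exists i, j.
left=> i j iJ jJ ij; apply: contraR h => nd.
by apply/'exists_existsP; exists i, j; rewrite iJ jJ ij.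
Qed.

(* Among equal minimal sets the one of least index is kept. *)
Definition min_gens f J :=
  [set j in J | [forall l in J, (f l \subset f j) ==> (f j \subset f l) && (j <= l)]].

Lemma min_gensP f J j : reflect
  (j \in J /\ forall l, l \in J -> f l \subset f j -> f j \subset f l /\ j <= l)
  (j \in min_gens f J).
Proof.
rewrite inE; apply: (iffP andP) => -[jJ].
  by move=> /forall_inP h; split=> // l lJ slj; have /implyP/(_ slj)/andP := h l lJ.
move=> h; split=> //; apply/forall_inP => l lJ; apply/implyP => slj.
by apply/andP; apply: h.
Qed.

Lemma min_gens_sub f J : min_gens f J \subset J.
Proof. by apply/subsetP => j /min_gensP[]. Qed.

Lemma min_gens_antichain f J : antichain f (min_gens f J).
Proof.
move=> i j /min_gensP[iJ hi] /min_gensP[jJ hj] sij.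
have [sji ji] := hj i iJ sij; have [_ ij] := hi j jJ sji.
by apply: val_inj; apply/eqP; rewrite eqn_leq ij ji.
Qed.

Lemma min_gens_dominates f J : dominates f (min_gens f J) J.
Proof.
move=> j jJ; pose P l := (l \in J) && (f l \subset f j).
have Pj : P j by rewrite /P jJ subxx.
case: (arg_minnP (fun l : 'I_m => #|f l| * m + l) Pj) => l /andP[lJ slj] minl.
exists l => //; apply/min_gensP; split=> // h hJ shl.
have le1 := minl h; rewrite /P hJ (subset_trans shl slj) in le1; have {}le1 := le1 isT.
have cle : #|f l| <= #|f h|.
  rewrite leqNgt; apply/negP => lt; have lm := ltn_ord h.
  have := leq_mul lt (leqnn m); rewrite mulSn; lia.
have eqf : f h = f l by apply/eqP; rewrite eqEcard shl.
by rewrite eqf subxx; split=> //; move: le1; rewrite eqf leq_add2l.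
Qed.

Lemma fbetti_min_gens f J i : fbetti k f J i = fbetti k f (min_gens f J) i.
Proof. by apply: fbetti_dominates; [apply: min_gens_sub|apply: min_gens_dominates]. Qed.

Lemma exists_transversal f K J : nonempty_on f K -> dominates f K J ->
  exists2 T, hitting f J T & #|T| <= #|K|.
Proof.
move=> nK dom; pose g j := [pick y in f j]; exists [set y | Some y \in g @: K].
  move=> j /dom[l lK slj]; have /set0Pn[y yl] := nK l lK.
  have [z gz zl] : exists2 z, g l = Some z & z \in f l.
    by rewrite /g; case: pickP => [z|/(_ y)]; [exists z|rewrite yl].
  apply/set0Pn; exists z; rewrite !inE (subsetP slj) //=.
  by rewrite -gz; apply: imset_f.
apply: leq_trans (leq_imset_card g (mem K)).
rewrite -(card_imset _ Some_inj); apply: subset_leq_card.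
by apply/subsetP => _ /imsetP[y + ->]; rewrite inE.
Qed.

Lemma card_set_ord A : #|A| <= m.
Proof. by rewrite -[leqRHS]card_ord max_card. Qed.

Lemma level_rank_top (P : {set {set 'I_m}}) : level_rank k P m.+1 = 0.
Proof.
rewrite /level_rank /restr_rank restr_mx0 ?mxrank0 // => A B.
by move=> /levelP[_ cA]; have := card_set_ord A; lia.
Qed.

Lemma split_excess_top f J x : split_excess k f J x m.+1 = 0.
Proof. by apply: big1 => b _; rewrite /excess level_rank_top. Qed.

Lemma sum_card_level f J i :
  \sum_(b : {set V}) #|level (weight_fam f J b) i.+1| = 'C(#|J|, i).
Proof.
rewrite -cards_draws -sum1_card (partition_big (cover_of f) predT) //=.
apply: eq_bigr => b _; rewrite -sum1_card; apply: eq_bigl => A.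
by rewrite !inE eqSS -!andbA; congr (_ && _); rewrite andbC.
Qed.

(** Each unit of rank of the differential removes two of the [2^#|J|] faces. *)
Lemma seq_sum_fbetti_parity f J :
  exists r, seq_sum m (fbetti k f J) + 2 * r = 2 ^ #|J|.
Proof.
pose e n := \sum_(b : {set V}) level_rank k (weight_fam f J b) n.
exists (seq_sum m (fun i => e i.+1)); rewrite -sum_double; first last.
- by apply: big1 => b _; apply: level_rank_top.
- by apply: big1 => b _; apply: level_rank0.
rewrite -seq_sumD -(seq_sum_bin (card_set_ord J)); apply: eq_bigr => i _.
rewrite -(sum_card_level f) /e /fbetti -!big_split /=; apply: eq_bigr => b _.
by rewrite addnA hdimE //; apply: weight_fam_convex.
Qed.

(** Among at most two incomparable nonempty generators, dropping one changes the lcm, so the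
    differentials next to degree 1 vanish. *)
Lemma card_le_fbetti1 f J : antichain f J -> nonempty_on f J -> #|J| <= fbetti k f J 1.
Proof.
move=> aJ nJ; rewrite -(bin1 #|J|) -(sum_card_level f); apply: leq_sum => b _.
have rk0 n : n < 3 -> level_rank k (weight_fam f J b) n = 0.
  move=> n3; rewrite /level_rank /restr_rank restr_mx0 ?mxrank0 // => A B.
  move=> /levelP[/weight_famP[sA cA] nA] /levelP[/weight_famP[sB cB] _].
  apply: bd_eq0 => j jA; apply/eqP => defB; have jJ := subsetP sA j jA.
  have fjB : f j \subset cover_of f B by rewrite cB -cA cover_sub.
  have [B0|[l lB]] := set_0Vmem B.
    by case/eqP: (nJ j jJ); apply/eqP; rewrite -subset0 (subset_trans fjB) // B0 /cover_of big_set0.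
  have cB1 : #|B| = 1.
    have : 0 < #|B| by apply/card_gt0P; exists l.
    move: nA; rewrite (cardsD1 j A) jA -defB add1n => -[nA].
    by rewrite -nA !ltnS in n3; case: #|B| n3 => // -[].
  have eB : B = [set l] by apply/eqP; rewrite eq_sym eqEcard sub1set lB cB1 cards1.
  rewrite eB /cover_of big_set1 in fjB.
  have ejl : j = l by apply: aJ => //; exact: (subsetP sB).
  by move: lB; rewrite defB ejl !inE eqxx.
have := hdimE k 1 (weight_fam_convex (f := f) (J := J) (b := b)).
by rewrite !rk0 // !addn0 /whdim => ->.
Qed.

Lemma antichain_sub f J K : K \subset J -> antichain f J -> antichain f K.
Proof. by move=> /subsetP sK aJ i j iK jK; apply: aJ; apply: sK. Qed.

Lemma dominates_hitting f K J x T : dominates (del f x) K J ->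
  hitting (del f x) K T -> hitting f J T.
Proof.
move=> dom hT j /dom[l /hT/set0Pn[y /setIP[yl yT]] slj].
by apply/set0Pn; exists y; rewrite inE yT andbT; move/(subsetP slj): yl => /setD1P[].
Qed.

Lemma cover_min_gens_lt f J x : x \in cover_of f J ->
  #|cover_of (del f x) (min_gens (del f x) J)| < #|cover_of f J|.
Proof.
move=> xJ; rewrite (cardsD1 x (cover_of f J)) xJ ltnS; apply: subset_leq_card.
by rewrite -cover_del cover_ofS // min_gens_sub.
Qed.

Lemma cover_avoiding_lt f J x : x \in cover_of f J ->
  #|cover_of f (avoiding f J x)| < #|cover_of f J|.
Proof.
move=> xJ; apply: proper_card; apply/properP; split.
  by apply: cover_ofS; apply: avoiding_sub.
by exists x => //; have := subxx (avoiding f J x); rewrite sub_avoiding => /andP[].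
Qed.

Lemma hits_ge_avoiding f J x c : hits_ge f J c.+1 -> hits_ge f (avoiding f J x) c.
Proof.
move=> hJ T hT; have: hitting f J (x |: T).
  move=> j jJ; have [xj|nxj] := boolP (x \in f j).
    by apply/set0Pn; exists x; rewrite !inE xj eqxx.
  have /hT/set0Pn[y /setIP[yj yT]] : j \in avoiding f J x by rewrite inE jJ.
  by apply/set0Pn; exists y; rewrite !inE yj yT orbT.
move/hJ => le1; have := cardsU1 x T; case: (x \notin T); lia.
Qed.

(** * The inductive step *)

Section Step.
Variables (f : 'I_m -> {set V}) (J : {set 'I_m}) (c : nat).
Hypotheses (aJ : antichain f J) (iJ : intersecting f J) (hJ : hits_ge f J c.+1).
Hypothesis IH : forall f' J' c', #|cover_of f' J'| < #|cover_of f J| ->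
  antichain f' J' -> intersecting f' J' -> hits_ge f' J' c' ->
  betti_bound m c' (fbetti k f' J').

Lemma intersecting_nonempty : nonempty_on f J.
Proof.
move=> j jJ; apply/eqP => fj0; case: iJ => i [i' [iJ' i'J ii' _]].
have eqj l : l \in J -> j = l by move=> lJ; apply: aJ => //; rewrite fj0 sub0set.
by case/eqP: ii'; rewrite -(eqj i) // -(eqj i').
Qed.

(** At [x = 1] the ideal is the unit ideal, which has no homology, so [phi] is zero and only [I_0]
    contributes. *)
Lemma bound_singleton j x : j \in J -> f j = [set x] ->
  betti_bound m c.+1 (fbetti k f J).
Proof.
move=> jJ fj; have xJ : x \in cover_of f J.
  by apply/cover_ofP; exists j; rewrite // fj set11.
have avoid l : l \in J -> x \in f l -> l = j.
  by move=> lJ xl; apply/esym/aJ; rewrite // fj sub1set.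
have iJ0 : intersecting f (avoiding f J x).
  case: iJ => i [i' [iJ' i'J ii' nd]]; exists i, i'; rewrite !inE iJ' i'J; split=> //=.
    apply/negP => xi; case/negP: nd; rewrite (avoid i) // fj disjoints1.
    by apply/negP => xi'; case/eqP: ii'; rewrite (avoid i) // (avoid i').
  apply/negP => xi'; case/negP: nd; rewrite (avoid i') // fj disjoint_sym disjoints1.
  by apply/negP => xi; case/eqP: ii'; rewrite (avoid i) // (avoid i').
pose e := split_excess k f J x.
have e0 i : fbetti k (del f x) J i = 0.
  by apply: big1 => b _; apply: (whdim_unit _ _ _ jJ); rewrite /del fj setDv.
apply: (bound_mono (H' := fun i => e i.+1 + e i)).
  by move=> i _; rewrite -(fbetti_split k f J x i) e0.
apply: (bound_double (q := fbetti k f (avoiding f J x))).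
- exact: split_excess0.
- exact: split_excess_top.
- by move=> i _; have := split_excess_ge k f J x i; rewrite e0 addn0.
apply: IH => //; first exact: cover_avoiding_lt.
  exact: antichain_sub (avoiding_sub _ _ _) aJ.
exact: hits_ge_avoiding.
Qed.

Local Notation fx := (del f).
Local Notation K x := (min_gens (del f x) J).
Local Notation J0 x := (avoiding f J x).

(** Setting [x = 1] can only lower the homology, and a hitting set of [I_1] also hits [I]. *)
Lemma bound_localize x : x \in cover_of f J -> intersecting (fx x) (K x) ->
  betti_bound m c.+1 (fbetti k f J).
Proof.
move=> xJ iK; apply: (bound_mono (H' := fbetti k (fx x) (K x))).
  move=> i _; rewrite -(fbetti_split k f J x i).
  by rewrite -fbetti_min_gens -addnA leq_addr.
apply: IH => //; first exact: cover_min_gens_lt.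
  exact: min_gens_antichain.
by move=> T /(dominates_hitting (@min_gens_dominates _ _)); apply: hJ.
Qed.

Hypothesis no_single : forall j, j \in J -> 1 < #|f j|.

Lemma del_nonempty x : nonempty_on (fx x) (K x).
Proof.
move=> j /(subsetP (min_gens_sub _ _))/no_single; rewrite -card_gt0 /del => c1.
by move: c1; rewrite (cardsD1 x); case: (x \in _); lia.
Qed.

(** A generator through [x] stays minimal at [x = 1]: one that divides it after the deletion already
    divides it before. *)
Lemma mem_K x j : j \in J -> x \in f j -> j \in K x.
Proof.
move=> jJ xj; have [l lK slj] := min_gens_dominates (fx x) jJ.
have lJ := subsetP (min_gens_sub _ _) _ lK.
suff -> : j = l by [].
apply/esym/aJ => //; apply/subsetP => y yl.
have [->//|nyx] := eqVneq y x.
by have /(subsetP slj)/setD1P[] : y \in fx x l by rewrite !inE nyx.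
Qed.

Lemma card_K_ge x : c < #|K x|.
Proof.
have [T hT] := exists_transversal (del_nonempty (x := x)) (@min_gens_dominates (fx x) J).
apply: leq_trans; apply: hJ.
apply: dominates_hitting (hT) => j jJ; by exists j.
Qed.

(** A complete intersection with [c + 2] generators already has Betti sum [2^(c+2)], more than
    [3 * 2^c]. *)
Lemma bound_many x : x \in cover_of f J -> pairwise_disjoint (fx x) (K x) ->
  c.+1 < #|K x| -> betti_bound m c.+1 (fbetti k f J).
Proof.
move=> xJ dK cK; apply: bound_strict.
apply: (@leq_trans (2 * seq_sum m (fun i => 'C(#|K x|, i)))).
  rewrite seq_sum_bin ?card_set_ord //.
  have: 2 ^ c.+2 <= 2 ^ #|K x| by rewrite leq_exp2l.
  have pc : 0 < 2 ^ c by rewrite expn_gt0.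
  by rewrite !expnS; lia.
rewrite leq_mul2l /=; apply: leq_seq_sum => i _.
rewrite -(@fbetti_disjoint k m V (fx x)) //; last exact: del_nonempty.
by rewrite -(fbetti_split k f J x i) -fbetti_min_gens -addnA leq_addr.
Qed.

Hypothesis disjK : forall x, x \in cover_of f J -> pairwise_disjoint (fx x) (K x).
Hypothesis cardK : forall x, x \in cover_of f J -> #|K x| = c.+1.

Lemma del_avoid x g : g \in J0 x -> fx x g = f g.
Proof.
rewrite inE => /andP[_ xg]; apply/setDidPl; rewrite disjoint_sym; by rewrite disjoints1.
Qed.

(** A generator of [I_0] dividing the lcm of [B] is a multiple of some generator of [I_1], which
    belongs to [B] by disjointness. If that one is not [l] there is nothing to check, so only
    multiples of [l] matter. *)
Lemma killed_crit x B l : x \in cover_of f J -> B \subset K x -> l \in B ->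
  (forall g, g \in J0 x -> f g \subset cover_of (fx x) B -> fx x l \subset f g ->
     exists l', [/\ l' \in B, l' != l & fx x l' \subset f g]) ->
  killed k f J x B.
Proof.
move=> xJ sB lB h; apply: killed_by_missing_factor (min_gens_sub _ _) _ _ (sB) (lB) _.
- exact: disjK.
- exact: del_nonempty.
move=> g gJ0 sg; have gJ := subsetP (avoiding_sub _ _ _) _ gJ0.
have [l0 l0K sl0] := min_gens_dominates (fx x) gJ; rewrite (del_avoid gJ0) in sl0.
have l0B : l0 \in B.
  have /set0Pn[y yl0] := del_nonempty l0K.
  have /(subsetP sg)/cover_ofP[l1 l1B yl1] := subsetP sl0 y yl0.
  apply: contraLR (l1B) => nl0; apply: contraL yl0 => _.
  have l10 : l1 != l0 by apply: contraNneq nl0 => <-.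
  by rewrite (disjointFr (disjK xJ (subsetP sB _ l1B) l0K l10)).
have [el|nel] := eqVneq l0 l; last by exists l0.
by rewrite el in sl0; apply: h.
Qed.

Lemma sum_good (good : {set {set 'I_m}}) :
  seq_sum m (fun i => #|[set B in good | #|B| == i]|) = #|good|.
Proof.
rewrite /seq_sum -sum1_card.
have bnd (B : {set 'I_m}) : #|B| < m.+1 by rewrite ltnS card_set_ord.
rewrite (partition_big (fun B : {set 'I_m} => Ordinal (bnd B)) predT) //=.
by apply: eq_bigr => i _; rewrite sum1dep_card; apply: eq_card => B; rewrite !inE.
Qed.

Section At.
Variables (x : V) (good : {set {set 'I_m}}).
Hypotheses (xJ : x \in cover_of f J)
  (bad : forall B, B \subset K x -> B \notin good -> killed k f J x B).
Let g i := #|[set B in good | #|B| == i]|.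

Let cm : c.+1 <= m.
Proof. by rewrite -(cardK xJ) card_set_ord. Qed.

Let defH i : i <= m -> fbetti k f J i
  = 'C(c.+1, i) + split_excess k f J x i.+1 + split_excess k f J x i.
Proof.
move=> _; rewrite -(fbetti_split k f J x i) -(cardK xJ).
rewrite fbetti_min_gens.
rewrite (fbetti_disjoint k i (disjK xJ)) //; exact: del_nonempty.
Qed.

Let qg i : i <= m -> fbetti k f (J0 x) i <= split_excess k f J x i.+1 + g i.
Proof.
move=> _; apply: split_excess_good bad.
- exact: min_gens_sub.
- exact: min_gens_dominates.
- exact: disjK.
- exact: del_nonempty.
Qed.

(** The threshold [2^c] is half the number of subsets of [K x]. *)
Lemma bound_good_strict : betti_bound m c (fbetti k f (J0 x)) -> #|good| < 2 ^ c ->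
  betti_bound m c.+1 (fbetti k f J).
Proof.
rewrite -sum_good.
exact: (bound_mixed_strict cm (split_excess0 _ _ _ _) (split_excess_top _ _ _) defH qg).
Qed.

Lemma good_sum : 2 ^ c.+1 + 2 * seq_sum m (fbetti k f (J0 x))
  <= seq_sum m (fbetti k f J) + 2 * #|good|.
Proof.
have := mixed_le qg.
rewrite (mixed_sum cm (split_excess0 _ _ _ _) (split_excess_top _ _ _) defH) sum_good.
by lia.
Qed.

Lemma good_poly : seq_sum m (fbetti k f J) + 2 * #|good|
    <= 2 ^ c.+1 + 2 * seq_sum m (fbetti k f (J0 x)) ->
  (seq_poly m (fbetti k f J)
    = (1 + 'X) ^+ c.+1 + (1 + 'X) * (seq_poly m (fbetti k f (J0 x)) - seq_poly m g))%R.
Proof.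
rewrite (mixed_sum cm (split_excess0 _ _ _ _) (split_excess_top _ _ _) defH) => le1.
apply: (mixed_poly cm (split_excess0 _ _ _ _) (split_excess_top _ _ _) defH qg).
by rewrite sum_good; lia.
Qed.

End At.

(** A factor [l] of [B] is [needed] if some generator of [I_0] inside the lcm of [B] is a multiple
    of [l] and of no other factor. When all factors are needed, disjointness of [I_0] prevents these
    generators from reaching into other factors, so each factor is itself a generator of [I_0].
    Hence the good sets are the sets of common generators. *)
Lemma bound_avoiding_disjoint x : x \in cover_of f J ->
  pairwise_disjoint f (J0 x) -> betti_bound m c.+1 (fbetti k f J).
Proof.
move=> xJ dJ0; pose Com := K x :&: J0 x.
have cm : c.+1 <= m by rewrite -(cardK xJ) card_set_ord.
have bad B : B \subset K x -> B \notin powerset Com -> killed k f J x B.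
  move=> sB; rewrite powersetE subsetI sB /= => nB.
  pose needed l := [exists g in J0 x, [&& f g \subset cover_of (fx x) B,
    fx x l \subset f g & [forall l' in B, (l' != l) ==> ~~ (fx x l' \subset f g)]]].
  have [/forall_inP all_needed|/forall_inPn[l lB nl]] := boolP [forall l in B, needed l].
    case/negP: nB; apply/subsetP => l lB.
    have /exists_inP[g gJ0 /and3P[sg slg /forall_inP ug]] := all_needed l lB.
    have gJ := subsetP (avoiding_sub _ _ _) _ gJ0.
    have lJ := subsetP (min_gens_sub _ _) _ (subsetP sB _ lB).
    suff sgl : f g \subset f l by have <- : g = l by apply: aJ.
    apply/subsetP => y yg; have /cover_ofP[l' l'B yl'] := subsetP sg y yg.
    have [el|nel] := eqVneq l' l; first by rewrite el in yl'; case/setD1P: yl'.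
    have /exists_inP[g' g'J0 /and3P[_ slg' _]] := all_needed l' l'B.
    have /implyP/(_ nel) nlg := ug l' l'B.
    have ngg' : g != g' by apply: contraNneq nlg => ->.
    by have := disjointFr (dJ0 g g' gJ0 g'J0 ngg') yg; rewrite (subsetP slg').
  apply: (killed_crit xJ sB lB) => g gJ0 sg slg.
  have [/exists_inP[l' l'B /andP[]]|no] :=
      boolP [exists l' in B, (l' != l) && (fx x l' \subset f g)]; first by exists l'.
  case/exists_inP: nl; exists g => //; rewrite sg slg /=.
  apply/forall_inP => l' l'B; apply/implyP => nl'; apply: contra no => s'.
  by apply/exists_inP; exists l'; rewrite ?nl'.
have nJ0 : nonempty_on f (J0 x).
  move=> j /(subsetP (avoiding_sub _ _ _)); exact: intersecting_nonempty.
have cr : c <= #|J0 x|.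
  have [T hT] := exists_transversal nJ0 (J := J0 x) (fun j jJ => ex_intro2 _ _ j jJ (subxx _)).
  by apply: leq_trans; apply: hits_ge_avoiding hJ _ hT.
have ar : #|Com| <= #|J0 x| by rewrite subset_leq_card // subsetIr.
have ac : #|Com| <= c.
  rewrite -ltnS -(cardK xJ); apply: proper_card; apply/properP; split; first exact: subsetIl.
  case/cover_ofP: (xJ) => j jJ xj; exists j; first exact: mem_K.
  by rewrite !inE xj /= !andbF.
apply: (@bound_mixed_disjoint m c (fbetti k f J) (split_excess k f J x)
  (fbetti k f (J0 x)) (fun i => #|[set B in powerset Com | #|B| == i]|)
  cm (split_excess0 _ _ _ _) (split_excess_top _ _ _) _ _ #|J0 x| #|Com|) => //.
- move=> i _; rewrite -(fbetti_split k f J x i) -(cardK xJ).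
  rewrite fbetti_min_gens.
  rewrite (fbetti_disjoint k i (disjK xJ)) //; exact: del_nonempty.
- move=> i _; apply: split_excess_good bad.
  + exact: min_gens_sub.
  + exact: min_gens_dominates.
  + exact: disjK.
  + exact: del_nonempty.
- exact: card_set_ord.
(* If [I_0] consisted of [c] common generators, exactly one generator would contain [x] and the
   whole family would be disjoint. *)
- move=> rc; rewrite ltn_neqAle ac andbT; apply/eqP => eac.
  have eC : Com = J0 x by apply/eqP; rewrite eqEcard subsetIr rc eac /=.
  have sJ0K : J0 x \subset K x by rewrite -eC subsetIl.
  have sJK : J \subset K x.
    apply/subsetP => j jJ; have [xj|nxj] := boolP (x \in f j); first exact: mem_K.
    by apply: (subsetP sJ0K); rewrite inE jJ.
  have cD : #|K x :\: J0 x| = 1 by rewrite cardsD (setIidPr sJ0K) cardK // rc subSnn.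
  case: iJ => i [j [iJ' jJ ij /negP]]; apply; rewrite disjoints_subset.
  apply/subsetP => y yi; rewrite inE; apply/negP => yj.
  have [eyx|nyx] := eqVneq y x.
    move/eqP/cards1P: cD => [l eD]; case/eqP: ij; rewrite eyx in yi yj.
    have mD h : h \in J -> x \in f h -> h = l.
      move=> hJ' xh; apply/set1P; rewrite -eD; apply/setDP.
      by split; [exact: (subsetP sJK)|rewrite inE xh andbF].
    by rewrite (mD i) // (mD j).
  have := disjK xJ (subsetP sJK _ iJ') (subsetP sJK _ jJ) ij.
  move/disjointFr => /(_ y); rewrite !inE nyx yi yj => h; by have := h isT.
- move=> i _; apply: fbetti_disjoint => //.
by move=> i _; rewrite -cards_draws; apply: eq_card => B; rewrite !inE.
Qed.

Hypothesis avoid_int : forall x, x \in cover_of f J -> intersecting f (J0 x).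

Lemma bound_avoiding x : x \in cover_of f J -> betti_bound m c (fbetti k f (J0 x)).
Proof.
move=> xJ; apply: IH; first exact: cover_avoiding_lt.
- exact: antichain_sub (avoiding_sub _ _ _) aJ.
- exact: avoid_int.
exact: hits_ge_avoiding.
Qed.

Lemma in_cover j x : j \in J -> x \in f j -> x \in cover_of f J.
Proof. by move=> jJ xj; apply/cover_ofP; exists j. Qed.

(** Both generators stay minimal at [x = 1], where they must be disjoint. *)
Lemma linear_family i j x y : i \in J -> j \in J -> i != j ->
  x \in f i -> x \in f j -> y \in f i -> y \in f j -> x = y.
Proof.
move=> iJ' jJ ij xi xj yi yj; apply/eqP; apply: contraT => nxy.
have := disjK (in_cover iJ' xi) (mem_K iJ' xi) (mem_K jJ xj) ij.
by move/disjointFr => /(_ y); rewrite !inE eq_sym nxy yi yj => h; have := h isT.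
Qed.

Lemma killed_single x l : l \in J -> x \in f l -> killed k f J x [set l].
Proof.
move=> lJ xl; apply: (killed_crit (in_cover lJ xl) _ (set11 l)).
  by rewrite sub1set mem_K.
move=> g gJ0 + slg; have -> : cover_of (fx x) [set l] = fx x l by apply: big_set1.
have gJ := subsetP (avoiding_sub _ _ _) _ gJ0.
move=> sgl; have egl : g = l by apply: aJ; rewrite // (subset_trans sgl) // subsetDl.
by move: gJ0; rewrite egl inE xl andbF.
Qed.

(** The sets avoiding [i] are exactly half of all, and the removal of one singleton makes the count
    strict. *)
Lemma card_powersetD1 x i j : x \in cover_of f J -> i \in K x -> j \in K x -> i != j ->
  #|powerset (K x :\ i) :\ [set j]| < 2 ^ c.
Proof.
move=> xJ iK jK ij.
have cK : #|K x :\ i| = c by have := cardsD1 i (K x); rewrite iK cardK //; lia.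
have := cardsD1 [set j] (powerset (K x :\ i)).
rewrite powersetE sub1set in_setD1 eq_sym ij jK /= card_powerset cK.
by set u := #|_ :\ [set j]|; lia.
Qed.

(** By linearity no generator of [I_0] contains the two or more elements of [f i :\ x], so every [B]
    containing [i] is killed; so is [[set j]]. *)
Lemma bound_big_edge i j x : i \in J -> j \in J -> i != j ->
  x \in f i -> x \in f j -> 2 < #|f i| -> betti_bound m c.+1 (fbetti k f J).
Proof.
move=> iJ' jJ ij xi xj ci; have xJ := in_cover iJ' xi.
apply: (bound_good_strict (good := powerset (K x :\ i) :\ [set j]) xJ); last first.
- exact: card_powersetD1 (mem_K _ _) (mem_K _ _) ij.
- exact: bound_avoiding.
move=> B sB; rewrite in_setD1 powersetE subsetD1 sB /= negb_and !negbK.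
case/orP => [/eqP ->|iB]; first exact: killed_single.
apply: (killed_crit xJ sB iB) => g gJ0 _ sig.
have gJ := subsetP (avoiding_sub _ _ _) _ gJ0.
have ig : i != g by apply: contraTneq gJ0 => <-; rewrite inE xi andbF.
have /card_gt1P[y [z [yi zi nyz]]] : 1 < #|fx x i|.
  by move: ci; rewrite (cardsD1 x) xi.
case/eqP: nyz; apply: (linear_family iJ' gJ ig).
- by case/setD1P: yi.
- exact: (subsetP sig).
- by case/setD1P: zi.
exact: (subsetP sig).
Qed.

Hypothesis small_meets : forall i j x, i \in J -> j \in J -> i != j ->
  x \in f i -> x \in f j -> #|f i| = 2.

(** A generator [j] that meets no other could be removed from consideration by setting one of its
    variables [w] to 1: the intersecting pair [i], [i'] would survive among the minimal generators,
    against [disjK]. *)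
Lemma all_edges j : j \in J -> #|f j| = 2.
Proof.
move=> jJ; case: iJ => i [i' [iJ' i'J ii' /pred0Pn[u /andP[/= ui ui']]]].
have [/existsP[l /and3P[lJ lj nd]]|iso] :=
    boolP [exists l, [&& l \in J, l != j & ~~ [disjoint f j & f l]]].
  move: nd => /pred0Pn[y /andP[/= yj yl]].
  by apply: (small_meets jJ lJ _ yj yl); rewrite eq_sym.
have {}iso l : l \in J -> l != j -> [disjoint f j & f l].
  by move=> lJ lj; apply: contraR iso => nd; apply/existsP; exists l; rewrite lJ lj.
have [eij|nij] := eqVneq i j; first by rewrite eij in iJ' ui ii'; apply: small_meets ii' ui ui'.
have [ei'j|ni'j] := eqVneq i' j.
  by rewrite ei'j in i'J ui' ii'; apply: (small_meets i'J iJ' _ ui' ui); rewrite eq_sym.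
have /set0Pn[w wj] := intersecting_nonempty jJ; have wJ := in_cover jJ wj.
have inK h : h \in J -> h != j -> h \in K w /\ w \notin f h.
  move=> hJ' hj; have wh : w \notin f h by rewrite (disjointFr (iso h hJ' hj) wj).
  split=> //; have [l lK slh] := min_gens_dominates (fx w) hJ'.
  have lJ := subsetP (min_gens_sub _ _) _ lK.
  have [elj|nlj] := eqVneq l j.
    have /set0Pn[y yl] := del_nonempty lK; have /setD1P[_ yh] := subsetP slh y yl.
    by rewrite elj in yl; case/setD1P: yl => _ yj; rewrite (disjointFr (iso h hJ' hj) yj) in yh.
  suff <- : l = h by [].
  apply: aJ => //; apply/subsetP => y yl.
  have ywn : y != w by apply: contraTneq yl => ->; rewrite (disjointFr (iso l lJ nlj) wj).
  by have /(subsetP slh)/setD1P[] : y \in fx w l by rewrite !inE ywn.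
have [iK wi] := inK i iJ' nij; have [i'K wi'] := inK i' i'J ni'j.
have := disjointFr (disjK wJ iK i'K ii') (x := u); rewrite !inE ui ui' andbT.
by rewrite (_ : u != w) // => [/(_ isT)|]; last by apply: contraNneq wi => <-.
Qed.

(** * Edge ideals of graphs *)

Definition adj u w := [exists j in J, f j == [set u; w]].
Definition nbrs u := [set w | adj u w].

Lemma adjP u w : reflect (exists2 j, j \in J & f j = [set u; w]) (adj u w).
Proof. by apply: (iffP exists_inP) => -[j jJ /eqP]; exists j => //; apply/eqP. Qed.

Lemma adj_sym u w : adj u w = adj w u.
Proof. by apply/adjP/adjP => -[j jJ e]; exists j; rewrite // setUC. Qed.

Lemma mem_nbrs u w : (w \in nbrs u) = adj u w.
Proof. by rewrite inE. Qed.

Lemma edge_eq j u w : j \in J -> u \in f j -> w \in f j -> u != w -> f j = [set u; w].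
Proof.
move=> jJ uj wj uw; apply/eqP; rewrite eq_sym eqEcard cards2 uw all_edges //.
by rewrite subUset !sub1set uj wj.
Qed.

Lemma adj_neq u w : adj u w -> u != w.
Proof.
by case/adjP => j jJ e; apply/eqP => euw; have := all_edges jJ; rewrite e euw setUid cards1.
Qed.

Lemma other_end j u : j \in J -> u \in f j -> exists2 w, f j = [set u; w] & u != w.
Proof.
move=> jJ uj; have : 0 < #|f j :\ u| by have := cardsD1 u (f j); rewrite uj all_edges //; lia.
case/card_gt0P => w /setD1P[wu wj]; exists w; last by rewrite eq_sym.
by apply: edge_eq; rewrite // eq_sym.
Qed.

Lemma edge_inj i j : i \in J -> j \in J -> f i = f j -> i = j.
Proof. by move=> iJ' jJ e; apply: aJ; rewrite // e. Qed.

Lemma del_edge j v s : j \in J -> f j = [set v; s] -> fx v j = [set s].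
Proof.
move=> jJ e; have /adj_neq vs : adj v s by apply/adjP; exists j.
by rewrite /del e setU1K // inE.
Qed.

(** The edges avoiding [v] and all its neighbours: the others either pass through [v] or become
    redundant at [v = 1]. *)
Definition far v := K v :&: J0 v.

Lemma in_far v j : j \in J0 v -> [disjoint f j & nbrs v] -> j \in far v.
Proof.
move=> jJ0 dj; rewrite inE jJ0 andbT.
have jJ := subsetP (avoiding_sub _ _ _) _ jJ0.
have [l lK slj] := min_gens_dominates (fx v) jJ; rewrite (del_avoid jJ0) in slj.
have lJ := subsetP (min_gens_sub _ _) _ lK.
have [vl|nvl] := boolP (v \in f l).
  have [s e vs] := other_end lJ vl; rewrite (del_edge lJ e) sub1set in slj.
  have sv : s \in nbrs v by rewrite mem_nbrs; apply/adjP; exists l.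
  by rewrite (disjointFr dj slj) in sv.
suff <- : l = j by [].
by apply: aJ => //; rewrite -(@del_avoid v l) // inE lJ.
Qed.

Lemma far_disjoint v j : j \in far v -> [disjoint f j & nbrs v].
Proof.
move=> /setIP[jK jJ0]; rewrite disjoints_subset; apply/subsetP => s sj.
rewrite inE mem_nbrs; apply/negP => /adjP[l lJ e].
have vl : v \in f l by rewrite e set21.
have lK := mem_K lJ vl.
have elj : l = j.
  apply: (@min_gens_antichain (fx v) J) => //.
  by rewrite (del_edge lJ e) (del_avoid jJ0) sub1set.
by move: jJ0; rewrite -elj inE vl andbF.
Qed.

Lemma nbr_cover v s : adj v s -> v \in cover_of f J.
Proof. by case/adjP => j jJ e; apply: (in_cover jJ); rewrite e set21. Qed.

(* Two edges that both survive when [w = 1] cannot meet. *)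
Lemma far_share w i j y : w \in cover_of f J -> i \in far w -> j \in far w ->
  y \in f i -> y \in f j -> i = j.
Proof.
move=> wJ /setIP[iK iJ0] /setIP[jK jJ0] yi yj; apply/eqP; apply: contraT => ij.
have := disjointFr (disjK wJ iK jK ij) (x := y).
by rewrite (del_avoid iJ0) (del_avoid jJ0) yi yj => /(_ isT).
Qed.

Lemma edge_far w u y : adj u y -> w != u -> w != y -> ~~ adj w u -> ~~ adj w y ->
  exists2 j, j \in far w & f j = [set u; y].
Proof.
case/adjP => j jJ e wu wy nwu nwy; exists j => //; apply: in_far.
  by rewrite inE jJ e !inE negb_or wu wy.
rewrite e disjoints_subset subUset !sub1set !inE.
by rewrite nwu nwy.
Qed.

(** Otherwise both edges stay minimal at [w = 1], where they still meet in [u]. *)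
Lemma two_edges_dominate w u y z : w \in cover_of f J -> adj u y -> adj u z -> y != z ->
  w != u -> w != y -> w != z -> [|| adj w u, adj w y | adj w z].
Proof.
move=> wJ uy uz yz wu wy wz; apply: contraT; rewrite !negb_or => /and3P[nwu nwy nwz].
have [i iF ei] := edge_far uy wu wy nwu nwy; have [j jF ej] := edge_far uz wu wz nwu nwz.
have eij : i = j by apply: (far_share wJ iF jF (y := u)); rewrite ?ei ?ej set21.
have : y \in f j by rewrite -eij ei set22.
rewrite ej !inE (negPf yz) orbF => /eqP eyu.
by have := adj_neq uy; rewrite eyu eqxx.
Qed.

Lemma card_near v : #|[set j in J | v \in f j]| = #|nbrs v|.
Proof.
rewrite -(card_in_imset (f := f)); last first.
  by move=> i j; rewrite !inE => /andP[iJ' _] /andP[jJ _]; apply: edge_inj.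
rewrite -(card_in_imset (f := fun s => [set v; s]) (D := mem (nbrs v))); last first.
  move=> s t; rewrite !mem_nbrs => vs vt /setP/(_ s).
  by rewrite !inE eqxx orbT [s == v]eq_sym (negPf (adj_neq vs)) /= => /esym/eqP.
apply: eq_card => A; apply/imsetP/imsetP => [[j + ->]|[s + ->]].
  rewrite inE => /andP[jJ vj]; have [s e vs] := other_end jJ vj.
  by exists s => //; rewrite mem_nbrs; apply/adjP; exists j.
rewrite mem_nbrs => /adjP[j jJ e]; exists j => //.
by rewrite inE jJ e set21.
Qed.

(** The minimal generators at [v = 1] are the neighbours of [v], as variables, and the far edges. *)
Lemma card_split v : v \in cover_of f J -> c.+1 = #|nbrs v| + #|far v|.
Proof.
move=> vJ; rewrite -(cardK vJ) -card_near -(cardsID (J0 v) (K v)) addnC; congr addn.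
apply: eq_card => j; apply/setDP/setIdP => [[/(subsetP (min_gens_sub _ _)) jJ]|[jJ vj]].
  by rewrite inE jJ /= negbK.
by split; [exact: mem_K|rewrite inE vj andbF].
Qed.

Lemma near_or_far v l : l \in K v -> v \notin f l -> l \in far v.
Proof.
move=> lK nv; apply/setIP; split=> //.
by rewrite inE nv (subsetP (min_gens_sub _ _) _ lK).
Qed.

(** With [f l = [set v; s]], a generator of [I_0] divisible by [l] is an edge [[set s; w]]. If it
    divides the lcm of [B], the hypothesis puts [[set v; w]] in [B] as well, and this second factor
    also divides it. *)
Lemma killed_near v B l : v \in cover_of f J -> B \subset K v -> l \in B ->
    v \in f l -> (forall l' s w, l' \in B -> f l = [set v; s] -> w \in f l' ->
       adj s w -> v \in f l') ->
  killed k f J v B.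
Proof.
move=> vJ sB lB vl near; apply: (killed_crit vJ sB lB) => g gJ0 sg slg.
have sBJ := subset_trans sB (min_gens_sub _ _).
have gJ := subsetP (avoiding_sub _ _ _) _ gJ0; have lJ := subsetP sBJ _ lB.
have [s es vs] := other_end lJ vl; rewrite (del_edge lJ es) sub1set in slg.
have [w ew sw] := other_end gJ slg.
have /cover_ofP[l' l'B] : w \in cover_of (fx v) B by rewrite (subsetP sg) // ew set22.
have l'J := subsetP sBJ _ l'B.
case/setD1P => wv wl'; have vl' : v \in f l'.
  by apply: near l'B es wl' _; apply/adjP; exists g.
have el' : f l' = [set v; w] by apply: edge_eq; rewrite // eq_sym.
exists l'; split=> //; last by rewrite (del_edge l'J el') sub1set ew set22.
apply: contraNneq sw => ell; rewrite ell es in wl'.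
by move: wl'; rewrite !inE (negPf wv) /= eq_sym.
Qed.

(** * A vertex of maximal degree *)

Section MaxDegree.
Variable v : V.
Hypotheses (vmax : forall u, #|nbrs u| <= #|nbrs v|) (deg2 : 1 < #|nbrs v|).
Local Notation far_vertices := (cover_of f (far v)).

Lemma max_cover : v \in cover_of f J.
Proof. by case/card_gt1P: deg2 => s [_ [+ _ _]]; rewrite mem_nbrs; apply: nbr_cover. Qed.

Lemma far_J j : j \in far v -> j \in J.
Proof. by case/setIP => /(subsetP (min_gens_sub _ _)). Qed.

Lemma far_vertexP w : w \in far_vertices ->
  [/\ w \notin nbrs v, w != v & w \in cover_of f J].
Proof.
case/cover_ofP => j jF wj; split; last exact: in_cover (far_J jF) wj.
  by rewrite (disjointFr (far_disjoint jF) wj).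
by case/setIP: jF => _; rewrite inE => /andP[_]; apply: contraNneq => <-.
Qed.

Lemma far_edge j w : j \in far v -> w \in f j ->
  exists w', [/\ f j = [set w; w'], w != w', adj w w' & w' \in far_vertices].
Proof.
move=> jF wj; have jJ := far_J jF; have [w' e ww'] := other_end jJ wj.
exists w'; split=> //; first by apply/adjP; exists j.
by apply/cover_ofP; exists j; rewrite // e set22.
Qed.

(** Otherwise the path [s - v - s'] would not dominate [w]. *)
Lemma bad_unique w s s' : w \in far_vertices -> s \in nbrs v -> s' \in nbrs v ->
  ~~ adj w s -> ~~ adj w s' -> s = s'.
Proof.
move=> wF sv s'v nws nws'; have [wv wnv wJ] := far_vertexP wF.
apply/eqP; apply: contraT => ss'; rewrite !mem_nbrs in sv s'v wv.
have := two_edges_dominate wJ sv s'v ss' wnv.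
rewrite (adj_sym w v) (negPf wv) (negPf nws) (negPf nws') /= => h.
by apply: h; apply: contraNneq wv => ->.
Qed.

(** A far vertex adjacent to all neighbours of [v] would, with its partner on the far edge, have
    larger degree than [v]. *)
Lemma one_bad w : w \in far_vertices -> #|nbrs v :\: nbrs w| = 1.
Proof.
move=> wF; apply/eqP; rewrite eqn_leq; apply/andP; split.
  rewrite leqNgt; apply/negP => /card_gt1P[s [s' [/setDP[sv ws] /setDP[s'v ws']]]].
  by rewrite !mem_nbrs in ws ws'; rewrite (bad_unique wF sv s'v) // eqxx.
case/cover_ofP: (wF) => j jF wj; have [w' [_ _ ww' w'F]] := far_edge jF wj.
have [w'v _ _] := far_vertexP w'F.
have : #|w' |: (nbrs v :&: nbrs w)| <= #|nbrs w|.
  by apply: subset_leq_card; rewrite subUset sub1set mem_nbrs ww' subsetIr.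
rewrite cardsU1 in_setI (negPf w'v) /= => le1.
have := cardsID (nbrs w) (nbrs v); have := vmax w.
by move: le1; set a := #|_ :&: _|; set d := #|_ :\: _|; lia.
Qed.

Lemma exists_bad w : w \in far_vertices -> exists2 s, s \in nbrs v & ~~ adj w s.
Proof.
by move/one_bad/eqP/cards1P => [s e]; exists s; have := set11 s; rewrite -e inE mem_nbrs => /andP[].
Qed.

Lemma far_adj_near w s : w \in far_vertices -> s \in nbrs v -> s != w.
Proof. by move=> wF sv; have [+ _ _] := far_vertexP wF; apply: contraNneq => <-. Qed.

(** Every other neighbour [t] of [v] is adjacent to [w], so [s], which must be dominated by the path
    [t - w - w'], is adjacent to [t]. Together with [v] this exhausts the maximal degree. *)
Lemma nbr_far_disjoint s w w' : s \in nbrs v -> w \in far_vertices -> w' \in far_vertices ->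
  adj w w' -> ~~ adj w s -> ~~ adj w' s -> [disjoint nbrs s & far_vertices].
Proof.
move=> sv wF w'F ww' nws nw's.
have sJ : s \in cover_of f J by move: sv; rewrite mem_nbrs adj_sym; apply: nbr_cover.
have sub : v |: (nbrs v :\ s) \subset nbrs s.
  apply/subsetP => t /setU1P[->|/setD1P[ts tv]]; first by rewrite mem_nbrs adj_sym -mem_nbrs.
  rewrite mem_nbrs; apply: contraT => nst.
  have wt : adj w t by apply: contraR ts => nwt; apply/eqP; apply: (bad_unique wF).
  have [i iF ei] : exists2 j, j \in far s & f j = [set w; t].
    by apply: edge_far => //; [exact: far_adj_near|rewrite eq_sym|rewrite adj_sym].
  have [j jF ej] : exists2 j, j \in far s & f j = [set w; w'].
    by apply: edge_far => //; first [exact: far_adj_near|rewrite adj_sym].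
  have eij : i = j by apply: (far_share sJ iF jF (y := w)); rewrite ?ei ?ej set21.
  have : t \in f j by rewrite -eij ei set22.
  rewrite ej !inE => /orP[/eqP e|/eqP e]; first by have := far_adj_near wF tv; rewrite e eqxx.
  by have := far_adj_near w'F tv; rewrite e eqxx.
have eq : v |: (nbrs v :\ s) = nbrs s.
  apply/eqP; rewrite eqEcard sub (leq_trans (vmax s)) //.
  have nv : v \notin nbrs v :\ s.
    by rewrite !inE negb_and; apply/orP; right; apply/negP => /adj_neq; rewrite eqxx.
  by rewrite cardsU1 nv (cardsD1 s) sv.
rewrite -eq disjoint_sym disjoints_subset; apply/subsetP => y /far_vertexP[yv yn _].
by rewrite !inE negb_or yn negb_and -mem_nbrs yv orbT.
Qed.

(** [s] misses at most one other neighbour of [v], since two of them, [t] and [t'], would give a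
    path [t - w - t'] not dominating [s]. The degree bound leaves room for one far neighbour. *)
Lemma nbr_far_one s w : s \in nbrs v -> w \in far_vertices -> ~~ adj w s ->
  #|nbrs s :&: far_vertices| <= 1.
Proof.
move=> sv wF nws.
have sJ : s \in cover_of f J by move: sv; rewrite mem_nbrs adj_sym; apply: nbr_cover.
have le1 : #|(nbrs v :\ s) :\: nbrs s| <= 1.
  rewrite leqNgt; apply/negP => /card_gt1P[t [t' [/setDP[/setD1P[ts tv] st]
    /setDP[/setD1P[t's t'v] st']]]] /eqP; apply.
  rewrite !mem_nbrs in st st'.
  have wt : adj w t by apply: contraR ts => nwt; apply/eqP; apply: (bad_unique wF).
  have wt' : adj w t' by apply: contraR t's => nwt; apply/eqP; apply: (bad_unique wF).
  have [i iF ei] : exists2 j, j \in far s & f j = [set w; t].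
    by apply: edge_far => //; [exact: far_adj_near|rewrite eq_sym|rewrite adj_sym].
  have [j jF ej] : exists2 j, j \in far s & f j = [set w; t'].
    by apply: edge_far => //; [exact: far_adj_near|rewrite eq_sym|rewrite adj_sym].
  have eij : i = j by apply: (far_share sJ iF jF (y := w)); rewrite ?ei ?ej set21.
  have : t \in f j by rewrite -eij ei set22.
  rewrite ej !inE => /orP[/eqP e|/eqP //]; by have := far_adj_near wF tv; rewrite e eqxx.
set N1 := (nbrs v :\ s) :&: nbrs s; set N2 := nbrs s :&: far_vertices.
have d12 : [disjoint N1 & N2].
  rewrite disjoints_subset; apply/subsetP => y /setIP[/setD1P[_ yv] _].
  by rewrite !inE; apply/negP => /andP[_ /far_vertexP[]]; rewrite yv.
have vN : v \notin N1 :|: N2.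
  rewrite in_setU negb_or; apply/andP; split; apply/negP => /setIP[].
    by case/setD1P; rewrite mem_nbrs => _ /adj_neq; rewrite eqxx.
  by move=> _ /far_vertexP[_]; rewrite eqxx.
have : #|v |: (N1 :|: N2)| <= #|nbrs s|.
  apply: subset_leq_card; rewrite !subUset sub1set subsetIr subsetIl !andbT.
  by rewrite mem_nbrs adj_sym -mem_nbrs.
rewrite cardsU1 vN cardsU (eqP (_ : N1 :&: N2 == set0)) ?setI_eq0 // cards0 subn0.
have := cardsID (nbrs s) (nbrs v :\ s); have := cardsD1 s (nbrs v); have := vmax s.
rewrite sv -/N1; move: le1; set d := #|_ :\: _|; set e := #|nbrs v :\ s|.
by lia.
Qed.

(** Given two far edges, let [s] be the neighbour of [v] missed by an end [w] of the first. Either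
    [s] misses this whole edge, or its only far neighbour is [w'] and it misses the second edge;
    [nbr_far_disjoint] applies in both cases. *)
Lemma far_dichotomy :
  (exists2 s, s \in nbrs v & [disjoint nbrs s & far_vertices]) \/
  (#|far v| <= 1 /\ forall s, s \in nbrs v -> ~~ [disjoint nbrs s & far_vertices]).
Proof.
have [/exists_inP|/exists_inPn none] :=
  boolP [exists s in nbrs v, [disjoint nbrs s & far_vertices]]; first by left.
right; split=> //; rewrite leqNgt; apply/negP => /card_gt1P[i [j [iF jF ij]]].
have /set0Pn[w wi] := intersecting_nonempty (far_J iF).
have [w' [ei ww' aww' w'F]] := far_edge iF wi.
have wF : w \in far_vertices by apply/cover_ofP; exists i.
have [s sv nws] := exists_bad wF; have := none s sv.
have [aw's _|nw's] := boolP (adj w' s); last by rewrite (nbr_far_disjoint sv wF w'F).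
have vJ := max_cover.
have nadj u : u \in f j -> ~~ adj u s.
  move=> uj; apply/negP => us; have := nbr_far_one sv wF nws; rewrite leqNgt => /negP; apply.
  apply/card_gt1P; exists u, w'; split.
  - by rewrite inE mem_nbrs adj_sym us; apply/cover_ofP; exists j.
  - by rewrite inE mem_nbrs adj_sym aw's.
  apply: contraNneq ij => euw; apply/eqP; apply: (far_share vJ iF jF (y := u)) => //.
  by rewrite euw ei set22.
have /set0Pn[u uj] := intersecting_nonempty (far_J jF).
have [u' [ej uu' auu' u'F]] := far_edge jF uj.
have uF : u \in far_vertices by apply/cover_ofP; exists j.
case/negP: (none s sv); apply: (nbr_far_disjoint sv uF u'F auu'); apply: nadj => //.
by rewrite ej set22.
Qed.

(** Neighbours of [s] lie on no far edge, so [killed_near] excludes every [B] containing the edge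
    [[set v; s]]: half of all sets. The singleton of another edge at [v] gives strictness. *)
Lemma bound_isolated_nbr s : s \in nbrs v -> [disjoint nbrs s & far_vertices] ->
  betti_bound m c.+1 (fbetti k f J).
Proof.
move=> sv ds; have vJ := max_cover.
case/adjP: (etrans (esym (mem_nbrs v s)) sv) => l lJ el.
have [s' s's s'v] : exists2 s', s' != s & s' \in nbrs v.
  case/card_gt1P: deg2 => a [b [av bv ab]].
  by have [ea|] := eqVneq a s; [exists b; rewrite // -ea eq_sym|exists a].
case/adjP: (etrans (esym (mem_nbrs v s')) s'v) => l' l'J el'.
have vl : v \in f l by rewrite el set21.
have vl' : v \in f l' by rewrite el' set21.
have ll' : l != l'.
  apply: contraNneq s's => ell; have : s' \in f l by rewrite ell el' set22.
  rewrite el !inE => /orP[/eqP e|//].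
  by move: s'v; rewrite mem_nbrs => /adj_neq; rewrite e eqxx.
apply: (bound_good_strict (good := powerset (K v :\ l) :\ [set l']) vJ); last first.
- exact: card_powersetD1 (mem_K _ _) (mem_K _ _) ll'.
- exact: bound_avoiding.
move=> B sB; rewrite in_setD1 powersetE subsetD1 sB /= negb_and !negbK.
case/orP => [/eqP ->|lB]; first exact: killed_single.
apply: (killed_near vJ sB lB vl) => l1 t w l1B elt wl1 tw.
have {elt}ets : t = s.
  have : t \in f l by rewrite elt set22.
  rewrite el !inE => /orP[/eqP e|/eqP //].
  have /adj_neq : adj v t by apply/adjP; exists l.
  by rewrite e eqxx.
apply: contraT => vl1; have l1F := near_or_far (subsetP sB _ l1B) vl1.
have : w \in far_vertices by apply/cover_ofP; exists l1.
by rewrite (disjointFr ds) // mem_nbrs -ets.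
Qed.

(** All edges of [B] pass through [v], so only the empty [B] survives. *)
Lemma bound_no_far : far v = set0 -> betti_bound m c.+1 (fbetti k f J).
Proof.
move=> far0; have vJ := max_cover; have := card_split vJ; rewrite far0 cards0 addn0 => cd.
apply: (bound_good_strict (good := [set set0]) vJ); last first.
- by rewrite cards1 -(expn0 2) ltn_exp2l //; lia.
- exact: bound_avoiding.
have near l : l \in K v -> v \in f l.
  by move=> lK; apply: contraT => /(near_or_far lK); rewrite far0 inE.
move=> B sB; rewrite inE => /set0Pn[l lB]; apply: (killed_near vJ sB lB).
  exact/near/(subsetP sB).
by move=> l' s w l'B _ _ _; apply/near/(subsetP sB).
Qed.

Lemma seq_poly_good (good : {set {set 'I_m}}) :
  (seq_poly m (fun i => #|[set B in good | #|B| == i]|)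
   = \sum_(B in good) 'X^#|B| :> {poly int})%R.
Proof.
apply/polyP => i; rewrite coef_poly coef_sum.
under eq_bigr => B _ do rewrite coefXn eq_sym.
rewrite -natr_sum -big_mkcondr /= sum1dep_card; case: ifP => // /negbT im.
suff -> : [set B in good | #|B| == i] = set0 by rewrite cards0.
apply/setP => B; rewrite !inE; apply/negP => /andP[_ /eqP cB].
by move: im; rewrite -cB ltnS card_set_ord.
Qed.

(** * A single far edge *)

Section OneFar.
Variable e0 : 'I_m.
Hypotheses (far1 : far v = [set e0])
  (meets : forall s, s \in nbrs v -> ~~ [disjoint nbrs s & far_vertices]).
Variables w w' : V.
Hypotheses (ew : f e0 = [set w; w']) (ww' : w != w').

Let vJ := max_cover.

Let e0F : e0 \in far v. Proof. by rewrite far1 set11. Qed.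

Let e0J : e0 \in J := far_J e0F.

Let far_verts : far_vertices = [set w; w'].
Proof. by rewrite far1 /cover_of big_set1. Qed.

Let wF : w \in far_vertices. Proof. by rewrite far_verts set21. Qed.
Let w'F : w' \in far_vertices. Proof. by rewrite far_verts set22. Qed.

Let degE : c = #|nbrs v|.
Proof. by have := card_split vJ; rewrite far1 cards1 addn1 => -[]. Qed.

Let card_common u : u \in far_vertices -> #|nbrs v :&: nbrs u| = c.-1.
Proof.
move=> uF; have := cardsID (nbrs u) (nbrs v); rewrite one_bad // -degE.
by set a := #|_|; lia.
Qed.

Let e0K : e0 \in K v. Proof. by case/setIP: e0F. Qed.
Let e0J0 : e0 \in J0 v. Proof. by case/setIP: e0F. Qed.

Definition far_star u := [set [set s; u] | s in nbrs v :&: nbrs u].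

(** The far edge and the edges joining it to neighbours of [v]. All avoid [v], which forces [I_0] to
    have at least [2(c - 1) + 1] generators. *)
Let inner_edges := far_star w :|: far_star w' :|: [set [set w; w']].

Let card_inner : #|inner_edges| = (c.-1 + c.-1).+1.
Proof.
have star u : u \in far_vertices -> #|far_star u| = c.-1.
  move=> uF; rewrite card_in_imset ?card_common // => s t /setIP[sv _] /setIP[tv _].
  move/setP/(_ s); rewrite !inE eqxx /= (negPf (far_adj_near uF sv)) orbF.
  by move/esym/eqP.
have d1 : [disjoint far_star w & far_star w'].
  rewrite disjoints_subset; apply/subsetP => _ /imsetP[s /setIP[sv _] ->].
  rewrite inE; apply/negP => /imsetP[t /setIP[tv _] /setP/(_ w)].
  by rewrite !inE eqxx orbT (negPf ww') orbF => /esym/eqP e; have := far_adj_near wF tv; rewrite e eqxx.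
have d2 : [set w; w'] \notin far_star w :|: far_star w'.
  have no u : u \in far_vertices -> [set w; w'] \notin far_star u.
    move=> uF; apply/negP => /imsetP[s /setIP[sv _] /setP/(_ s)].
    rewrite !inE eqxx /= => /orP[] /eqP e; first by have := far_adj_near wF sv; rewrite e eqxx.
    by have := far_adj_near w'F sv; rewrite e eqxx.
  by rewrite inE negb_or !no.
rewrite /inner_edges setUC cardsU1 d2 cardsU (eqP (_ : _ :&: _ == set0)) ?setI_eq0 //.
by rewrite cards0 subn0 !star.
Qed.

Let inner_sub : inner_edges \subset f @: J0 v.
Proof.
have star u : u \in far_vertices -> far_star u \subset f @: J0 v.
  move=> uF; apply/subsetP => _ /imsetP[s /setIP[sv us] ->].
  have [_ uv _] := far_vertexP uF.
  case/adjP: (etrans (esym (mem_nbrs u s)) us) => j jJ ej.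
  apply/imsetP; exists j; last by rewrite ej setUC.
  rewrite inE jJ ej !inE negb_or eq_sym uv /=.
  by apply: contraTneq sv => <-; rewrite mem_nbrs; apply/negP => /adj_neq; rewrite eqxx.
rewrite !subUset !star //= sub1set; apply/imsetP; exists e0 => //.
Qed.

Let card_J0 : #|f @: J0 v| = #|J0 v|.
Proof.
rewrite card_in_imset // => i j.
by rewrite !inE => /andP[iJ' _] /andP[jJ _]; apply: edge_inj.
Qed.

(** Excluding the nonempty [B] without [e0] leaves [2^c + 1] sets, one more than half; the parity of
    the Betti sum of [I_0] makes up for it when [I_0] is not extremal. *)
Let bound_loose : 2 * seq_sum m (fbetti k f (J0 v)) != 3 * 2 ^ c ->
  betti_bound m c.+1 (fbetti k f J).
Proof.
move=> neq; pose good := set0 |: [set B in powerset (K v) | e0 \in B].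
have bad B : B \subset K v -> B \notin good -> killed k f J v B.
  move=> sB; rewrite !inE sB negb_or /= => /andP[/set0Pn[l lB] eB].
  have near l' : l' \in B -> v \in f l'.
    move=> l'B; apply: contraT => /(near_or_far (subsetP sB _ l'B)).
    by rewrite far1 => /set1P el; rewrite -el l'B in eB.
  by apply: (killed_near vJ sB lB) => [|l' s u l'B _ _ _]; apply: near.
have cgood : #|good| <= (2 ^ c).+1.
  apply: leq_trans (leq_card_setU _ _) _; rewrite cards1 add1n ltnS.
  have := cardsID [set B : {set 'I_m} | e0 \in B] (powerset (K v)).
  rewrite card_powerset cardK // expnS.
  have -> : powerset (K v) :\: [set B : {set 'I_m} | e0 \in B] = powerset (K v :\ e0).
    by apply/setP => B; rewrite in_setD in_set !powersetE subsetD1 andbC.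
  have cKe : #|K v :\ e0| = c.
    by have /eqP := cardsD1 e0 (K v); rewrite e0K cardK // add1n eqSS => /eqP.
  rewrite card_powerset cKe mul2n -addnn => /eqP; rewrite eqn_add2r => /eqP eqc.
  have -> : [set B in powerset (K v) | e0 \in B]
     = powerset (K v) :&: [set B : {set 'I_m} | e0 \in B].
    by apply/setP => B; rewrite !inE.
  by rewrite eqc.
have := good_sum vJ bad; have [le1 _] := bound_avoiding vJ.
have [r par] := seq_sum_fbetti_parity f (J0 v).
have [n0 eqn] : exists n0, #|J0 v| = n0.+1.
  by have := cardsD1 e0 (J0 v); rewrite e0J0 add1n => ->; eexists.
have [c' eqc'] : exists c', c = c'.+2.
  by move: deg2; rewrite -degE; case: (c) => [|[|c']] // _; exists c'.
rewrite eqn expnS in par; move=> le2; apply: bound_strict.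
rewrite eqc' in le1 le2 neq cgood *; exact: loose_arith le1 le2 neq cgood par.
Qed.

Let inner_eq : #|J0 v| <= (c.-1 + c.-1).+1 ->
  forall j, j \in J0 v -> f j \in inner_edges.
Proof.
move=> le j jJ0; have /eqP -> : inner_edges == f @: J0 v; last exact: imset_f.
by rewrite eqEcard inner_sub card_J0 card_inner.
Qed.

(** If the five inner edges are all of [I_0], then [v], [w], [w'] hit every edge, whereas hitting
    sets need four vertices. *)
Let not_three : c = 3 -> ~ #|J0 v| <= 5.
Proof.
move=> c3 le; have inner : forall j, j \in J0 v -> f j \in inner_edges.
  by apply: inner_eq; rewrite c3.
have: hitting f J [set v; w; w'].
  move=> j jJ; apply/set0Pn; have [vj|nvj] := boolP (v \in f j).
    by exists v; rewrite !inE vj eqxx.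
  have /inner : j \in J0 v by rewrite inE jJ.
  rewrite !inE -orbA => /or3P[/imsetP[s _ ->]|/imsetP[s _ ->]|/eqP ->].
  - by exists w; rewrite !inE eqxx !orbT.
  - by exists w'; rewrite !inE eqxx !orbT.
  by exists w; rewrite !inE eqxx !orbT.
move/hJ; rewrite c3 leqNgt => /negP; apply; rewrite ltnS.
apply: leq_trans (leq_card_setU _ _) _; rewrite cards1 addn1 ltnS.
by apply: leq_trans (leq_card_setU _ _) _; rewrite !cards1.
Qed.

(** * The pentagon [v - s1 - w - w' - s2 - v] *)

Section Pentagon.
Hypotheses (c2 : c = 2) (J0le : #|J0 v| <= 3).
Variables s1 s2 : V.
Hypotheses (N1 : nbrs v :&: nbrs w = [set s1]) (N2 : nbrs v :&: nbrs w' = [set s2]).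

Let inner : forall j, j \in J0 v -> f j \in inner_edges.
Proof. by apply: inner_eq; rewrite c2. Qed.

Let s1v : s1 \in nbrs v. Proof. by have := set11 s1; rewrite -N1 => /setIP[]. Qed.
Let s2v : s2 \in nbrs v. Proof. by have := set11 s2; rewrite -N2 => /setIP[]. Qed.

(** If they coincided, the other neighbour of [v] would have no far neighbour, against [meets]. *)
Let s12 : s1 != s2.
Proof.
apply/eqP => e; have [t tv ts] : exists2 t, t \in nbrs v & t != s1.
  case/card_gt1P: deg2 => a [b [av bv ab]].
  by have [ea|] := eqVneq a s1; [exists b; rewrite // -ea eq_sym|exists a].
case/negP: (meets tv); rewrite far_verts disjoint_sym disjoints_subset subUset !sub1set.
rewrite !inE; apply/andP; split; apply: contra ts => at_; rewrite -in_set1.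
  by rewrite -N1 inE tv mem_nbrs adj_sym.
by rewrite e -N2 inE tv mem_nbrs adj_sym.
Qed.

Let nbrsE : nbrs v = [set s1; s2].
Proof.
apply/eqP; rewrite eq_sym eqEcard -degE c2 cards2 s12 subUset !sub1set.
by rewrite s1v s2v.
Qed.

Variables g1 g2 l1 l2 : 'I_m.
Hypotheses (g1J : g1 \in J) (g2J : g2 \in J) (l1J : l1 \in J) (l2J : l2 \in J).
Hypotheses (eg1 : f g1 = [set w; s1]) (eg2 : f g2 = [set w'; s2]).
Hypotheses (el1 : f l1 = [set v; s1]) (el2 : f l2 = [set v; s2]).

Let J0E j : j \in J0 v -> j = e0 \/ j = g1 \/ j = g2.
Proof.
move=> jJ0; have jJ := subsetP (avoiding_sub _ _ _) _ jJ0; have := inner jJ0.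
rewrite !inE /far_star N1 N2 -orbA => /or3P[/imsetP[s /set1P-> e]|/imsetP[s /set1P-> e]|/eqP e].
- by right; left; apply: edge_inj; rewrite // e eg1 setUC.
- by right; right; apply: edge_inj; rewrite // e eg2 setUC.
by left; apply: edge_inj; rewrite // e ew.
Qed.

Let vl1 : v \in f l1. Proof. by rewrite el1 set21. Qed.
Let vl2 : v \in f l2. Proof. by rewrite el2 set21. Qed.

Let l12 : l1 != l2.
Proof.
apply: contraNneq s12 => e; have : s1 \in f l2 by rewrite -e el1 set22.
rewrite el2 !inE => /orP[/eqP e1|/eqP -> //].
by move: s1v; rewrite e1 mem_nbrs => /adj_neq; rewrite eqxx.
Qed.

Let l1e : l1 != e0. Proof. by apply: contraTneq e0J0 => <-; rewrite inE vl1 andbF. Qed.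
Let l2e : l2 != e0. Proof. by apply: contraTneq e0J0 => <-; rewrite inE vl2 andbF. Qed.

Let KE l : l \in K v -> [\/ l = l1, l = l2 | l = e0].
Proof.
move=> lK; have lJ := subsetP (min_gens_sub _ _) _ lK.
have [vl|nvl] := boolP (v \in f l); last first.
  by have := near_or_far lK nvl; rewrite far1 => /set1P ->; apply: Or33.
have [s es _] := other_end lJ vl.
have : s \in nbrs v by rewrite mem_nbrs; apply/adjP; exists l.
rewrite nbrsE => /set2P[e|e]; [apply: Or31|apply: Or32];
by apply: edge_inj; rewrite // es e ?el1 ?el2.
Qed.

Let killed_top B : B \subset K v -> e0 \in B -> l1 \in B -> l2 \in B -> killed k f J v B.
Proof.
move=> sB eB l1B l2B; exists (J0 v); split; last 1 first.
- set b := cover_of _ B.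
  have sb1 : s1 \in b by apply/cover_ofP; exists l1; rewrite // (del_edge l1J el1) set11.
  have sb2 : s2 \in b by apply/cover_ofP; exists l2; rewrite // (del_edge l2J el2) set11.
  apply: (@hdim_cone _ _ _ e0); first exact: weight_fam_convex.
  move=> A /weight_famP[sA cA].
  have inA s g : s \in b -> g \in J -> (forall j, j \in J0 v -> s \in f j -> j = g) -> g \in A.
    rewrite -cA => /cover_ofP[j jA /setD1P[_ sj]] gJ uniq.
    by rewrite -(uniq j) // (subsetP sA).
  have g1A : g1 \in A.
    apply: (inA s1) => // j /J0E[->|[->//|->]].
      by rewrite ew !inE !(negPf (far_adj_near _ s1v)).
    by rewrite eg2 !inE (negPf (far_adj_near w'F s1v)) (negPf s12).
  have g2A : g2 \in A.
    apply: (inA s2) => // j /J0E[->|[->|->//]].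
      by rewrite ew !inE !(negPf (far_adj_near _ s2v)).
    by rewrite eg1 !inE (negPf (far_adj_near wF s2v)) eq_sym (negPf s12).
  have ge g s u : g \in J -> f g = [set u; s] -> s \in nbrs v -> g != e0.
    move=> gJ eg sv; apply/eqP => e; have : s \in f e0 by rewrite -e eg set22.
    by rewrite ew !inE !(negPf (far_adj_near _ sv)).
  have inC (C : {set 'I_m}) : g1 \in C -> g2 \in C -> fx v e0 \subset cover_of (fx v) C.
    move=> g1C g2C; rewrite (del_avoid e0J0) ew subUset !sub1set.
    have [_ wv _] := far_vertexP wF; have [_ w'v _] := far_vertexP w'F.
    apply/andP; split; apply/cover_ofP; [exists g1|exists g2] => //.
      by rewrite in_setD1 wv eg1 set21.
    by rewrite in_setD1 w'v eg2 set21.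
  have cU : cover_of (fx v) (e0 |: A) = b by rewrite cover_setU1 (setUidPr (inC A _ _)).
  split; apply/weight_famP; split=> //.
  - by rewrite subUset sub1set e0J0.
  - exact: subset_trans (subsetDl _ _) sA.
  rewrite -cU; have <- : e0 |: (A :\ e0) = e0 |: A.
    by apply/setP => j; rewrite !inE; case: eqP.
  rewrite cover_setU1 (setUidPr (inC _ _ _)) // in_setD1 ?g1A ?g2A andbT.
    exact: ge eg1 s1v.
  exact: ge eg2 s2v.
- by apply/subsetP => j /setIdP[].
exact: avoiding_sub.
Qed.

(** The sizes 0, 1, 2, 2 contribute [1 + t + 2t^2]. *)
Let good := set0 |: ([set e0] |: ([set l1; e0] |: [set [set l2; e0]])).

Let bad B : B \subset K v -> B \notin good -> killed k f J v B.
Proof.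
move=> sB nB; have BE (C : {set 'I_m}) : C \subset K v ->
    (l1 \in B) = (l1 \in C) -> (l2 \in B) = (l2 \in C) -> (e0 \in B) = (e0 \in C) -> B = C.
  move=> sC h1 h2 h3; apply/setP => l; case lK: (l \in K v).
    by case: (KE lK) => ->.
  by rewrite (contraFF (subsetP sB l) lK) (contraFF (subsetP sC l) lK).
have l1K : l1 \in K v by apply: mem_K.
have l2K : l2 \in K v by apply: mem_K.
have [eB|eB] := boolP (e0 \in B); last first.
  have near l' : l' \in B -> v \in f l'.
    move=> l'B; apply: contraT => /(near_or_far (subsetP sB _ l'B)).
    by rewrite far1 => /set1P el; rewrite -el l'B in eB.
  have /set0Pn[l lB] : B != set0 by apply: contraNneq nB => ->; rewrite setU11.
  by apply: (killed_near vJ sB lB) => [|l' s u l'B _ _ _]; apply: near.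
case l1B: (l1 \in B); case l2B: (l2 \in B); first exact: killed_top.
- have e : B = [set l1; e0].
    by apply: BE; rewrite ?subUset ?sub1set ?l1K ?e0K // ?l1B ?l2B ?eB !inE ?eqxx ?orbT //
       eq_sym (negPf l12) (negPf l2e).
  by case/negP: nB; rewrite e !inE eqxx !orbT.
- have e : B = [set l2; e0].
    by apply: BE; rewrite ?subUset ?sub1set ?l2K ?e0K // ?l1B ?l2B ?eB !inE ?eqxx ?orbT //
       (negPf l12) (negPf l1e).
  by case/negP: nB; rewrite e !inE eqxx !orbT.
have e : B = [set e0].
  by apply: BE; rewrite ?sub1set ?e0K // ?l1B ?l2B ?eB !inE ?eqxx // ?(negPf l1e) ?(negPf l2e).
by case/negP: nB; rewrite e !inE eqxx !orbT.
Qed.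

Let n0 : set0 \notin [set e0] |: ([set l1; e0] |: [set [set l2; e0]]).
Proof.
rewrite !inE; apply/negP => /or3P[] /eqP/setP/(_ e0); rewrite !inE eqxx ?orbT //.
Qed.

Let n1 : [set e0] \notin [set l1; e0] |: [set [set l2; e0]].
Proof.
rewrite !inE; apply/negP => /orP[] /eqP/setP.
  by move/(_ l1); rewrite !inE eqxx (negPf l1e).
by move/(_ l2); rewrite !inE eqxx (negPf l2e).
Qed.

Let n2 : [set l1; e0] \notin [set [set l2; e0]].
Proof.
rewrite !inE; apply/negP => /eqP/setP/(_ l1).
by rewrite !inE eqxx (negPf l12) (negPf l1e).
Qed.

Lemma bound_pentagon : 2 * seq_sum m (fbetti k f (J0 v)) = 3 * 2 ^ c ->
  betti_bound m c.+1 (fbetti k f J).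
Proof.
move=> eqS; have cgood : #|good| = 4 by rewrite /good !cardsU1 n0 n1 n2 cards1.
have := good_sum vJ bad; have := good_poly vJ bad.
rewrite cgood; have [_ /(_ eqS) eqp] := bound_avoiding vJ.
rewrite c2 in eqS eqp *; move=> polyH leS.
split; first exact: pentagon_arith leS eqS.
move=> eqH; right; exists 0 => //.
case: eqp => [eqp|[d //]].
have {}eqp : (seq_poly m (fbetti k f (J0 v)) = (1 + 2%:R *: 'X) * (1 + 'X))%R.
  have nz : (1 + 'X : {poly int})%R != 0%R.
    by rewrite addrC -[1%R]opprK -polyCN polyXsubC_eq0.
  by apply: (mulIf nz); rewrite eqp -mulrA -expr2.
rewrite polyH ?eqp; last exact: pentagon_arith_eq eqS eqH.
(* The identity is [(1+t)^3 + (1+t)((1+2t)(1+t) - (1+t+2t^2)) = 1 + 5t + 5t^2 + t^3]. *)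
rewrite seq_poly_good /good !big_setU1 ?n0 ?n1 ?n2 //= big_set1.
rewrite cards0 cards1 !cards2 l1e l2e !scaler_nat.
by rewrite expr0 /=; ring.
Qed.

End Pentagon.

(** If [I_0] is extremal it has at most [c + 1] generators, or [c + 2] with [c > 2], against at
    least [2c - 1] inner edges. This leaves [c = 2], the pentagon, and [c = 3], which is
    excluded. *)
Lemma bound_one_far : betti_bound m c.+1 (fbetti k f J).
Proof.
have [eqS|] := eqVneq (2 * seq_sum m (fbetti k f (J0 v))) (3 * 2 ^ c); last exact: bound_loose.
have m0 : 0 < m by apply: leq_ltn_trans (ltn_ord e0).
have J0le := card_le_fbetti1 (antichain_sub (avoiding_sub f J v) aJ)
  (fun j hj => intersecting_nonempty (subsetP (avoiding_sub _ _ _) j hj)).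
have := subset_leq_card inner_sub; rewrite card_J0 card_inner => J0ge.
have c2 : 1 < c by rewrite degE.
have [h1|[c3 h1]] := bound_eq_coef1 m0 (bound_avoiding vJ) eqS; rewrite h1 in J0le.
  have ec : c = 2 by move: c2 J0ge J0le; clear; case: (c) => [|[|[|c']]] //; lia.
  have sel u : u \in far_vertices -> exists2 s, nbrs v :&: nbrs u = [set s] & true.
    by move=> uF; have /eqP/cards1P[s ->] : #|nbrs v :&: nbrs u| = 1;
       [rewrite card_common // ec|exists s].
  have [s1 N1 _] := sel w wF; have [s2 N2 _] := sel w' w'F.
  have : s1 \in nbrs v :&: nbrs w by rewrite N1 set11.
  have : s2 \in nbrs v :&: nbrs w' by rewrite N2 set11.
  rewrite !in_setI !mem_nbrs => /andP[/adjP[l2 l2J el2] /adjP[g2 g2J eg2]].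
  case/andP => /adjP[l1 l1J el1] /adjP[g1 g1J eg1].
  apply: (bound_pentagon ec _ N1 N2 g1J g2J l1J l2J eg1 eg2 el1 el2 eqS).
  by rewrite ec in J0le.
have ec : c = 3 by move: c3 J0ge J0le; clear; case: (c) => [|[|[|[|c']]]] //; lia.
by case: (not_three ec); rewrite ec in J0le.
Qed.

End OneFar.

End MaxDegree.

Lemma bound_graph : betti_bound m c.+1 (fbetti k f J).
Proof.
case: (iJ) => i [j [iJ' jJ ij /pred0Pn[u /andP[/= ui uj]]]].
have [a ea ua] := other_end iJ' ui; have [b eb ub] := other_end jJ uj.
have degu : 1 < #|nbrs u|.
  apply/card_gt1P; exists a, b; split.
  - by rewrite mem_nbrs; apply/adjP; exists i.
  - by rewrite mem_nbrs; apply/adjP; exists j.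
  by apply: contraNneq ij => eab; apply/eqP/edge_inj; rewrite // ea eb eab.
case: (arg_maxnP (fun x => #|nbrs x|) (isT : xpredT u)) => v _ vmax.
have {}vmax x : #|nbrs x| <= #|nbrs v| by apply: vmax.
have deg2 : 1 < #|nbrs v| := leq_trans degu (vmax u).
have [[s sv ds]|[far1 meets]] := far_dichotomy vmax deg2.
  exact: (bound_isolated_nbr deg2 sv ds).
move: far1; rewrite leq_eqVlt ltnS leqn0 => /orP[/cards1P[e0 far1]|]; last first.
  by rewrite cards_eq0 => /eqP; apply: bound_no_far.
have e0F : e0 \in far v by rewrite far1 set11.
have /set0Pn[w we] := intersecting_nonempty (far_J e0F).
have [w' [ew ww' _ _]] := far_edge e0F we.
exact: (bound_one_far vmax deg2 far1 meets ew ww').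
Qed.

End Step.
Lemma forall_or_exists (S : finType) (P Q : S -> Prop) :
  (forall z, P z \/ Q z) -> (forall z, P z) \/ (exists z, Q z).
Proof.
move=> PQ; suff: (forall z, z \in enum S -> P z) \/ (exists z, Q z).
  by case=> [h|]; [left=> z; apply: h; rewrite mem_enum|right].
elim: (enum S) => [|y s [IHs|]]; [by left| |by right].
by case: (PQ y) => [Py|Qy]; [left=> z /predU1P[->|/IHs]|right; exists y].
Qed.

Lemma family_bound f J c : antichain f J -> intersecting f J -> hits_ge f J c ->
  betti_bound m c (fbetti k f J).
Proof.
have [N] := ubnP #|cover_of f J|; elim: N f J c => // N IHN f J c; rewrite ltnS => leN aJ iJ.
have IH f' J' c' : #|cover_of f' J'| < #|cover_of f J| -> antichain f' J' ->
    intersecting f' J' -> hits_ge f' J' c' -> betti_bound m c' (fbetti k f' J').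
  by move=> lt; apply: IHN; apply: leq_trans lt leN.
suff main c' : hits_ge f J c'.+1 -> betti_bound m c'.+1 (fbetti k f J).
  (* A hitting set of a nonempty family of nonempty sets is nonempty, so at [c = 0] the stronger
     bound for 1 is available. *)
  case: c => [_|c]; last exact: main.
  have [le1 _] : betti_bound m 1 (fbetti k f J).
    apply: main => T hT; rewrite card_gt0; case: iJ => i [_ [iJ' _ _ _]].
    have /set0Pn[y /setIP[_ yT]] := hT i iJ'; by apply/set0Pn; exists y.
  by apply: bound_strict; apply: leq_trans le1.
move=> {c} hJ; set c := c' in hJ *.
have [/exists_inP[j jJ cj]|/exists_inPn big] := boolP [exists j in J, #|f j| <= 1].
  have : #|f j| == 1.
    by rewrite eqn_leq cj card_gt0; apply: (intersecting_nonempty aJ iJ).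
  by case/cards1P => x fj; apply: (bound_singleton aJ iJ hJ IH jJ fj).
have no_single j : j \in J -> 1 < #|f j| by move/big; rewrite -ltnNge.
have [disjK|[x [xJ iK]]] : (forall x, x \in cover_of f J ->
      pairwise_disjoint (del f x) (min_gens (del f x) J)) \/
    (exists x, x \in cover_of f J /\ intersecting (del f x) (min_gens (del f x) J)).
  apply: forall_or_exists => x; have [xJ|nx] := boolP (x \in cover_of f J); last by left.
  by have [d|i] := disjoint_or_intersecting (del f x) (min_gens (del f x) J); [left|right].
  2: exact: (bound_localize hJ IH xJ iK).
have [/exists_inP[x xJ cx]|/exists_inPn small] :=
    boolP [exists x in cover_of f J, c.+1 < #|min_gens (del f x) J|].
  exact: (bound_many no_single xJ (disjK x xJ) cx).
have cardK x : x \in cover_of f J -> #|min_gens (del f x) J| = c.+1.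
  move=> xJ; apply/eqP; rewrite eqn_leq (card_K_ge hJ no_single) andbT leqNgt.
  exact: small.
have [avoid_int|[x [xJ dJ0]]] : (forall x, x \in cover_of f J ->
      intersecting f (avoiding f J x)) \/
    (exists x, x \in cover_of f J /\ pairwise_disjoint f (avoiding f J x)).
  apply: forall_or_exists => x; have [xJ|nx] := boolP (x \in cover_of f J); last by left.
  by have [d|i] := disjoint_or_intersecting f (avoiding f J x); [right|left].
  2: exact: (bound_avoiding_disjoint aJ iJ hJ no_single disjK cardK xJ dJ0).
have [/existsP[i /existsP[j /existsP[x /and5P[iJ' jJ ij xi /andP[xj ci]]]]]|none] :=
  boolP [exists i, exists j, exists x,
    [&& i \in J, j \in J, i != j, x \in f i & (x \in f j) && (2 < #|f i|)]].
  exact: (bound_big_edge aJ hJ IH no_single disjK cardK avoid_int iJ' jJ ij xi xj ci).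
apply: bound_graph => // i j x iJ' jJ ij xi xj; apply/eqP; rewrite eqn_leq no_single //.
rewrite andbT leqNgt; apply: contra none => ci; apply/existsP; exists i.
by apply/existsP; exists j; apply/existsP; exists x; rewrite iJ' jJ ij xi xj.
Qed.

End FamilyBound.

(** * Comparison of free resolutions *)

Local Open Scope ring_scope.

Section Comparison.
Variables (R : comNzRingType) (p q : nat -> nat).
Variables (dP : forall i, 'M[R]_(p i.+1, p i)) (dQ : forall i, 'M[R]_(q i.+1, q i)).
Hypotheses (PP : forall i, dP i.+1 *m dP i = 0) (QQ : forall i, dQ i.+1 *m dQ i = 0).
Hypothesis exP : forall i (v : 'rV_(p i.+1)), v *m dP i = 0 -> exists u, v = u *m dP i.+1.
Hypothesis exQ : forall i (v : 'rV_(q i.+1)), v *m dQ i = 0 -> exists u, v = u *m dQ i.+1.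

Lemma lift_rows (a b c : nat) (M : 'M[R]_(a, b)) (D : 'M[R]_(c, b)) :
  (forall i, exists u, row i M = u *m D) -> exists N, M = N *m D.
Proof.
move=> /fin_all_exists[U hU]; exists (\matrix_i U i); apply/row_matrixP => i.
by rewrite row_mul rowK.
Qed.

Lemma exact_lift (r : nat -> nat) (d : forall i, 'M[R]_(r i.+1, r i)) a i (M : 'M_(a, r i.+1)) :
  (forall i (v : 'rV_(r i.+1)), v *m d i = 0 -> exists u, v = u *m d i.+1) ->
  M *m d i = 0 -> exists N, M = N *m d i.+1.
Proof.
by move=> ex M0; apply: lift_rows => j; apply: ex; rewrite -row_mul M0 row0.
Qed.

(** The state carried from degree to degree: [g] and [f] send boundaries to boundaries, and the
    defect of the homotopy [s] vanishes on the image of [dP i]. Exactness then yields the next chain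
    maps and the next homotopy. *)
Definition comparable_at i (g : 'M_(p i, q i)) (f : 'M_(q i, p i)) (s : 'M_(p i, p i.+1)) :=
  [/\ exists N, dP i *m g = N *m dQ i, exists N, dQ i *m f = N *m dP i
    & dP i *m (g *m f - 1%:M - s *m dP i) = 0].

Lemma comparable_step i g f s : @comparable_at i g f s ->
  exists g' f' s', @comparable_at i.+1 g' f' s' /\
    g' *m f' - 1%:M = dP i *m s + s' *m dP i.+1.
Proof.
move=> [[g' hg] [f' hf] h0].
have [s' hs] : exists s', g' *m f' - 1%:M - dP i *m s = s' *m dP i.+1.
  apply: (exact_lift exP); rewrite !mulmxBl -mulmxA -hf mulmxA -hg mul1mx -[RHS]h0.
  by rewrite !mulmxBr mulmx1 !mulmxA.
have hs' : g' *m f' - 1%:M = dP i *m s + s' *m dP i.+1 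
  by apply/eqP; rewrite -subr_eq0 opprD addrA hs subrr.
exists g', f', s'; split=> //; split.
- by apply: (exact_lift exQ); rewrite -mulmxA -hg mulmxA PP mul0mx.
- by apply: (exact_lift exP); rewrite -mulmxA -hf mulmxA QQ mul0mx.
by rewrite hs' addrK mulmxA PP mul0mx.
Qed.

Hypothesis base : exists g f s, @comparable_at 0 g f s.

Lemma comparable_all i : exists g f s, @comparable_at i g f s.
Proof.
elim: i => // i [g [f [s /comparable_step[g' [f' [s' [h _]]]]]]].
by exists g', f', s'.
Qed.

(** Over [k], the homotopy writes every cycle of [P] as an element of the image of [f'] plus a
    boundary, so the homology of the reduced [P] has dimension at most [q i.+1]. *)
Lemma comparison_rank_le (k : fieldType) (phi : {rmorphism R -> k}) i :
  (p i.+1 <= q i.+1 + \rank (map_mx phi (dP i)) + \rank (map_mx phi (dP i.+1)))%N.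
Proof.
have [g [f [s /comparable_step[g' [f' [s' [_ h]]]]]]] := comparable_all i.
set D := map_mx phi (dP i); set D' := map_mx phi _.
have rk := mxrank_ker D.
have Z0 : kermx D *m D = 0 by apply: mulmx_ker.
have Zsub : (kermx D <= map_mx phi f' + D')%MS.
  have := congr1 (fun M => kermx D *m map_mx phi M) h.
  rewrite /= map_mxB map_mx1 map_mxD !map_mxM mulmxBr mulmx1 mulmxDr.
  rewrite !mulmxA -/D Z0 mul0mx add0r => /eqP; rewrite subr_eq => /eqP e.
  have -> : kermx D = kermx D *m map_mx phi g' *m map_mx phi f'
            - kermx D *m map_mx phi s' *m D'.
    by rewrite e addrC addKr.
  by rewrite addmx_sub ?eqmx_opp // mulmx_sub ?addsmxSl ?addsmxSr // ?eqmx_opp mulmx_sub ?addsmxSr.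
have := leq_trans (mxrankS Zsub) (mxrank_adds_leqif _ _).
have := rank_leq_row (map_mx phi f'); have := rank_leq_col D.
have := rank_leq_row D.
by rewrite rk -/D; lia.
Qed.

End Comparison.

(** * Contraction of a simplex to a vertex *)

Section Cone.
Variables (R : comNzRingType) (m : nat).
Implicit Types A B C : {set 'I_m}.
Local Notation bdR := (@bd R m).

Lemma face_sign_sq A i : face_sign R A i * face_sign R A i = 1.
Proof. by rewrite /face_sign -exprD addnn -mul2n exprM sqrrN expr1n expr1n. Qed.

Lemma bd_map (R' : nzRingType) (phi : {rmorphism R -> R'}) A B : phi (bdR A B) = bd R' A B.
Proof.
by rewrite /bd rmorph_sum; apply: eq_bigr => i _; rewrite rmorphXn rmorphN1.
Qed.

(** The matrix form of [d h + h d = 1], where [h] adjoins the vertex [j] with its sign. *)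
Lemma cone_identity (j : 'I_m) A' A :
  (j \notin A')%:R * bdR (j |: A') A' * bdR (j |: A') A
    + (j \in A)%:R * bdR A' (A :\ j) * bdR A (A :\ j) = (A' == A)%:R.
Proof.
have sg B : j \in B -> bdR B (B :\ j) * bdR B (B :\ j) = 1.
  by move=> jB; rewrite bd_face // face_sign_sq.
have bdU : j \notin A' -> bdR (j |: A') A' * bdR (j |: A') A' = 1.
  by move=> jA'; rewrite -{2 4}(setU1K jA') sg ?setU11.
have [jA'|jA'] := boolP (j \in A'); have [jA|jA] := boolP (j \in A).
- rewrite !mul0r add0r mul1r; have [->|neA] := eqVneq A' A; first exact: sg.
  rewrite bd_eq0 ?mul0r // => l lA'; apply: contraNneq neA => e.
  have [elj|nlj] := eqVneq l j.
    by rewrite -(setD1K jA) e elj setD1K.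
  by have := setD11 j A; rewrite e !inE eq_sym nlj jA'.
- by rewrite !mul0r addr0 (_ : (A' == A) = false) //; apply: contraNF jA => /eqP <-.
- rewrite !mul1r (_ : (A' == A) = false); last by apply: contraNF jA' => /eqP ->.
  (* Only two faces lie between [j |: A'] and [A :\ j] with nonzero coefficients, namely [A'] and
     [A], so [d d = 0] relates exactly the two terms in question. *)
  have := bd_bd R (j |: A') (A :\ j).
  rewrite (bigD1 A') //= (bigD1 A) /=; last by apply: contraNneq jA' => <-.
  rewrite big1 ?addr0 => [e|B /andP[BA' BA]]; last first.
    apply/eqP; apply: contraNT BA => /eqP nz; apply/eqP.
    have [l lj eB] : exists2 l, l \in j |: A' & B = (j |: A') :\ l.
      by apply: (bd_nz (R := R)); apply/eqP => z; apply: nz; rewrite z mul0r.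
    have [l' l'B eA] : exists2 l', l' \in B & A :\ j = B :\ l'.
      by apply: (bd_nz (R := R)); apply/eqP => z; apply: nz; rewrite z mulr0.
    have jB : j \in B.
      rewrite eB !inE eqxx andbT; apply: contraNneq BA' => ejl.
      by rewrite eB -ejl setU1K.
    have ejl' : l' = j.
      apply/eqP; apply: contraT => nl; have := setD11 j A.
      by rewrite eA !inE eq_sym nl jB.
    by rewrite -(setD1K jB) -(setD1K jA) eA ejl'.
  set x := bdR (j |: A') A' in e *; set y := bdR A (A :\ j) in e *.
  set u := bdR (j |: A') A in e *; set w := bdR A' (A :\ j) in e *.
  have x2 : x * x = 1 by apply: bdU.
  have y2 : y * y = 1 by apply: sg.
  transitivity (x * y * (x * w + u * y)); last by rewrite e mulr0.
  transitivity ((y * y) * x * u + (x * x) * w * y); last by ring.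
  by rewrite x2 y2; ring.
rewrite !mul0r addr0 mul1r; have [<-|neA] := eqVneq A' A; first exact: bdU.
rewrite [X in _ * X]bd_eq0 ?mulr0 // => l lA'; apply: contraNneq neA => e.
have [elj|nlj] := eqVneq l j; first by rewrite e elj setU1K.
by case/negP: jA; rewrite e !inE eq_sym nlj eqxx.
Qed.

End Cone.

(** * The Taylor resolution *)

Section Taylor.
Variables (k : fieldType) (n : nat) (G : seq 'X_{1..n}).
Local Notation S := {mpoly k[n]}.
Local Notation m := (size G).
Local Notation bdS := (@bd S m).
Local Notation bdk := (@bd k m).
Implicit Types (A B C : {set 'I_m}) (b d : 'X_{1..n}).

Definition gen (j : 'I_m) : 'X_{1..n} := nth 0%MM G j.

Definition set_lcm A : 'X_{1..n} := [multinom (\max_(j in A) gen j i)%N | i < n].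

Lemma set_lcmE A i : set_lcm A i = (\max_(j in A) gen j i)%N.
Proof. by rewrite mnmE. Qed.

Lemma set_lcmP A b : reflect (forall j, j \in A -> (gen j <= b)%MM) (set_lcm A <= b)%MM.
Proof.
apply: (iffP mnm_lepP) => [le j jA|le i].
  apply/mnm_lepP => i; apply: leq_trans (le i); rewrite set_lcmE.
  exact: (leq_bigmax_cond (F := fun j => gen j i)).
by rewrite set_lcmE; apply/bigmax_leqP => j /le/mnm_lepP.
Qed.

Lemma set_lcmS A B : B \subset A -> (set_lcm B <= set_lcm A)%MM.
Proof. by move/subsetP => sBA; apply/set_lcmP => j /sBA; apply/set_lcmP; apply: lepm_refl. Qed.

Lemma bd_sub (R : comNzRingType) A B : bd R A B != 0 -> B \subset A.
Proof. by case/bd_nz => i _ ->; apply: subsetDl. Qed.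

Lemma mcoeffMX_if (p : S) (c d : 'X_{1..n}) :
  (p * 'X_[c])@_d = if (c <= d)%MM then p@_(d - c) else 0.
Proof.
case: ifP => [le|nle]; first by rewrite -{1}(submK le) addmC mcoeffMX.
rewrite {1}(mpolyE p) mulr_suml raddf_sum big1 // => e _.
rewrite /= -scalerAl -mpolyXD mcoeffZ mcoeffX.
suff /negPf -> : (e + c)%MM != d by rewrite mulr0.
by apply: contraFneq nle => <-; apply: lem_addl.
Qed.

Definition card_sets i := [set A : {set 'I_m} | #|A| == i].

Definition taylor_rank i := #|card_sets i|.

Definition taylor i : 'M[S]_(taylor_rank i.+1, taylor_rank i) :=
  \matrix_(a, b) (bdS (enum_val a) (enum_val b)
                  * 'X_[(set_lcm (enum_val a) - set_lcm (enum_val b))%MM]).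

Definition spread i (v : 'rV[S]_(taylor_rank i)) A : S := \sum_(a | enum_val a == A) v 0 a.

Lemma card_enum_val i (a : 'I_(taylor_rank i)) : #|enum_val a| = i.
Proof. by have := enum_valP a; rewrite inE => /eqP. Qed.

Lemma spreadE i (v : 'rV[S]_(taylor_rank i)) a : spread v (enum_val a) = v 0 a.
Proof. by rewrite /spread (big_pred1 a) // => b; rewrite (inj_eq enum_val_inj). Qed.

Lemma spread_out i (v : 'rV[S]_(taylor_rank i)) A : #|A| != i -> spread v A = 0.
Proof.
move=> cA; rewrite /spread big_pred0 // => a; apply: contraNF cA => /eqP <-.
by rewrite card_enum_val.
Qed.

Lemma spread_sum i (v : 'rV[S]_(taylor_rank i)) (F : {set 'I_m} -> S) :
  \sum_a v 0 a * F (enum_val a) = \sum_A spread v A * F A.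
Proof.
rewrite (partition_big (fun a => enum_val a) predT) //=; apply: eq_bigr => A _.
by rewrite /spread mulr_suml; apply: eq_bigr => a /eqP ->.
Qed.

Lemma taylor_mulE i (v : 'rV[S]_(taylor_rank i.+1)) c :
  (v *m taylor i) 0 c = \sum_A spread v A
    * (bdS A (enum_val c) * 'X_[(set_lcm A - set_lcm (enum_val c))%MM]).
Proof.
rewrite -(spread_sum v (fun A => bdS A (enum_val c) * 'X_[(set_lcm A - set_lcm (enum_val c))%MM])).
by rewrite mxE; apply: eq_bigr => a _; rewrite mxE.
Qed.

Lemma bdS_const A B : bdS A B = (bdk A B)%:MP.
Proof. by rewrite -(bd_map (@mpolyC n k)). Qed.

Lemma taylor_complex i : taylor i.+1 *m taylor i = 0.
Proof.
apply/row_matrixP => c; rewrite row_mul row0; apply/rowP => b; rewrite taylor_mulE mxE.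
set C := enum_val c; set B := enum_val b.
rewrite (eq_bigr (fun A => 'X_[(set_lcm C - set_lcm B)%MM] * (bdS C A * bdS A B))); last first.
  move=> A _; have [cA|ncA] := eqVneq #|A| i.+1; last first.
    rewrite spread_out // mul0r bd_eq0 ?mul0r ?mulr0 // => l lC; apply: contraNneq ncA => ->.
    by have := cardsD1 l C; rewrite lC card_enum_val => -[->].
  have [a ea] : exists a : 'I_(taylor_rank i.+1), enum_val a = A.
    have hA : A \in card_sets i.+1 by rewrite inE cA.
    by exists (enum_rank_in hA A); rewrite enum_rankK_in.
  rewrite -ea spreadE !mxE ea -/C.
  have [->|nz1] := eqVneq (bdS C A) 0; first by rewrite !mul0r mulr0.
  have [->|nz2] := eqVneq (bdS A B) 0; first by rewrite !(mul0r, mulr0).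
  have /mnm_lepP le1 := set_lcmS (bd_sub nz1); have /mnm_lepP le2 := set_lcmS (bd_sub nz2).
  have -> : (set_lcm C - set_lcm B = (set_lcm C - set_lcm A) + (set_lcm A - set_lcm B))%MM.
    by apply/mnmP => j; rewrite mnmDE !mnmBE; have := le1 j; have := le2 j; lia.
  by rewrite mpolyXD; ring.
by rewrite -mulr_sumr bd_bd mulr0.
Qed.

(** The part of [v] of multidegree [b] at the basis element [A], which itself has degree
    [set_lcm A]. *)
Definition hcoef i (v : 'rV[S]_(taylor_rank i)) A b : k :=
  if (set_lcm A <= b)%MM then (spread v A)@_(b - set_lcm A) else 0.

(** In a fixed multidegree the Taylor differential is the simplicial boundary over [k]. *)
Lemma taylor_coef i (v : 'rV[S]_(taylor_rank i.+1)) c b : (set_lcm (enum_val c) <= b)%MM ->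
  ((v *m taylor i) 0 c)@_(b - set_lcm (enum_val c))
    = \sum_A bdk A (enum_val c) * hcoef v A b.
Proof.
move=> leb; rewrite taylor_mulE raddf_sum; apply: eq_bigr => A _ /=; set B := enum_val c.
rewrite bdS_const mulrCA mcoeffCM mcoeffMX_if.
have [->|nz] := eqVneq (bdk A B) 0; first by rewrite !mul0r.
have /mnm_lepP le1 := set_lcmS (bd_sub nz); have /mnm_lepP le2 := leb.
congr (_ * _); rewrite /hcoef.
have -> : (set_lcm A - set_lcm B <= b - set_lcm B)%MM = (set_lcm A <= b)%MM.
  apply/mnm_lepP/mnm_lepP => le i'; have := le i'; have := le1 i'; have := le2 i';
  by rewrite !mnmBE -/B; lia.
case: ifP => // /mnm_lepP le3; congr (_@_ _); apply/mnmP => i'; rewrite !mnmBE.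
by have := le1 i'; have := le2 i'; have := le3 i'; rewrite -/B; lia.
Qed.

Definition mk_poly (W : nat) (F : 'X_{1..n} -> k) : S :=
  \sum_(d : 'X_{1..n < W}) F d *: 'X_[d].

Lemma mcoeff_mk_poly W (F : 'X_{1..n} -> k) : (forall d, F d != 0 -> (mdeg d < W)%N) ->
  forall d, (mk_poly W F)@_d = F d.
Proof.
move=> bnd d; have [lt|ge] := ltnP (mdeg d) W; first exact: mcoeff_mpoly.
have -> : F d = 0 by apply/eqP; apply: contraTT ge => /bnd; rewrite -ltnNge.
rewrite /mk_poly raddf_sum big1 // => e _; rewrite /= mcoeffZ mcoeffX.
suff /negPf -> : bmnm e != d by rewrite mulr0.
by apply: contraTneq ge => <-; rewrite -ltnNge; apply: bmdeg.
Qed.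

(** The faces with lcm dividing [b] form the full simplex on the generators dividing [b]; this
    vertex serves to contract it. *)
Definition cone_pt b := [pick j | (gen j <= b)%MM].

(** Each multidegree is the complex of a full simplex, contracted by adjoining [cone_pt b]. The
    scalars [eta] are the coefficients of the resulting chain, and the degree bound [W] assembles
    them into polynomials. *)
Lemma taylor_exact i (v : 'rV[S]_(taylor_rank i.+1)) : v *m taylor i = 0 ->
  exists u, v = u *m taylor i.+1.
Proof.
move=> v0; pose W := (\sum_A msize (spread v A))%N.
pose eta C b : k := if cone_pt b is Some j
  then (j \in C)%:R * bdk C (C :\ j) * hcoef v (C :\ j) b else 0.
have eta_le C b : eta C b != 0 -> (set_lcm C <= b)%MM.
  rewrite /eta /cone_pt; case: pickP => [j jb|_]; last by rewrite eqxx.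
  rewrite /hcoef; case: ifP => [le _|_]; last by rewrite mulr0 eqxx.
  apply/set_lcmP => l lC; have [->//|nlj] := eqVneq l j.
  by move/set_lcmP: le; apply; rewrite !inE nlj.
have eta_deg C d : eta C (d + set_lcm C)%MM != 0 -> (mdeg d < W)%N.
  rewrite /eta /cone_pt; case: pickP => [j jb|_]; last by rewrite eqxx.
  rewrite /hcoef; case: ifP => [le|_]; last by rewrite mulr0 eqxx.
  set e := (_ - _)%MM; have [->|nz _] := eqVneq (spread v (C :\ j))@_e 0.
    by rewrite mulr0 eqxx.
  have es : e \in msupp (spread v (C :\ j)) by rewrite mcoeff_msupp.
  apply: (@leq_ltn_trans (mdeg e)).
    rewrite !mdegE; apply: leq_sum => l _; rewrite /e mnmBE mnmDE.
    have /mnm_lepP/(_ l) : (set_lcm (C :\ j) <= set_lcm C)%MM by apply/set_lcmS/subsetDl.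
    by lia.
  apply: leq_trans (msize_mdeg_lt es) _; rewrite /W (bigD1 (C :\ j)) //=.
  exact: leq_addr.
pose u : 'rV[S]_(taylor_rank i.+2) :=
  \row_c mk_poly W (fun d => eta (enum_val c) (d + set_lcm (enum_val c))%MM).
have ucoef C b : #|C| = i.+2 -> hcoef u C b = eta C b.
  move=> cC; rewrite /hcoef; case: ifP => [le|nle]; last first.
    by apply/esym/eqP; apply: contraFT nle; apply: eta_le.
  have [c ec] : exists c : 'I_(taylor_rank i.+2), enum_val c = C.
    have hC : C \in card_sets i.+2 by rewrite inE cC.
    by exists (enum_rank_in hC C); rewrite enum_rankK_in.
  rewrite -ec spreadE mxE mcoeff_mk_poly; first by rewrite ec submK.
  by move=> d; apply: eta_deg.
exists u; apply/rowP => a; apply/mpolyP => d; set A := enum_val a.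
pose b := (d + set_lcm A)%MM.
have leb : (set_lcm A <= b)%MM by apply: lem_addl.
have -> : d = (b - set_lcm A)%MM by rewrite addmK.
rewrite taylor_coef // -/A -(spreadE v) -/A.
have -> : (spread v A)@_(b - set_lcm A) = hcoef v A b by rewrite /hcoef leb.
(* In positive degree [A] is nonempty, so some generator divides [b] and a cone point exists. *)
have /card_gt0P[l lA] : (0 < #|A|)%N by rewrite card_enum_val.
have [j ej] : exists j, cone_pt b = Some j.
  rewrite /cone_pt; case: pickP => [j _|/(_ l)]; first by exists j.
  by move/set_lcmP: leb => /(_ l lA) ->.
rewrite (eq_bigr (fun C => bdk C A * eta C b)); last first.
  move=> C _; have [cC|ncC] := eqVneq #|C| i.+2; first by rewrite ucoef.
  rewrite bd_eq0 ?mul0r // => h hC; apply: contraNneq ncC => eA.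
  by have := cardsD1 h C; rewrite hC -eA card_enum_val => ->.
rewrite (bigID (fun C => j \in C)) /= [X in _ = _ + X]big1 ?addr0; last first.
  by move=> C jC; rewrite /eta ej (negPf jC) !mul0r mulr0.
rewrite (reindex_onto (fun C => j |: C) (fun C => C :\ j)) /=; last first.
  by move=> C jC; rewrite setD1K.
rewrite (eq_bigl (fun C => j \notin C)); last first.
  move=> C; rewrite setU11 /=; apply/eqP/idP => [<-|jC]; last by rewrite setU1K.
  by rewrite !inE eqxx.
transitivity (\sum_C hcoef v C b * ((C == A)%:R
   - (j \in A)%:R * bdk C (A :\ j) * bdk A (A :\ j))); last first.
  rewrite [RHS]big_mkcond; apply: eq_bigr => C _.
  rewrite -(cone_identity k j C A) addrK.
  case: ifP => jC; last by rewrite !mul0r mulr0.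
  by rewrite /eta ej setU11 setU1K // !mul1r; ring.
under eq_bigr => C _ do rewrite mulrBr.
rewrite big_split /= sumrN (bigD1 A) //= eqxx mulr1 [X in _ = _ + X - _]big1 ?addr0; last first.
  by move=> C /negPf ->; rewrite mulr0.
have [jA|jA] := boolP (j \in A); last first.
  by rewrite big1 ?subr0 // => C _; rewrite !mul0r mulr0.
have cB : #|A :\ j| = i by have := cardsD1 j A; rewrite jA card_enum_val => -[].
have [c ec] : exists c : 'I_(taylor_rank i), enum_val c = A :\ j.
  have hB : A :\ j \in card_sets i by rewrite inE cB.
  by exists (enum_rank_in hB (A :\ j)); rewrite enum_rankK_in.
have leB : (set_lcm (enum_val c) <= b)%MM.
  by rewrite ec; apply: lepm_trans leb; apply/set_lcmS/subsetDl.
have := taylor_coef v leB; rewrite v0 mxE mcoeff0 ec => e0.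
rewrite (eq_bigr (fun C => bdk A (A :\ j) * (bdk C (A :\ j) * hcoef v C b))).
  by rewrite -mulr_sumr -e0 mulr0 subr0.
by move=> C _; rewrite mul1r; ring.
Qed.

End Taylor.

(** * Polarization *)

Section Polarization.
Variables (n : nat) (G : seq 'X_{1..n}).
Local Notation m := (size G).
Implicit Types (A B : {set 'I_m}).

Definition exp_bound := (\max_(j < m) mdeg (gen j)).+1.

(* The monomial [x_1^a_1 ... x_n^a_n] becomes the squarefree monomial with the
   [a_i] variables [(i, 0), ..., (i, a_i - 1)] for every [i]. *)
Definition polar (j : 'I_m) : {set 'I_n * 'I_exp_bound} :=
  [set p : 'I_n * 'I_exp_bound | (p.2 < gen j p.1)%N].

Lemma exp_lt_bound (j : 'I_m) i : (gen j i < exp_bound)%N.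
Proof.
rewrite ltnS; apply: leq_trans (leq_bigmax j); rewrite mdegE.
by rewrite (bigD1 i) //= leq_addr.
Qed.

Lemma mem_cover_polar A p : (p \in cover_of polar A) = (p.2 < set_lcm A p.1)%N.
Proof.
rewrite set_lcmE; apply/cover_ofP/idP => [[j jA]|].
  by rewrite inE => lt; apply: leq_trans lt (leq_bigmax_cond _ jA).
move=> lt; have [j0 j0A|A0] := pickP (mem A); last by rewrite big_pred0 in lt.
have cA : (0 < #|A|)%N by apply/card_gt0P; exists j0.
have [j jA e] := eq_bigmax_cond (fun j : 'I_m => gen j p.1) cA.
by exists j; rewrite // inE -e.
Qed.

Lemma cover_polar_sub A B :
  (cover_of polar A \subset cover_of polar B) = (set_lcm A <= set_lcm B)%MM.
Proof.
apply/subsetP/mnm_lepP => [sAB i|le p]; last first.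
  by rewrite !mem_cover_polar => lt; apply: leq_trans lt (le _).
rewrite leqNgt; apply/negP => lt.
have ltW : (set_lcm B i < exp_bound)%N.
  apply: leq_trans lt _; rewrite set_lcmE; apply/bigmax_leqP => j _.
  by rewrite ltnW // exp_lt_bound.
have := sAB (i, Ordinal ltW); rewrite !mem_cover_polar /= lt => /(_ isT).
by rewrite ltnn.
Qed.

Lemma polar_sub (i j : 'I_m) : (polar i \subset polar j) = (gen i <= gen j)%MM.
Proof.
have one l : cover_of polar [set l] = polar l by apply: big_set1.
rewrite -!one cover_polar_sub; congr (_ <= _)%MM; apply/mnmP => x.
  by rewrite set_lcmE big_set1.
by rewrite set_lcmE big_set1.
Qed.

Lemma polar_disjoint (i j : 'I_m) :
  [disjoint polar i & polar j] = [forall x, (gen i x == 0%N) || (gen j x == 0%N)].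
Proof.
apply/idP/forallP => [d x|h].
  apply/norP => -[]; rewrite -!lt0n => lt1 lt2.
  have lt0 : (0 < exp_bound)%N by [].
  have := disjointFr d (x := (x, Ordinal lt0)); rewrite !inE /= lt1 lt2 => h.
  by have := h isT.
rewrite disjoints_subset; apply/subsetP => p; rewrite !inE -leqNgt.
by case/orP: (h p.1) => /eqP ->.
Qed.

End Polarization.

(** * Betti numbers and the reduced Taylor complex *)

Section BettiLowerBound.
Variables (k : fieldType) (n : nat) (G : seq 'X_{1..n}).
Local Notation S := {mpoly k[n]}.
Local Notation m := (size G).
Local Notation bdk := (@bd k m).
Local Notation phi := (mcoeff 0%MM : {rmorphism S -> k}).
Local Notation wf := (weight_fam (@polar n G) setT).

Lemma taylor_mod_max i a c : (map_mx phi (taylor k G i)) a c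
  = (cover_of (@polar n G) (enum_val a) == cover_of (@polar n G) (enum_val c))%:R
    * bdk (enum_val a) (enum_val c).
Proof.
rewrite !mxE /= bdS_const mcoeffCM mcoeffX mulrC.
have [->|nz] := eqVneq (bdk (enum_val a) (enum_val c)) 0; first by rewrite !mulr0.
have sub := bd_sub nz; congr (_%:R * _).
rewrite eqEsubset !cover_polar_sub (set_lcmS sub) andbT; congr nat_of_bool.
apply/eqP/mnm_lepP => [e i'|le].
  by move/mnmP/(_ i'): e; rewrite mnmBE mnm0E => /eqP; rewrite subn_eq0.
by apply/mnmP => i'; rewrite mnmBE mnm0E; apply/eqP; rewrite subn_eq0.
Qed.

(** The reduced matrix is a sum of blocks indexed by the lcm's; the selection matrices [sel] pass
    between all faces and those of one cardinality. *)
Lemma rank_taylor_mod i : (\rank (map_mx phi (taylor k G i))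
  <= \sum_(b : {set 'I_n * 'I_(exp_bound G)}) level_rank k (wf b) i.+1)%N.
Proof.
pose sel j : 'M[k]_(taylor_rank G j, #|{set 'I_m}|) :=
  \matrix_(a, e) (e == enum_rank (enum_val a))%:R.
have selE j j' (M : 'M[k]_#|{set 'I_m}|) a c :
    (sel j *m M *m (sel j')^T) a c = M (enum_rank (enum_val a)) (enum_rank (enum_val c)).
  rewrite mxE (bigD1 (enum_rank (enum_val c))) //= !mxE eqxx mulr1.
  rewrite [X in _ + X]big1 ?addr0 => [|e /negPf ne]; last by rewrite !mxE ne mulr0.
  rewrite (bigD1 (enum_rank (enum_val a))) //= !mxE eqxx mul1r.
  by rewrite big1 ?addr0 // => e /negPf ne; rewrite !mxE ne mul0r.
have -> : map_mx phi (taylor k G i) = \sum_(b : {set 'I_n * 'I_(exp_bound G)})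
    sel i.+1 *m restr_mx bdk (level (wf b) i.+2) (level (wf b) i.+1) *m (sel i)^T.
  apply/matrixP => a c; rewrite taylor_mod_max summxE.
  under eq_bigr => b _ do rewrite selE /restr_mx /coord_proj mul_mx_diag mul_diag_mx !mxE !enum_rankK.
  set A := enum_val a; set C := enum_val c.
  rewrite (bigD1 (cover_of (@polar n G) A)) //= big1 ?addr0.
    by rewrite !inE !subsetT !card_enum_val !eqxx /= mul1r mulrC andbT eq_sym.
  move=> b nb; rewrite [A \in _]inE [A \in _]inE subsetT (eq_sym _ b) (negPf nb).
  by rewrite !mul0r.
apply: (big_ind2 (fun (M : 'M[k]_(taylor_rank G i.+1, taylor_rank G i)) r => (\rank M <= r)%N)).
- by rewrite mxrank0.
- move=> M r M' r' le le'; exact: leq_trans (mxrank_add _ _) (leq_add le le').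
move=> b _; apply: leq_trans (mxrankM_maxl _ _) _; exact: mxrankM_maxr.
Qed.

Lemma monomial_ideal_gen (r : S) (j : 'I_m) : monomial_ideal G (r * 'X_[gen j]).
Proof.
have lt : (j < size [seq 'X_[e] : S | e <- G])%N by rewrite size_map.
exists (fun i => if i == Ordinal lt then r else 0).
rewrite (bigD1 (Ordinal lt)) //= eqxx big1 ?addr0.
  by rewrite (nth_map 0%MM).
by move=> i /negPf ->; rewrite mul0r.
Qed.

Lemma taylor_rank0 : taylor_rank G 0 = 1%N.
Proof.
rewrite /taylor_rank -(cards1 (@set0 'I_m)); apply: eq_card => A.
by rewrite !inE cards_eq0.
Qed.

Section Resolution.
Variable F : min_free_resolution (@monomial_ideal k n G).
Local Notation r := (res_rank F).
Local Notation dF := (res_map F).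

Lemma res_complex i : dF i.+1 *m dF i = 0.
Proof.
apply/row_matrixP => a; rewrite row_mul row0; apply: (proj2 (res_exact _)).
by exists (delta_mx 0 a); rewrite -rowE.
Qed.

(** In degree 0 both modules are [S] and the maps are the identity; the content is that the two
    first differentials have the same image, the ideal. *)
Lemma comparison_base :
  exists g f s, @comparable_at S (taylor_rank G) r (taylor k G) dF 0 g f s.
Proof.
have r0 := res_rank0 F.
pose g : 'M[S]_(taylor_rank G 0, r 0) := const_mx 1.
pose f : 'M[S]_(r 0, taylor_rank G 0) := const_mx 1.
have t1 (a b : 'I_(taylor_rank G 0)) : a = b.
  by apply: val_inj; case: a b => [[|a] ha] [[|b] hb] //; exfalso; move: ha hb; rewrite taylor_rank0.
have r1 (a b : 'I_(r 0)) : a = b.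
  by apply: val_inj; case: a b => [[|a] ha] [[|b] hb] //; exfalso; move: ha hb; rewrite r0.
have ev0 (c : 'I_(taylor_rank G 0)) : enum_val c = set0.
  by apply/eqP; rewrite -cards_eq0 card_enum_val.
exists g, f, 0; split.
- apply: lift_rows => a; set A := enum_val a.
  have /eqP/cards1P[j eA] : #|A| = 1%N by rewrite card_enum_val.
  have [u hu] : exists u : 'rV_(r 1), forall c, (u *m dF 0) 0 c = 'X_[gen j].
    by apply/(res_image F); rewrite -[X in monomial_ideal _ X]mul1r; apply: monomial_ideal_gen.
  exists u; apply/rowP => c; rewrite hu !mxE.
  have c0 : 'I_(taylor_rank G 0) by rewrite taylor_rank0; exact: ord0.
  rewrite (bigD1 c0) //= big1 ?addr0 => [|b]; last by rewrite (t1 b c0) eqxx.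
  rewrite !mxE mulr1 -/A eA ev0.
  have -> : set0 = [set j] :\ j by rewrite setDv.
  rewrite bd_face ?set11 // /face_sign.
  have -> : [set l in [set j] | (l < j)%N] = set0.
    by apply/setP => l; rewrite !inE; case: eqP => [->|] //=; rewrite ltnn.
  rewrite cards0 expr0 mul1r; congr 'X_[_]; apply/mnmP => i.
  by rewrite mnmBE setDv !set_lcmE big_set1 big_set0 subn0.
- apply: lift_rows => a.
  have c0 : 'I_(r 0) by rewrite r0; exact: ord0.
  have /(res_image F)[/= coef hcoef] : exists u : 'rV_(r 1), forall c, (u *m dF 0) 0 c = dF 0 a c0.
    by exists (delta_mx 0 a) => c; rewrite -rowE mxE (r1 c c0).
  have sz : size [seq 'X_[e] : S | e <- G] = m by rewrite size_map.
  pose u : 'rV[S]_(taylor_rank G 1) :=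
    \row_b \sum_(j < m | [set j] == enum_val b) coef (cast_ord (esym sz) j).
  exists u; apply/rowP => c; rewrite taylor_mulE ev0 [LHS]mxE mxE.
  rewrite (bigD1 c0) //= big1 ?addr0 => [|b]; last by rewrite (r1 b c0) eqxx.
  rewrite [const_mx 1 _ _]mxE mulr1 hcoef.
  transitivity (\sum_(j < m) coef (cast_ord (esym sz) j) * 'X_[gen j]).
    rewrite (reindex (cast_ord (esym sz))) /=; last first.
      by exists (cast_ord sz) => j _; rewrite ?cast_ordK ?cast_ordKV.
    by apply: eq_bigr => j _; rewrite (nth_map 0%MM).
  rewrite (partition_big (fun j : 'I_m => [set j]) predT) //=; apply: eq_bigr => A _.
  have [/eqP/cards1P[j0 eA]|ncA] := eqVneq #|A| 1%N; last first.
    rewrite spread_out // mul0r big_pred0 // => j; apply: contraNF ncA => /eqP <-.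
    by rewrite cards1.
  have [b eb] : exists b : 'I_(taylor_rank G 1), enum_val b = A.
    have hA : A \in card_sets G 1 by rewrite inE eA cards1.
    by exists (enum_rank_in hA A); rewrite enum_rankK_in.
  rewrite -eb spreadE mxE eb mulr_suml; apply: eq_bigr => j /eqP <-.
  congr (_ * _).
  have -> : set0 = [set j] :\ j by rewrite setDv.
  rewrite bd_face ?set11 // /face_sign.
  have -> : [set l in [set j] | (l < j)%N] = set0.
    by apply/setP => l; rewrite !inE; case: eqP => [->|] //=; rewrite ltnn.
  rewrite cards0 expr0 mul1r; congr 'X_[_]; apply/mnmP => i.
  by rewrite mnmBE setDv !set_lcmE big_set1 big_set0 subn0.
rewrite mul0mx subr0 [X in _ *m X](_ : _ = 0) ?mulmx0 //; apply/matrixP => a b.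
rewrite !mxE (t1 a b) eqxx (eq_bigr (fun _ => 1)) => [|c _]; last by rewrite !mxE mulr1.
by rewrite sumr_const card_ord r0 subrr.
Qed.

Lemma fbetti_le_res_rank i : (fbetti k (@polar n G) setT i <= r i)%N.
Proof.
have conv b : convex (wf b) by apply: weight_fam_convex.
case: i => [|i].
  rewrite res_rank0 -(bin0 #|[set: 'I_m]|) -(sum_card_level (@polar n G)).
  by apply: leq_sum => b _; rewrite -(hdimE k 0 (conv b)) -addnA leq_addr.
have := comparison_rank_le (@taylor_complex k n G) res_complex (@taylor_exact k n G)
  (fun i v => proj1 (res_exact v)) comparison_base phi i.
have := rank_taylor_mod i; have := rank_taylor_mod i.+1.
have : (\sum_(b : {set 'I_n * 'I_(exp_bound G)}) #|level (wf b) i.+2| = taylor_rank G i.+1)%N.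
  rewrite sum_card_level /taylor_rank -cards_draws; apply: eq_card => A.
  by rewrite !inE subsetT.
rewrite -(eq_bigr _ (fun b _ => hdimE k i.+1 (conv b))) !big_split /=.
rewrite /fbetti /whdim.
set x := (\sum_b _)%N; set y := (\sum_b _)%N; set z := (\sum_b _)%N => e.
move=> h1 h2 h3; have := leq_trans h3 (leq_add (leq_add (leqnn _) h2) h1).
by rewrite -e -!addnA (addnC z) !addnA !leq_add2r.
Qed.

End Resolution.
End BettiLowerBound.

(** * Heights of monomial ideals *)

Section KrullDimension.
Variables (k : fieldType) (n : nat).
Local Notation S := {mpoly k[n]}.
Implicit Types (p q : S) (P : pset k n) (T : {set 'I_n}).

Lemma deg_prod (I : finType) (y : I -> S) (e : I -> nat) d D :
  (forall i, (msize (y i) <= d.+1)%N) -> (forall i, (e i <= D)%N) ->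
  (msize (\prod_i y i ^+ e i) <= (#|I| * (D * d)).+1)%N.
Proof.
move=> yd eD.
have mulb p q a b : (msize p <= a.+1 -> msize q <= b.+1 -> msize (p * q) <= (a + b).+1)%N.
  have [->|nzp] := eqVneq p 0; first by rewrite mul0r msize0.
  have [->|nzq] := eqVneq q 0; first by rewrite mulr0 msize0.
  rewrite msizeM // => lp lq; have := leq_add lp lq; rewrite addSn addnS.
  by case: (_ + _)%N.
have expb p a l : (msize p <= a.+1 -> msize (p ^+ l) <= (l * a).+1)%N.
  move=> pa; elim: l => [|l IHl]; first by rewrite expr0 msize1.
  by rewrite exprS mulSn; apply: mulb.
have -> : (#|I| * (D * d) = \sum_(i : I) D * d)%N by rewrite sum_nat_const.
apply: (big_ind2 (fun p a => (msize p <= a.+1)%N)).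
- by rewrite msize1.
- by move=> p a q b; apply: mulb.
move=> i _; apply: leq_trans (expb _ _ (e i) (yd i)) _.
by rewrite ltnS leq_mul2r eD orbT.
Qed.

Lemma card_bmultinom W : (#|{: 'X_{1..n < W}}| <= W ^ n)%N.
Proof.
have bnd (m : 'X_{1..n < W}) (i : 'I_n) : (m i < W)%N.
  by apply: leq_ltn_trans (bmdeg m); rewrite mdegE (bigD1 i) //= leq_addr.
pose F (m : 'X_{1..n < W}) : {ffun 'I_n -> 'I_W} := [ffun i => Ordinal (bnd m i)].
have Finj : injective F.
  move=> m1 m2 /ffunP e; apply/val_inj/mnmP => i.
  by have := e i; rewrite !ffunE => /(congr1 val).
by have := leq_card F Finj; rewrite card_ffun !card_ord.
Qed.

(** The [D^(n+1)] products with exponents below [D] have degree less than [W], hence lie in a space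
    of dimension at most [W^n]. As [W <= D * C] with [C] independent of [D], taking [D > C^n] makes
    the products too numerous to be independent. *)
Lemma algebraic_dependence (y : 'I_n.+1 -> S) :
  exists (D : nat) (c : {ffun 'I_n.+1 -> 'I_D} -> k),
    (exists e, c e != 0) /\ \sum_e c e *: \prod_i y i ^+ e i = 0.
Proof.
pose d := (\max_i msize (y i))%N.
have yd i : (msize (y i) <= d.+1)%N by apply/leqW/(leq_bigmax i).
pose C := (n.+1 * d).+2; pose D := (C ^ n).+1; pose W := (n.+1 * (D * d)).+2.
pose X := {ffun 'I_n.+1 -> 'I_D}.
pose mon (e : X) : S := \prod_i y i ^+ e i.
have mon_deg e : (msize (mon e) <= W)%N.
  apply: leqW; rewrite -[n.+1]card_ord; apply: deg_prod => // i.
  exact: ltnW (ltn_ord _).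
pose M : 'M[k]_(#|{: X}|, #|{: 'X_{1..n < W}}|) :=
  \matrix_(a, b) (mon (enum_val a))@_(enum_val b : 'X_{1..n < W}).
have nfree : ~~ row_free M.
  apply/negP => /eqP rk; have := rank_leq_col M; rewrite rk leqNgt => /negP; apply.
  apply: leq_ltn_trans (card_bmultinom W) _.
  rewrite card_ffun !card_ord expnS.
  have aux a x z : (0 < x -> (a * (x * z)).+2 <= x * (a * z).+2)%N by nia.
  have WD : (W <= D * C)%N by apply: aux.
  have [n0|n0] := posnP n; first by rewrite n0 expn0 /D n0 expn0.
  apply: (@leq_ltn_trans ((D * C) ^ n)); first by rewrite leq_exp2r.
  by rewrite expnMn mulnC ltn_mul2r expn_gt0 /= ltnSn.
have /rowV0Pn[v vM v0] : kermx M != 0 by rewrite kermx_eq0.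
exists D, (fun e => v 0 (enum_rank e)); split.
  have /rV0Pn[a va] := v0; exists (enum_val a); by rewrite enum_valK.
apply/mpolyP => e; rewrite raddf_sum mcoeff0 /=.
have [lt|ge] := ltnP (mdeg e) W; last first.
  rewrite big1 // => x _; rewrite mcoeffZ; suff -> : (mon x)@_e = 0 by rewrite mulr0.
  apply/eqP; apply: contraTT ge; rewrite -mcoeff_msupp -ltnNge => es.
  exact: leq_trans (msize_mdeg_lt es) (mon_deg x).
have /sub_kermxP/rowP/(_ (enum_rank (BMultinom lt))) := vM.
rewrite !mxE (reindex (fun x : X => enum_rank x)) /=; last first.
  by exists enum_val => a _; rewrite ?enum_rankK ?enum_valK.
move=> e0; rewrite -[RHS]e0; apply: eq_bigr => x _.
by rewrite mcoeffZ mxE !enum_rankK.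
Qed.

Definition strict_chain (Q : nat -> pset k n) N :=
  (forall i, (i <= N)%N -> prime_ideal (Q i)) /\
  (forall i, (i < N)%N -> psubset (Q i) (Q i.+1) /\ exists x, Q i.+1 x /\ ~ Q i x).

Lemma ideal_opp P p : is_ideal P -> P p -> P (- p).
Proof. by case=> _ _ h /(h (-1)); rewrite mulN1r. Qed.

Lemma prime_exp P p l : prime_ideal P -> P (p ^+ l) -> P p.
Proof.
case=> _ n1 pr; elim: l => [|l IHl]; first by rewrite expr0.
by rewrite exprS => /pr[].
Qed.

(* Lexicographic descent through the dependence relation: in the [j]-th prime
   only the terms with minimal exponents of the first [j] elements matter. *)
Lemma strict_chain_le (Q : nat -> pset k n) N : strict_chain Q N -> (N <= n)%N.
Proof.
move=> [prQ incQ]; rewrite leqNgt; apply/negP => ltN.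
have [y hy] : exists y : 'I_n.+1 -> S, forall i : 'I_n.+1, Q i.+1 (y i) /\ ~ Q i (y i).
  apply: (fin_all_exists (P := fun (i : 'I_n.+1) x => Q i.+1 x /\ ~ Q i x)) => i.
  by have [_ [x hx]] := incQ i (leq_trans (ltn_ord i) ltN); exists x.
have [D [c [[e0 ce0] dep]]] := algebraic_dependence y.
pose X := {ffun 'I_n.+1 -> 'I_D}.
pose tail j (e : X) : S := \prod_(i < n.+1 | (j <= i)%N) y i ^+ e i.
have key j : (j <= n.+1)%N -> exists A : {set X},
    [/\ exists2 e, e \in A & c e != 0,
        forall e e' (i : 'I_n.+1), e \in A -> e' \in A -> (i < j)%N -> e i = e' i
      & Q j (\sum_(e in A) c e *: tail j e)].
  elim: j => [|j IHj] lej.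
    exists setT; split=> //; first by exists e0.
    have -> : \sum_(e in [set: X]) c e *: tail 0 e = 0.
      by rewrite -[RHS]dep; apply: eq_bigl => e; rewrite inE.
    by have [[]] := prQ 0%N isT.
  have [A [[e1 e1A ce1] agree QA]] := IHj (ltnW lej).
  have jN : (j < N)%N by apply: leq_trans lej _.
  have [iQ nQ pQ] := prQ j (ltnW jN); have [sQ _] := incQ j jN.
  have [iQ' _ _] := prQ j.+1 jN.
  pose jo := Ordinal lej; have [yj1 yj0] := hy jo.
  pose supp e := (e \in A) && (c e != 0).
  have e1P : supp e1 by rewrite /supp e1A.
  case: (arg_minnP (fun e : X => e jo : nat) e1P) => e2 /andP[e2A ce2] mine2.
  (* The least exponent [a] of [y jo] is factored out; its power can be cancelled because [y jo] is
     outside the prime [Q j]. The terms with larger exponent keep a factor [y jo], so they lie in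
     [Q j.+1] and can be discarded. *)
  pose a := e2 jo; pose B := [set e in A | (e jo == a) && (c e != 0)].
  exists B; split.
  - by exists e2; rewrite // !inE e2A eqxx.
  - move=> e e' i; rewrite !inE => /and3P[eA /eqP ea _] /and3P[e'A /eqP e'a _].
    rewrite ltnS leq_eqVlt => /orP[/eqP eij|]; last exact: agree.
    by have -> : i = jo by [apply: val_inj]; rewrite ea e'a.
  pose rest e := if e \in B then 0 else (c e *: tail j.+1 e) * y jo ^+ (e jo - a.+1).
  have tailE e : tail j e = y jo ^+ e jo * tail j.+1 e.
    rewrite /tail (bigD1 jo) //=; congr (_ * _); apply: eq_bigl => i.
    by rewrite ltn_neqAle -val_eqE /= eq_sym andbC.
  have fact : \sum_(e in A) c e *: tail j e
      = y jo ^+ a * (\sum_(e in B) c e *: tail j.+1 e + y jo * \sum_(e in A) rest e).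
    rewrite mulrDr !mulr_sumr (bigID (fun e => e \in B)) /=; congr (_ + _).
      rewrite [LHS](eq_bigl (fun e => e \in B)); last first.
        by move=> e; rewrite !inE; case: (e \in A).
      apply: eq_bigr => e; rewrite !inE tailE => /and3P[_ /eqP -> _].
      by rewrite -scalerAr.
    rewrite [RHS](bigID (fun e => e \in B)) /= [X in _ = X + _]big1; last first.
      by move=> e /andP[_ eB]; rewrite /rest eB !mulr0.
    rewrite add0r; apply: eq_bigr => e /andP[eA neB]; rewrite /rest (negPf neB) tailE.
    have [ce|ce] := eqVneq (c e) 0; first by rewrite ce !scale0r mul0r !mulr0.
    have lt : (a < e jo)%N.
      have := mine2 e; rewrite /supp eA ce => /(_ isT); rewrite leq_eqVlt => /orP[/eqP ea|//].
      by move: neB; rewrite !inE eA ce andbT /= => /eqP[]; apply: val_inj.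
    rewrite -{1}(subnKC lt) exprD exprS -!scalerAl -!scalerAr; congr (_ *: _); ring.
  move: QA; rewrite fact => /pQ[/(prime_exp (prQ j (ltnW jN)))//|/sQ].
  have [_ addQ mulQ] := iQ'.
  have restQ : Q j.+1 (y jo * \sum_(e in A) rest e) by rewrite mulrC; apply: mulQ.
  move=> h; have := addQ _ _ h (ideal_opp iQ' restQ); by rewrite addrK.
(* A single exponent vector remains, so a nonzero constant would lie in a prime. *)
have [A [[e eA ce] agree QA]] := key n.+1 (leqnn _).
have AE : A = [set e].
  apply/setP => e'; rewrite inE; apply/idP/eqP => [e'A|->//].
  by apply/ffunP => i; apply: agree.
have [[_ _ mulQ] n1 _] := prQ n.+1 ltN; apply: n1.
move: QA; rewrite AE big_set1 /tail big_pred0 => [h|i]; last by rewrite leqNgt ltn_ord.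
by have := mulQ (c e)^-1%:MP _ h; rewrite mul_mpolyC scalerA mulVf // scale1r.
Qed.

Definition hits T (m : 'X_{1..n}) := [exists i in T, m i != 0%N].

Definition kill T : n.-tuple S := [tuple (if i \in T then 0 else 'X_i) | i < n].

(** The ideal generated by the variables in [T], as the kernel of an endomorphism of a domain, which
    makes primality immediate. *)
Definition var_ideal T : pset k n := fun p => p \mPo kill T = 0.

Lemma kill_mon T m : 'X_[m] \mPo kill T = if hits T m then 0 else 'X_[m] :> S.
Proof.
rewrite comp_mpolyX; case: ifP => [/exists_inP[i iT mi]|/negbT nh].
  by rewrite (bigD1 i) //= tnth_mktuple iT expr0n (negPf mi) mul0r.
rewrite mpolyXE_id; apply: eq_bigr => i _; rewrite tnth_mktuple.
case: ifP => // iT; suff -> : m i = 0%N by rewrite !expr0.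
by apply/eqP; apply: contraNT nh => mi; apply/exists_inP; exists i.
Qed.

Lemma var_idealP T p : var_ideal T p <-> forall m, p@_m != 0 -> hits T m.
Proof.
have coefE m : (p \mPo kill T)@_m = if hits T m then 0 else p@_m.
  rewrite comp_mpolyEX raddf_sum /=.
  under eq_bigr => e _ do rewrite kill_mon mcoeffZ (fun_if (mcoeff m)) mcoeff0 mcoeffX.
  have -> : p@_m = \sum_(e <- msupp p) p@_e * (e == m)%:R.
    by rewrite {1}(mpolyE p) raddf_sum; apply: eq_bigr => e _; rewrite /= mcoeffZ mcoeffX.
  case: ifP => hm; last first.
    apply: eq_bigr => e _; case: ifP => // he; case: eqP => // eem.
    by rewrite -eem he in hm.
  rewrite big1 // => e _; case: ifP => [_|he]; first by rewrite mulr0.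
  by case: eqP => [eem|]; rewrite ?mulr0 // -eem he in hm *.
split=> [p0 m|h].
  by have := coefE m; rewrite p0 mcoeff0; case: ifP => [//|_ <-]; rewrite eqxx.
apply/mpolyP => m; rewrite coefE mcoeff0; case: ifP => // nh.
by apply/eqP; apply: contraFT nh; apply: h.
Qed.

Lemma var_ideal_prime T : prime_ideal (var_ideal T).
Proof.
rewrite /var_ideal; split; first split.
- exact: raddf0.
- by move=> a b a0 b0; rewrite raddfD /= a0 b0 addr0.
- by move=> r a a0; rewrite rmorphM /= a0 mulr0.
- by rewrite rmorph1; apply/eqP; apply: oner_neq0.
by move=> a b; rewrite rmorphM /= => /eqP; rewrite mulf_eq0 => /orP[] /eqP; [left|right].
Qed.

Lemma var_ideal_grow T j : j \notin T ->
  psubset (var_ideal T) (var_ideal (j |: T)) /\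
  exists x, var_ideal (j |: T) x /\ ~ var_ideal T x.
Proof.
move=> jT; split.
  move=> p /var_idealP h; apply/var_idealP => m /h/exists_inP[i iT mi].
  by apply/exists_inP; exists i; rewrite // !inE iT orbT.
exists 'X_j; split.
  apply/var_idealP => m; rewrite mcoeffX; have [<- _|] := eqVneq U_(j)%MM m; last by rewrite eqxx.
  by apply/exists_inP; exists j; rewrite ?setU11 // mnm1E eqxx.
move/var_idealP/(_ U_(j)%MM); rewrite mcoeffX eqxx => /(_ (oner_neq0 _))/exists_inP[i iT].
by rewrite mnm1E; have [e|] := eqVneq j i; [rewrite e iT in jT|rewrite eqxx].
Qed.

Lemma chain_extend P P' c : prime_chain_to P c -> prime_ideal P' -> psubset P P' ->
  (exists x, P' x /\ ~ P x) -> prime_chain_to P' c.+1.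
Proof.
move=> [Q [prQ incQ eqQ]] prP' sPP' [x [xP' xP]].
exists (fun i => if (i <= c)%N then Q i else P'); split=> [i _|i|z].
- by case: ifP => [/prQ|].
- rewrite ltnS => ic; rewrite ic; case: ltnP => [lt|ge]; first exact: incQ.
  have -> : i = c by apply/eqP; rewrite eqn_leq ic ge.
  split=> [z /eqQ/sPP'//|]; exists x; split=> //; by move/eqQ.
by rewrite ltnn.
Qed.

(** The chain is prolonged by adjoining the remaining [n - #|T|] variables one at a time, and the
    total length is at most [n]. *)
Lemma chain_to_var_ideal T c : prime_chain_to (var_ideal T) c -> (c <= #|T|)%N.
Proof.
elim: {T}#|~: T| {-2}T (erefl #|~: T|) c => [|l IHl] T cT c ch; last first.
  have /card_gt0P[j] : (0 < #|~: T|)%N by rewrite cT.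
  rewrite inE => jT; have [sub str] := var_ideal_grow jT.
  have := IHl (j |: T) _ c.+1 (chain_extend ch (var_ideal_prime _) sub str).
  rewrite cardsU1 jT add1n ltnS; apply.
  have := cardsC (j |: T); have := cardsC T; rewrite cT cardsU1 jT; lia.
have -> : #|T| = n by have := cardsC T; rewrite cT card_ord; lia.
have [Q [prQ incQ _]] := ch; exact: (@strict_chain_le Q).
Qed.

End KrullDimension.

Lemma height_le_hitting (k : fieldType) n (G : seq 'X_{1..n}) c (T : {set 'I_n}) :
  ideal_height (@monomial_ideal k n G) c -> (forall g, g \in G -> hits T g) ->
  (c <= #|T|)%N.
Proof.
move=> [ch _] hT; apply: (@chain_to_var_ideal k); apply: ch; first exact: var_ideal_prime.
move=> _ [a ->]; have [[P0 PD PM] _ _] := var_ideal_prime k T.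
apply: big_ind => // i _; apply: PM; apply/var_idealP => m.
have lt : (i < size G)%N by rewrite (leq_trans (ltn_ord i)) ?size_map.
rewrite (nth_map 0%MM) // mcoeffX.
have [<- _|] := eqVneq (nth 0%MM G i) m; last by rewrite eqxx.
by apply: hT; apply: mem_nth.
Qed.

(** * The theorem *)

Section MonomialIdeals.
Variables (k : fieldType) (n : nat).
Local Notation S := {mpoly k[n]}.
Implicit Types (M : seq 'X_{1..n}) (p : S) (d : 'X_{1..n}).

Lemma ideal_gen_ideal (fs : seq S) : is_ideal (ideal_gen fs).
Proof.
split.
- by exists (fun=> 0); rewrite big1 // => i _; rewrite mul0r.
- move=> _ _ [a ->] [b ->]; exists (fun i => a i + b i).
  by rewrite -big_split; apply: eq_bigr => i _; rewrite mulrDl.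
move=> r _ [a ->]; exists (fun i => r * a i).
by rewrite mulr_sumr; apply: eq_bigr => i _; rewrite mulrA.
Qed.

Lemma monomial_idealP M p :
  monomial_ideal M p <-> forall d, p@_d != 0 -> has (fun e => (e <= d)%MM) M.
Proof.
split=> [[a ->] d nz|h].
  apply: contraNT nz => /hasPn no; rewrite raddf_sum big1 // => i _ /=.
  have lt : (i < size M)%N by rewrite (leq_trans (ltn_ord i)) ?size_map.
  by rewrite (nth_map 0%MM) // mcoeffMX_if (negPf (no _ (mem_nth _ lt))).
have [I0 ID IM] := ideal_gen_ideal [seq 'X_[e] : S | e <- M].
rewrite (mpolyE p) big_seq; apply: big_ind => // d.
rewrite mcoeff_msupp => /h/hasP[e eM le].
have lt : (index e M < size M)%N by rewrite index_mem.
have := monomial_ideal_gen (p@_d *: 'X_[(d - e)%MM] : S) (Ordinal lt).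
by rewrite /gen nth_index // -scalerAl -mpolyXD submK.
Qed.

(** A monomial that divides a product and is coprime to one factor divides the other. *)
Lemma regular_monomials M : ~ monomial_ideal M (1 : S) ->
  (forall i j, (i < j < size M)%N -> forall x, (nth 0%MM M i x == 0%N) || (nth 0%MM M j x == 0%N)) ->
  regular_seq [seq 'X_[e] : S | e <- M].
Proof.
move=> n1 cop; split=> // j; rewrite size_map => ltj g.
rewrite -map_take (nth_map 0%MM) // => /monomial_idealP h; apply/monomial_idealP => d nz.
have /h/hasP[e eM le] : ('X_[nth 0%MM M j] * g)@_(nth 0%MM M j + d) != 0.
  by rewrite mulrC mcoeffMX.
apply/hasP; exists e => //; apply/mnm_lepP => x; have /mnm_lepP/(_ x) := le.
rewrite mnmDE; set i := index e (take j M).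
have lti : (i < j)%N by move: eM; rewrite -index_mem size_take ltj.
have ei : e = nth 0%MM M i by rewrite -(nth_take _ lti) nth_index.
have /orP[] : (nth 0%MM M i x == 0%N) || (nth 0%MM M j x == 0%N).
  by apply: cop; rewrite lti.
- by rewrite -ei => /eqP ->.
by move/eqP->.
Qed.

End MonomialIdeals.

(** * From the polarized family back to the ideal *)

Section Conclusion.
Variables (k : fieldType) (n : nat) (G : seq 'X_{1..n}) (c : nat).
Local Notation m := (size G).
Local Notation J := (min_gens (@polar n G) setT).
Hypothesis ht : ideal_height (@monomial_ideal k n G) c.

Lemma disjoint_complete_intersection : pairwise_disjoint (@polar n G) J ->
  complete_intersection (@monomial_ideal k n G).
Proof.
move=> dJ; pose M := [seq gen j | j <- enum J].
have memM p : monomial_ideal G p <-> @monomial_ideal k n M p.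
  split=> /monomial_idealP h; apply/monomial_idealP => d /h/hasP[e eM le]; apply/hasP.
    have lt : (index e G < m)%N by rewrite index_mem.
    have [l lJ] := min_gens_dominates (@polar n G) (in_setT (Ordinal lt)).
    rewrite polar_sub {2}/gen nth_index // => le'; exists (gen l).
      by apply: map_f; rewrite mem_enum.
    exact: lepm_trans le' le.
  case/mapP: eM => j _ ej; exists e => //.
  by rewrite ej; apply: mem_nth.
exists [seq 'X_[e] | e <- M]; split; first exact: memM.
apply: regular_monomials => [/memM|].
  by have [_ [P [[_ n1 _] sP _]]] := ht => /sP.
move=> i j /andP[ij]; rewrite size_map => ltj x.
have lti := ltn_trans ij ltj.
have j0 : 'I_m by case: (enum J) ltj => // j0 _ _; exact: j0.
rewrite !(nth_map j0) //.
have memJ h : (h < size (enum J))%N -> nth j0 (enum J) h \in J.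
  by move=> lth; rewrite -mem_enum mem_nth.
have := dJ _ _ (memJ i lti) (memJ j ltj).
rewrite nth_uniq ?enum_uniq // (ltn_eqF ij) => /(_ isT).
by rewrite polar_disjoint => /forallP.
Qed.

(** Projected to the original variables, a hitting set of the polarized generators still hits and
    does not grow. *)
Lemma polar_hits_ge : hits_ge (@polar n G) J c.
Proof.
move=> T hT; apply: leq_trans (leq_imset_card (fun p => p.1) (mem T)).
apply: (height_le_hitting ht) => g gG.
have lt : (index g G < m)%N by rewrite index_mem.
have [l lJ slj] := min_gens_dominates (@polar n G) (in_setT (Ordinal lt)).
have /set0Pn[p /setIP[pl pT]] := hT l lJ.
apply/exists_inP; exists p.1; first exact: imset_f.
have := subsetP slj p pl; rewrite inE /gen /= nth_index // => ltp.
by rewrite -lt0n; apply: leq_ltn_trans ltp.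
Qed.

Hypothesis nci : ~ complete_intersection (@monomial_ideal k n G).

Lemma polar_bound c' : hits_ge (@polar n G) J c' ->
  betti_bound m c' (fbetti k (@polar n G) setT).
Proof.
move=> hJ; apply: (bound_mono (H' := fbetti k (@polar n G) J)).
  by move=> i _; rewrite -fbetti_min_gens.
apply: family_bound => //; first exact: min_gens_antichain.
by have [/disjoint_complete_intersection|] := disjoint_or_intersecting (@polar n G) J.
Qed.

(** An empty hitting set would leave no generators, and the zero ideal is a complete intersection.
    This serves the case [c = 0]. *)
Lemma polar_hits_ge1 : hits_ge (@polar n G) J 1.
Proof.
move=> T hT; rewrite lt0n cards_eq0; apply/eqP => T0.
apply: nci; apply: disjoint_complete_intersection => i j iJ _ _.
by have := hT i iJ; rewrite T0 setI0 eqxx.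
Qed.

End Conclusion.

Lemma seq_sum_stable a b H : (a <= b)%N -> (forall i, (a < i)%N -> H i = 0%N) ->
  seq_sum b H = seq_sum a H.
Proof.
move=> ab H0; rewrite /seq_sum [RHS](big_ord_widen b.+1 H) ?ltnS //.
rewrite [LHS](bigID (fun i : 'I_b.+1 => (i < a.+1)%N)) /= [X in (_ + X)%N]big1 ?addn0 //.
by move=> i; rewrite -leqNgt; apply: H0.
Qed.

Lemma seq_poly_stable a b H : (a <= b)%N -> (forall i, (a < i)%N -> H i = 0%N) ->
  seq_poly b H = seq_poly a H.
Proof.
move=> ab H0; apply/polyP => i; rewrite !coef_poly !ltnS.
case: leqP => [ib|bi]; case: leqP => [ia|ai] //; first by rewrite H0.
by have := leq_trans ia ab; rewrite leqNgt bi.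
Qed.

(** The Taylor complex and the resolution may have different lengths; this lets them be compared at
    the larger one. *)
Lemma bound_stable a b c H : (a <= b)%N -> (forall i, (a < i)%N -> H i = 0%N) ->
  betti_bound a c H <-> betti_bound b c H.
Proof. by move=> ab H0; rewrite /betti_bound (seq_sum_stable ab) // (seq_poly_stable ab). Qed.

Lemma seq_poly_horner1 a H : (seq_poly a H).[1] = (seq_sum a H)%:R.
Proof.
rewrite /seq_poly horner_poly /seq_sum natr_sum; apply: eq_bigr => i _.
by rewrite expr1n mulr1.
Qed.

Lemma resolution_bound (k : fieldType) n (G : seq 'X_{1..n}) c
    (F : min_free_resolution (@monomial_ideal k n G)) :
  betti_bound (size G) c (fbetti k (@polar n G) setT) -> betti_bound (res_len F) c (res_rank F).
Proof.
move=> bd.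
apply/(bound_stable c (leq_maxr (size G) (res_len F))); first exact: res_rank_vanish.
apply: (bound_mono (H' := fbetti k (@polar n G) setT)).
  by move=> i _; apply: fbetti_le_res_rank.
apply/(bound_stable c (leq_maxl (size G) (res_len F))) => // i lt.
apply/eqP; rewrite -leqn0.
have <- : 'C(#|[set: 'I_(size G)]|, i) = 0%N by rewrite bin_small // cardsT card_ord.
rewrite -(sum_card_level (@polar n G)); apply: leq_sum => b _.
by rewrite -(hdimE k i (weight_fam_convex (b := b))) -addnA leq_addr.
Qed.

Theorem theorem1p1 (k : fieldType) (n : nat) (G : seq 'X_{1..n}) (c : nat)
    (F : min_free_resolution (@monomial_ideal k n G)) :
  ideal_height (@monomial_ideal k n G) c ->
  ~ complete_intersection (@monomial_ideal k n G) ->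
  (2 ^ c + 2 ^ c.-1 <= betti_sum F)%N /\
  (betti_sum F = (2 ^ c + 2 ^ c.-1)%N <->
     (betti_poly F * ('X + 1) ^+ 2
        = (1 + 3%:R *: 'X + 2%:R *: 'X ^+ 2) * ('X + 1) ^+ c
      \/ betti_poly F * ('X + 1) ^+ 3
        = (1 + 5%:R *: 'X + 5%:R *: 'X ^+ 2 + 'X ^+ 3) * ('X + 1) ^+ c)).
Proof.
move=> ht nci.
have eqP_ : betti_poly F = seq_poly (res_len F) (res_rank F) by rewrite /seq_poly poly_def.
have [le1 _] := resolution_bound F (polar_bound ht nci (polar_hits_ge1 ht nci)).
have [leS eqS] := resolution_bound F (polar_bound ht nci (polar_hits_ge ht)).
rewrite -[seq_sum _ _]/(betti_sum F) in le1 leS eqS.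
(* At [t = 1] the fixed factors are 4 against 6, or 8 against 12; both give
   [2 * betti_sum F = 3 * 2^c]. *)
have back : (betti_poly F * ('X + 1) ^+ 2
        = (1 + 3%:R *: 'X + 2%:R *: 'X ^+ 2) * ('X + 1) ^+ c
      \/ betti_poly F * ('X + 1) ^+ 3
        = (1 + 5%:R *: 'X + 5%:R *: 'X ^+ 2 + 'X ^+ 3) * ('X + 1) ^+ c) ->
    (2 * betti_sum F = 3 * 2 ^ c)%N.
  have two : (1 + 1 : int) = 2%:R by [].
  have twoX : (2%:R ^+ c : int) = (2 ^ c)%N%:R by rewrite natrX.
  case=> /(congr1 (fun p : {poly int} => p.[1]));
  rewrite eqP_ !(hornerM, horner_exp, hornerD, hornerZ, hornerX, hornerC) seq_poly_horner1;
  rewrite two twoX -[seq_sum _ _]/(betti_sum F) !mulr1 !natz;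
  by move: (betti_sum F) (2 ^ c)%N => u w; lia.
have forth : (2 * betti_sum F = 3 * 2 ^ c)%N ->
    (betti_poly F * ('X + 1) ^+ 2
        = (1 + 3%:R *: 'X + 2%:R *: 'X ^+ 2) * ('X + 1) ^+ c
      \/ betti_poly F * ('X + 1) ^+ 3
        = (1 + 5%:R *: 'X + 5%:R *: 'X ^+ 2 + 'X ^+ 3) * ('X + 1) ^+ c).
  rewrite eqP_ ![('X + 1)]addrC => /eqS[e|[d -> e]]; [left|right].
    by rewrite exprS expr1 mulrA e !scaler_nat; ring.
  by rewrite e (exprD _ 3 d) mulrA; ring.
case: c leS eqS back forth {ht} => [|c'] leS eqS back forth /=.
  (* At [c = 0] the truncated [c.-1] makes the stated bound 2, but the bound for height 1 gives a
     sum of at least 3. Equality fails, and so do both identities, which would require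
     [2 * betti_sum F = 3]. *)
  split; first by move: le1; rewrite expn0 expn1; lia.
  split=> [e|/back]; last by rewrite expn0; lia.
  by move: le1; rewrite e expn0 expn1; lia.
have E := expnS 2 c'; split; first by move: leS E; clear; lia.
split=> [e|/back e]; last by move: e E; clear; lia.
by apply: forth; rewrite e; move: E; clear; lia.
Qed.
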